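(* Let $\omega_1,\omega_2\in\mathbb C$ with $\tau=\omega_2/\omega_1$, $\Im\tau>0$, $\lambda(P)=\wp(z_P)+c$ on $\mathbb C/(2\omega_1\mathbb Z+2\omega_2\mathbb Z)$, and let $$x_3=\oint_a\lambda\,\phi_2,\qquad y_2=\sqrt2\operatorname{res}_{\infty^0}\sqrt{\lambda}\,\phi_3,\qquad y_3=\oint_a\lambda\,\phi_3 .$$ Then, with $t_2=\frac1{\sqrt2\,\omega_1}$ and $'=\frac{d}{d\tau}$, $$x_3=y_2=\frac{\mathrm i\pi^3}3t_2^3E_2'(\tau),\qquad y_3=-\frac{\pi^4}6t_2^4E_2''(\tau).$$ In particular, the following Ramanujan identities hold: $$\frac1{2\pi\mathrm i}E_2'=\frac1{12}(E_2^2-E_4),\qquad\frac1{2\pi\mathrm i}E_4'=\frac13(E_2E_4-E_6),\qquad\frac1{2\pi\mathrm i}E_6'=\frac12(E_2E_6-E_4^2).$$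
   Context: $\wp,\zeta$ are the Weierstrass functions of the lattice $2\omega_1\mathbb Z+2\omega_2\mathbb Z$ and $g_2=60\sum_{w\ne0}w^{-4}$; $c$ is a constant. $\infty^0$ is the point $z=0$ (double pole of $\lambda$), where $\sqrt\lambda$ denotes $1/z_\infty$ with $z_\infty=\lambda^{-1/2}$ the local parameter satisfying $z_\infty\sim z$. The cycles are $a=[x,x+2\omega_1]$, $b=[x,x+2\omega_2]$. $W(P,Q)=\big(\wp(z_P-z_Q)+\frac{\zeta(\omega_1)}{\omega_1}\big)dz_Pdz_Q$ is the canonical bidifferential. The differentials are $\phi_2(P)=\sqrt2\operatorname{res}_{Q=\infty^0}\sqrt{\lambda(Q)}W(P,Q)$ and $\phi_3(P)=\oint_{a}\lambda(Q)W(P,Q)$; explicitly $\phi_2=\sqrt2\big(\wp(z)+\frac{\zeta(\omega_1)}{\omega_1}\big)dz$ and $\phi_3=\Big(4\omega_1\wp^2(z)-4\zeta(\omega_1)\wp(z)+2\wp'(z)\big(\omega_1\zeta(z)-\zeta(\omega_1)z\big)-\frac{g_2}2\omega_1-2\frac{\zeta^2(\omega_1)}{\omega_1}\Big)dz$. Eisenstein series, with $q=e^{2\pi\mathrm i\tau}$: $E_2=1-24\sum_{n\ge1}\frac{nq^n}{1-q^n}$, $E_4=1+240\sum_{n\ge1}\frac{n^3q^n}{1-q^n}$, $E_6=1-504\sum_{n\ge1}\frac{n^5q^n}{1-q^n}$. *)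

(* Defs.v *)
From Stdlib Require Export Reals ZArith List.
From Coquelicot Require Export Coquelicot.
Export ListNotations.

Open Scope R_scope.
Open Scope C_scope.

Definition Cexp (z : C) : C := (exp (Re z) * cos (Im z), exp (Re z) * sin (Im z))%R.

(** Net of finite subsets of [T], represented by duplicate-free lists ordered by inclusion:
    [filterlim] along it is unconditional summation. *)
Definition finite_subsets {T : Type} (P : list T -> Prop) : Prop :=
  exists F0 : list T, forall F : list T, NoDup F -> incl F0 F -> P F.

Definition sum_list {T : Type} (f : T -> C) (F : list T) : C :=
  fold_right (fun t s => f t + s) 0 F.

Definition is_usum {T : Type} (f : T -> C) (s : C) : Prop :=
  filterlim (sum_list f) finite_subsets (locally (T := C_UniformSpace) s).

Definition usum {T : Type} (f : T -> C) : C :=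
  iota (T := C_R_CompleteNormedModule) (is_usum f).

Definition Cseries (a : nat -> C) : C :=
  iota (T := C_R_CompleteNormedModule)
    (is_series (K := C_AbsRing) (V := C_NormedModule) a).

Definition lattice_pt (w1 w2 : C) (p : Z * Z) : C :=
  2 * IZR (fst p) * w1 + 2 * IZR (snd p) * w2.

Definition nonzero_part (f : Z * Z -> C) (p : Z * Z) : C :=
  match p with
  | (0%Z, 0%Z) => 0
  | _ => f p
  end.

Definition wp (w1 w2 z : C) : C :=
  / z ^ 2 + usum (nonzero_part (fun p =>
    let w := lattice_pt w1 w2 p in / (z - w) ^ 2 - / w ^ 2)).

Definition wzeta (w1 w2 z : C) : C :=
  / z + usum (nonzero_part (fun p =>
    let w := lattice_pt w1 w2 p in / (z - w) + / w + z / w ^ 2)).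

(** A differential [f dz] is represented by its coefficient [f] in the coordinate [z]. *)

Definition is_cycle_int (f : C -> C) (x w v : C) : Prop :=
  is_RInt (V := C_R_NormedModule) (fun t : R => f (x + t * w) * w) 0%R 1%R v.

Definition cycle_int (f : C -> C) (x w : C) : C :=
  RInt (V := C_R_CompleteNormedModule) (fun t : R => f (x + t * w) * w) 0%R 1%R.

(** [f] is holomorphic on a punctured disc around [z0], and [v] is the residue of [f dz]
    there. *)
Definition is_residue (f : C -> C) (z0 v : C) : Prop :=
  exists r0 : posreal,
    (forall z : C, (0 < Cmod (z - z0) < r0)%R ->
       ex_derive (K := C_AbsRing) (V := C_NormedModule) f z) /\
    (forall r : R, (0 < r < r0)%R ->
       is_RInt (V := C_R_NormedModule)
         (fun t : R => f (z0 + r * Cexp (Ci * t)) * (Ci * r * Cexp (Ci * t)))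
         0%R (2 * PI)%R (2 * PI * Ci * v)).

Definition residue (f : C -> C) (z0 : C) : C :=
  iota (T := C_R_CompleteNormedModule) (is_residue f z0).

(** The line through [x] in the direction of the period [2 w1] contains no lattice point. *)
Definition avoids_lattice (w1 w2 x : C) : Prop :=
  forall (t : R) (p : Z * Z), x + t * (2 * w1) <> lattice_pt w1 w2 p.

Definition lambda (w1 w2 c z : C) : C := wp w1 w2 z + c.

Definition W (w1 w2 zP zQ : C) : C := wp w1 w2 (zP - zQ) + wzeta w1 w2 w1 / w1.

(** [zinf] is the local parameter lambda^(-1/2) at the point z = 0, on the branch with
    zinf ~ z; so the function written sqrt(lambda) is [/ zinf]. *)
Definition is_zinf (lam zinf : C -> C) : Prop :=
  locally' (T := C_UniformSpace) (RtoC 0) (fun z => zinf z ^ 2 = / lam z) /\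
  filterlim (fun z => zinf z / z)
    (locally' (T := C_UniformSpace) (RtoC 0)) (locally (T := C_UniformSpace) (RtoC 1)).

Definition phi2 (w1 w2 : C) (zinf : C -> C) (zP : C) : C :=
  sqrt 2 * residue (fun zQ => / zinf zQ * W w1 w2 zP zQ) 0.

(** [x] is the base point of the cycle a = [[x, x + 2 w1]] over which [Q] runs. The pole of
    [W] at [P = Q] means that [P] may not lie on that cycle modulo the lattice: to integrate
    against [phi3] over a, use a parallel representative of a with another base point. *)
Definition phi3 (w1 w2 c x zP : C) : C :=
  cycle_int (fun zQ => lambda w1 w2 c zQ * W w1 w2 zP zQ) x (2 * w1).

Definition qnome (tau : C) : C := Cexp (2 * PI * Ci * tau).

(** sum_(n >= 1) n^k q^n / (1 - q^n), with n = m + 1 *)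
Definition lambert (k : nat) (tau : C) : C :=
  Cseries (fun m => INR (S m) ^ k * qnome tau ^ S m / (1 - qnome tau ^ S m)).

Definition E2 (tau : C) : C := 1 - 24 * lambert 1 tau.
Definition E4 (tau : C) : C := 1 + 240 * lambert 3 tau.
Definition E6 (tau : C) : C := 1 - 504 * lambert 5 tau.

(** [C_derive] computes a difference quotient in the real direction only; it is the complex
    derivative under [C_differentiable]. *)
Definition C_differentiable (f : C -> C) (z : C) : Prop :=
  ex_derive (K := C_AbsRing) (V := C_NormedModule) f z.

(* Main.v *)
(** Write [q = e(tau)] with [e(s) = exp (2 pi i s)], [z = 2 w1 s] and [u_n = q^n / (1 - q^n)].
    Summing the lattice row by row with [sum_m (s - m)^(-2) = pi^2 / sin^2 (pi s)] gives, in the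
    strip [0 < Im s < Im tau], [wp(z) = (pi i / w1)^2 (E2 / 12 + sum_n a_n e(n s))] with
    [a_n = n / (1 - q^n)], and [zeta(w1) = pi^2 E2 / (12 w1)], so that [W(P, Q)] is the same series
    without its constant term.  All cycle integrals are then instances of Parseval's formula:
    [x3] and [y2] are multiples of [sum a_n a_(-n)], and [y3] is a multiple of
    [sum a_n^2 a_(-n)]; these are the first and second derivatives of
    [sum n q^n / (1 - q^n) = sum_(n, d) n q^(n d)].

    The Ramanujan identities are relations between [S_k = sum n^k u_n] and [q dS_k/dq].  They
    follow from [u_a u_b = u_(a+b) (1 + u_a + u_b)]: multiplying by a symmetric polynomial weight
    [k(a, b)] and summing, the quadratic terms on the two sides combine to the weight
    [k(a, b) - k(a - b, b)], and the linear terms to Faulhaber sums.  The weights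
    [(a^2 + ab + b^2)^j] with [j = 1, 2, 3] give the three derivatives, and [(ab(a + b))^2] gives
    the relation [E8 = E4^2] that eliminates [S_7]. *)

(* On the weights: comparing the two sides turns [k(x, y)] into
   [sigma(x, y) = k(x, y) - k(x - y, y)]. Since [x^2 + x y + y^2] becomes [x^2 - x y + y^2] at
   [(x - y, y)], the difference of the [j]-th powers is symmetric and odd in each variable, so it
   only produces products of sums [S_k] with odd [k]; the diagonal leaves [k(0, x) = x^(2 j)], which
   is the derivative term. For [(x y (x + y))^2] the difference is [4 x^3 y^3] and [k(0, x) = 0]: a
   relation without derivative.

   The analytic part has two obstacles. The lattice sum of [w^(-2)] does not converge absolutely, so
   it is summed only by rows, after subtraction from an absolutely convergent combination. A Fourier
   expansion holds only in an open strip between two lattice rows, so a base point is recorded as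
   the number of its strip and a position inside it. In the end nothing depends on these data:
   [a_0 = 0] removes [c] and [E2 / 12] from every product of coefficients, and the exponentials of
   the positions cancel. *)
Require Import Defs.
From Stdlib Require Import Lra Lia Psatz Classical ClassicalEpsilon FunctionalExtensionality Permutation.

(** * Unconditional summation *)

(** Excluded middle makes every index type decidable, so that finite sets can be handled as lists
    with [nodup] and [in_dec]. *)
Lemma eqdec {T : Type} (x y : T) : {x = y} + {x <> y}.
Proof. apply excluded_middle_informative. Qed.

Global Instance finite_subsets_filter {T : Type} : ProperFilter (@finite_subsets T).
Proof.
  split.
  - intros P [F0 H]. exists (nodup eqdec F0). apply H.
    + apply NoDup_nodup.
    + intros x Hx. apply nodup_In. exact Hx.
  - split.
    + exists nil. auto.
    + intros P Q [F1 H1] [F2 H2]. exists (F1 ++ F2). intros F HF HI. split.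
      * apply H1; auto. intros x Hx. apply HI, in_or_app; auto.
      * apply H2; auto. intros x Hx. apply HI, in_or_app; auto.
    + intros P Q HPQ [F0 H]. exists F0. auto.
Qed.

Lemma is_usum_eps {T : Type} (f : T -> C) (s : C) :
  is_usum f s <-> forall eps : R, (0 < eps)%R -> exists F0 : list T,
    forall F, NoDup F -> incl F0 F -> (Cmod (sum_list f F - s) < eps)%R.
Proof.
  unfold is_usum. 
  rewrite (filterlim_locally_ball_norm (K := C_AbsRing) (U := C_NormedModule) (F := finite_subsets)).
  split.
  - intros H eps Heps. exact (H (mkposreal eps Heps)).
  - intros H [eps Heps]. exact (H eps Heps).
Qed.

Lemma is_usum_unique {T : Type} (f : T -> C) (s s' : C) :
  is_usum f s -> is_usum f s' -> s = s'.
Proof.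
  intros H H'. apply (filterlim_locally_unique (K := C_AbsRing) (V := C_NormedModule) (F := finite_subsets) (sum_list f)); assumption.
Qed.

Lemma usum_unique {T : Type} (f : T -> C) (s : C) : is_usum f s -> usum f = s.
Proof.
  intros H. unfold usum. apply (iota_unique (V := C_R_CompleteNormedModule)); [|exact H].
  intros y Hy. exact (is_usum_unique _ _ _ Hy H).
Qed.

Lemma is_usum_ext {T : Type} (f g : T -> C) (s : C) :
  (forall t, f t = g t) -> is_usum f s -> is_usum g s.
Proof. intros H. rewrite (functional_extensionality f g H). auto. Qed.

Definition rsum {T : Type} (g : T -> R) (F : list T) : R :=
  fold_right (fun t s => g t + s)%R 0%R F.

(** For nonnegative [g], bounded finite sums already mean convergence; in this form majorants can be
    combined without naming a limit. *)
Definition bsum {T : Type} (g : T -> R) : Prop :=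
  exists B : R, forall F, NoDup F -> (rsum g F <= B)%R.

Definition asum {T : Type} (f : T -> C) : Prop := bsum (fun t => Cmod (f t)).

Lemma rsum_le {T : Type} (g h : T -> R) F :
  (forall t, g t <= h t)%R -> (rsum g F <= rsum h F)%R.
Proof. intros H. induction F as [|t F IH]; simpl; [lra|]. specialize (H t); lra. Qed.

Lemma rsum_scal {T : Type} (g : T -> R) c F : (rsum (fun t => c * g t)%R F = c * rsum g F)%R.
Proof. induction F as [|t F IH]; simpl; [ring|]. rewrite IH; ring. Qed.

Lemma rsum_plus {T : Type} (g h : T -> R) F :
  (rsum (fun t => g t + h t)%R F = rsum g F + rsum h F)%R.
Proof. induction F as [|t F IH]; simpl; [ring|]. rewrite IH; ring. Qed.

Lemma rsum_nonneg {T : Type} (g : T -> R) F : (forall t, 0 <= g t)%R -> (0 <= rsum g F)%R.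
Proof. intros H. induction F as [|t F IH]; simpl; [lra|]. specialize (H t); lra. Qed.

Lemma rsum_app {T : Type} (g : T -> R) F G : rsum g (F ++ G) = (rsum g F + rsum g G)%R.
Proof. induction F as [|t F IH]; simpl; [ring|]. rewrite IH; ring. Qed.

Lemma rsum_map {T U : Type} (g : T -> R) (h : U -> T) F :
  rsum g (map h F) = rsum (fun u => g (h u)) F.
Proof. induction F as [|t F IH]; simpl; congruence. Qed.

Lemma rsum_perm {T : Type} (g : T -> R) F G : Permutation F G -> rsum g F = rsum g G.
Proof. induction 1; simpl; lra. Qed.

Lemma sum_list_app {T : Type} (g : T -> C) F G : sum_list g (F ++ G) = sum_list g F + sum_list g G.
Proof. induction F as [|t F IH]; simpl; [ring|]. unfold sum_list in *. rewrite IH; ring. Qed.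

Lemma sum_list_perm {T : Type} (g : T -> C) F G : Permutation F G -> sum_list g F = sum_list g G.
Proof. unfold sum_list. induction 1; simpl; try congruence. ring. Qed.

Lemma sum_list_plus {T : Type} (g h : T -> C) F :
  sum_list (fun t => g t + h t) F = sum_list g F + sum_list h F.
Proof. unfold sum_list. induction F as [|t F IH]; simpl; [ring|]. rewrite IH; ring. Qed.

Lemma sum_list_scal {T : Type} (g : T -> C) c F : sum_list (fun t => c * g t) F = c * sum_list g F.
Proof. unfold sum_list. induction F as [|t F IH]; simpl; [ring|]. rewrite IH; ring. Qed.

Lemma sum_list_map {T U : Type} (g : T -> C) (h : U -> T) F :
  sum_list g (map h F) = sum_list (fun u => g (h u)) F.
Proof. unfold sum_list. induction F as [|t F IH]; simpl; congruence. Qed.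

Lemma sum_list_ext_in {T : Type} (g h : T -> C) F :
  (forall t, In t F -> g t = h t) -> sum_list g F = sum_list h F.
Proof.
  unfold sum_list. induction F as [|t F IH]; simpl; intros H; auto.
  rewrite H by auto. rewrite IH; auto.
Qed.

Lemma sum_list_zero {T : Type} (g : T -> C) F : (forall t, In t F -> g t = 0) -> sum_list g F = 0.
Proof.
  unfold sum_list. induction F as [|t F IH]; simpl; intros H; auto.
  rewrite H, IH by auto. ring.
Qed.

Lemma Cmod_sum_list {T : Type} (g : T -> C) F : (Cmod (sum_list g F) <= rsum (fun t => Cmod (g t)) F)%R.
Proof.
  unfold sum_list. induction F as [|t F IH]; simpl.
  - rewrite Cmod_0; lra.
  - eapply Rle_trans; [apply Cmod_triangle|]. simpl in IH. lra.
Qed.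

Lemma split_incl {T : Type} (F0 F : list T) :
  NoDup F0 -> NoDup F -> incl F0 F ->
  exists F1, Permutation F (F0 ++ F1) /\ NoDup F1 /\ (forall t, In t F1 -> ~ In t F0).
Proof.
  intros N0 N HI.
  set (F1 := filter (fun t => if in_dec eqdec t F0 then false else true) F).
  assert (HF1 : forall t, In t F1 <-> In t F /\ ~ In t F0).
  { intros t. unfold F1. rewrite filter_In. destruct (in_dec eqdec t F0); intuition discriminate. }
  exists F1. split; [|split].
  - apply NoDup_Permutation; auto.
    + apply NoDup_app; auto.
      * apply NoDup_filter; auto.
      * intros t H1 H2. apply HF1 in H2. tauto.
    + intros t. rewrite in_app_iff, HF1. specialize (HI t). destruct (classic (In t F0)); tauto.
  - apply NoDup_filter; auto.
  - intros t Ht. apply HF1 in Ht. tauto.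
Qed.

(** A finite set whose sum is within [eps] of the supremum leaves at most [eps] for any disjoint
    set, since the union still stays below the supremum. *)
Lemma bsum_tail {T : Type} (g : T -> R) : (forall t, 0 <= g t)%R -> bsum g ->
  forall eps : R, (0 < eps)%R -> exists F0, NoDup F0 /\
    forall F, NoDup F -> (forall t, In t F -> ~ In t F0) -> (rsum g F <= eps)%R.
Proof.
  intros Hg [B HB] eps Heps.
  destruct (completeness (fun x => exists F, NoDup F /\ x = rsum g F)) as [L [HL1 HL2]].
  - exists B. intros x [F [HF ->]]. auto.
  - exists 0%R. exists nil. split; [constructor|reflexivity].
  - destruct (classic (exists F0, NoDup F0 /\ (L - eps < rsum g F0)%R)) as [[F0 [N0 H0]]|Hn].
    + exists F0. split; auto. intros F N HD.
      assert (H : (rsum g (F0 ++ F) <= L)%R).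
      { apply HL1. exists (F0 ++ F). split; auto. apply NoDup_app; auto.
        intros t H1 H2. apply (HD t H2 H1). }
      rewrite rsum_app in H. lra.
    + exfalso. assert (L <= L - eps)%R; [|lra].
      apply HL2. intros x [F [N ->]].
      destruct (Rle_dec (rsum g F) (L - eps)) as [|Hx]; auto.
      exfalso; apply Hn. exists F. split; auto. lra.
Qed.

Lemma asum_is_usum {T : Type} (f : T -> C) : asum f -> exists s, is_usum f s.
Proof.
  intros Hf.
  apply (filterlim_locally_cauchy (U := C_R_CompleteNormedModule) (F := finite_subsets)).
  intros eps.
  destruct (bsum_tail _ (fun t => Cmod_ge_0 (f t)) Hf (eps / 3)) as [F0 [N0 H0]].
  { destruct eps as [e He]; simpl; lra. }
  exists (fun F => NoDup F /\ incl F0 F). split.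
  - exists F0. auto.
  - assert (K : forall F, NoDup F -> incl F0 F -> (Cmod (sum_list f F - sum_list f F0) <= eps / 3)%R).
    { intros F N HI. destruct (split_incl F0 F N0 N HI) as [F1 [HP [N1 HD]]].
      rewrite (sum_list_perm _ _ _ HP), sum_list_app.
      replace (sum_list f F0 + sum_list f F1 - sum_list f F0) with (sum_list f F1) by ring.
      eapply Rle_trans; [apply Cmod_sum_list|]. apply H0; auto. }
    intros F G [NF HF] [NG HG].
    specialize (K F NF HF) as K1. specialize (K G NG HG) as K2.
    assert (H : (Cmod (sum_list f G - sum_list f F) < eps)%R).
    { replace (sum_list f G - sum_list f F) with
        ((sum_list f G - sum_list f F0) + - (sum_list f F - sum_list f F0)) by ring.
      eapply Rle_lt_trans; [apply Cmod_triangle|]. rewrite Cmod_opp.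
      destruct eps as [e He]; simpl in *; lra. }
    apply (norm_compat1 (K := C_AbsRing) (V := C_NormedModule)). exact H.
Qed.

Lemma asum_usum {T : Type} (f : T -> C) : asum f -> is_usum f (usum f).
Proof.
  intros H. destruct (asum_is_usum f H) as [s Hs]. rewrite (usum_unique f s Hs). exact Hs.
Qed.

Lemma is_usum_plus {T : Type} (f g : T -> C) s r :
  is_usum f s -> is_usum g r -> is_usum (fun t => f t + g t) (s + r).
Proof.
  rewrite !is_usum_eps. intros Hf Hg eps Heps.
  destruct (Hf (eps / 2)%R) as [F1 H1]; [lra|]. destruct (Hg (eps / 2)%R) as [F2 H2]; [lra|].
  exists (F1 ++ F2). intros F N HI.
  specialize (H1 F N (fun x Hx => HI x (in_or_app _ _ _ (or_introl Hx)))).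
  specialize (H2 F N (fun x Hx => HI x (in_or_app _ _ _ (or_intror Hx)))).
  rewrite sum_list_plus.
  replace (sum_list f F + sum_list g F - (s + r)) with
    ((sum_list f F - s) + (sum_list g F - r)) by ring.
  eapply Rle_lt_trans; [apply Cmod_triangle|]. lra.
Qed.

Lemma is_usum_scal {T : Type} (f : T -> C) c s :
  is_usum f s -> is_usum (fun t => c * f t) (c * s).
Proof.
  rewrite !is_usum_eps. intros Hf eps Heps.
  assert (Hc := Cmod_ge_0 c).
  destruct (Hf (eps / (Cmod c + 1))%R) as [F0 H0].
  { apply Rdiv_lt_0_compat; lra. }
  exists F0. intros F N HI. specialize (H0 F N HI).
  rewrite sum_list_scal. replace (c * sum_list f F - c * s) with (c * (sum_list f F - s)) by ring.
  rewrite Cmod_mult. assert (Hp := Cmod_ge_0 (sum_list f F - s)).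
  apply Rle_lt_trans with ((Cmod c + 1) * Cmod (sum_list f F - s))%R; [nra|].
  apply Rlt_le_trans with ((Cmod c + 1) * (eps / (Cmod c + 1)))%R.
  - apply Rmult_lt_compat_l; lra.
  - right. field. lra.
Qed.

Lemma is_usum_opp {T : Type} (f : T -> C) s : is_usum f s -> is_usum (fun t => - f t) (- s).
Proof.
  intros H. replace (- s) with (-1 * s) by ring.
  eapply is_usum_ext; [|apply is_usum_scal, H]. intros t; simpl; ring.
Qed.

Lemma is_usum_minus {T : Type} (f g : T -> C) s r :
  is_usum f s -> is_usum g r -> is_usum (fun t => f t - g t) (s - r).
Proof. intros Hf Hg. apply is_usum_plus; [exact Hf|apply is_usum_opp, Hg]. Qed.

(** Remainder estimates go through this bound: the remainder is exhibited as an unconditional sum,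
    and its terms are bounded in modulus. *)
Lemma is_usum_bound {T : Type} (f : T -> C) s B :
  is_usum f s -> (forall F, NoDup F -> (rsum (fun t => Cmod (f t)) F <= B)%R) -> (Cmod s <= B)%R.
Proof.
  rewrite is_usum_eps. intros Hf HB.
  apply le_epsilon. intros eps Heps. destruct (Hf eps Heps) as [F0 H0].
  specialize (H0 (nodup eqdec F0) (NoDup_nodup _ _) (fun x Hx => proj2 (nodup_In eqdec F0 x) Hx)).
  replace s with (sum_list f (nodup eqdec F0) + - (sum_list f (nodup eqdec F0) - s)) by ring.
  eapply Rle_trans; [apply Cmod_triangle|]. rewrite Cmod_opp.
  assert (H := Cmod_sum_list f (nodup eqdec F0)).
  specialize (HB _ (NoDup_nodup eqdec F0)). lra.
Qed.

Lemma is_usum_finite {T : Type} (f : T -> C) F0 :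
  NoDup F0 -> (forall t, ~ In t F0 -> f t = 0) -> is_usum f (sum_list f F0).
Proof.
  intros N0 H. rewrite is_usum_eps. intros eps Heps. exists F0. intros F N HI.
  destruct (split_incl F0 F N0 N HI) as [F1 [HP [N1 HD]]].
  rewrite (sum_list_perm _ _ _ HP), sum_list_app, (sum_list_zero f F1).
  - replace (sum_list f F0 + 0 - sum_list f F0) with (RtoC 0) by ring. rewrite Cmod_0; auto.
  - intros t Ht. apply H, HD, Ht.
Qed.

Lemma is_usum_zero {T : Type} : is_usum (fun _ : T => 0) 0.
Proof. apply (is_usum_finite (fun _ : T => 0) nil); auto. constructor. Qed.

Lemma bsum_le {T : Type} (g h : T -> R) : (forall t, g t <= h t)%R -> bsum h -> bsum g.
Proof.
  intros H [B HB]. exists B. intros F N. eapply Rle_trans; [apply rsum_le, H|auto].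
Qed.

Lemma bsum_scal {T : Type} (g : T -> R) c : (0 <= c)%R -> bsum g -> bsum (fun t => c * g t)%R.
Proof.
  intros Hc [B HB]. exists (c * B)%R. intros F N. rewrite rsum_scal.
  apply Rmult_le_compat_l; auto.
Qed.

Lemma bsum_plus {T : Type} (g h : T -> R) : bsum g -> bsum h -> bsum (fun t => g t + h t)%R.
Proof.
  intros [B HB] [D HD]. exists (B + D)%R. intros F N. rewrite rsum_plus.
  specialize (HB F N); specialize (HD F N); lra.
Qed.

Lemma bsum_comp {T U : Type} (g : T -> R) (h : U -> T) :
  (forall u v, h u = h v -> u = v) -> bsum g -> bsum (fun u => g (h u)).
Proof.
  intros Hh [B HB]. exists B. intros F N. rewrite <- rsum_map. apply HB.
  apply FinFun.Injective_map_NoDup; auto.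
Qed.

Lemma asum_le {T : Type} (f : T -> C) (h : T -> R) :
  (forall t, Cmod (f t) <= h t)%R -> bsum h -> asum f.
Proof. apply bsum_le. Qed.

Lemma asum_ext {T : Type} (f g : T -> C) : (forall t, f t = g t) -> asum f -> asum g.
Proof. intros H. rewrite (functional_extensionality f g H). auto. Qed.

Lemma asum_scal {T : Type} (f : T -> C) c : asum f -> asum (fun t => c * f t).
Proof.
  intros H. apply asum_le with (fun t => Cmod c * Cmod (f t))%R.
  - intros t. rewrite Cmod_mult. lra.
  - apply bsum_scal; [apply Cmod_ge_0|exact H].
Qed.

Lemma asum_plus {T : Type} (f g : T -> C) : asum f -> asum g -> asum (fun t => f t + g t).
Proof.
  intros Hf Hg. apply asum_le with (fun t => Cmod (f t) + Cmod (g t))%R.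
  - intros t. apply Cmod_triangle.
  - apply bsum_plus; assumption.
Qed.

Lemma asum_opp {T : Type} (f : T -> C) : asum f -> asum (fun t => - f t).
Proof. intros Hf. apply asum_le with (fun t => Cmod (f t)); auto. intros t; rewrite Cmod_opp; lra. Qed.

Lemma asum_minus {T : Type} (f g : T -> C) : asum f -> asum g -> asum (fun t => f t - g t).
Proof. intros Hf Hg. apply asum_plus; [exact Hf|apply asum_opp, Hg]. Qed.

Lemma asum_comp {T U : Type} (f : T -> C) (h : U -> T) :
  (forall u v, h u = h v -> u = v) -> asum f -> asum (fun u => f (h u)).
Proof. intros Hh Hf. apply (bsum_comp (fun t => Cmod (f t)) h Hh Hf). Qed.

Lemma is_usum_reindex {T U : Type} (f : T -> C) (h : U -> T) s :
  (forall u v, h u = h v -> u = v) -> (forall t, (forall u, h u <> t) -> f t = 0) ->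
  is_usum f s <-> is_usum (fun u => f (h u)) s.
Proof.
  intros Hh H0. rewrite !is_usum_eps.
  (* By injectivity of [h] a finite set has a finite preimage, which transports the threshold sets
     in both directions. *)
  assert (Pre : forall F : list T, exists G : list U,
    forall u, In (h u) F <-> In u G).
  { induction F as [|t F [G HG]].
    - exists nil. simpl; tauto.
    - destruct (classic (exists u, h u = t)) as [[u Hu]|Hn].
      + exists (u :: G). intros v. simpl. rewrite HG. split; intros [H|H]; auto.
        * left. apply Hh. congruence.
        * left. congruence.
      + exists G. intros v. simpl. rewrite HG. split; auto. intros [H|H]; auto.
        exfalso. apply Hn. exists v; auto. }
  split; intros H eps Heps; destruct (H eps Heps) as [F0 HF0].
  - destruct (Pre F0) as [G0 HG0]. exists G0. intros G N HI.
    assert (N' : NoDup (map h G)) by (apply FinFun.Injective_map_NoDup; auto).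
    destruct (split_incl (map h G) (nodup eqdec (map h G ++ F0))) as [F1 [HP [N1 HD]]]; auto.
    { apply NoDup_nodup. }
    { intros x Hx. apply nodup_In, in_or_app; auto. }
    specialize (HF0 _ (NoDup_nodup eqdec (map h G ++ F0))
      (fun x Hx => proj2 (nodup_In eqdec _ x) (in_or_app _ _ _ (or_intror Hx)))).
    rewrite (sum_list_perm _ _ _ HP), sum_list_app, sum_list_map, (sum_list_zero f F1) in HF0.
    + rewrite Cplus_0_r in HF0. exact HF0.
    + intros t Ht. apply H0. intros u Hu. apply (HD t Ht). rewrite <- Hu. apply in_map.
      apply HI, HG0. rewrite Hu.
      assert (Ht' : In t (nodup eqdec (map h G ++ F0))).
      { apply (Permutation_in _ (Permutation_sym HP)), in_or_app; auto. }
      apply nodup_In, in_app_or in Ht'. destruct Ht' as [Ht'|]; auto.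
      exfalso; apply (HD t Ht Ht').
  - exists (map h F0). intros F N HI. destruct (Pre F) as [G HG].
    set (G' := nodup eqdec G).
    assert (HG' : forall u, In (h u) F <-> In u G') by (intros u; unfold G'; rewrite nodup_In; apply HG).
    assert (NG : NoDup G') by apply NoDup_nodup.
    destruct (split_incl (map h G') F) as [F1 [HP [N1 HD]]]; auto.
    { apply FinFun.Injective_map_NoDup; auto. }
    { intros t Ht. apply in_map_iff in Ht. destruct Ht as [u [<- Hu]]. apply HG', Hu. }
    rewrite (sum_list_perm _ _ _ HP), sum_list_app, sum_list_map, (sum_list_zero f F1).
    + rewrite Cplus_0_r. apply HF0; auto. intros u Hu. apply HG', HI, in_map, Hu.
    + intros t Ht. apply H0. intros u Hu. apply (HD t Ht). rewrite <- Hu. apply in_map.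
      apply HG'. rewrite Hu. apply (Permutation_in _ (Permutation_sym HP)), in_or_app; auto.
Qed.

(** Extension by zero instead of a sum over a subtype: partial sums over complementary sets then
    live on one index type and can be added. *)
Definition restrict {T : Type} (P : T -> Prop) (f : T -> C) (t : T) : C :=
  if excluded_middle_informative (P t) then f t else 0.

Lemma restrict_true {T : Type} (P : T -> Prop) f t : P t -> restrict P f t = f t.
Proof. intros H. unfold restrict. destruct (excluded_middle_informative (P t)); tauto. Qed.

Lemma restrict_false {T : Type} (P : T -> Prop) f t : ~ P t -> restrict P f t = 0.
Proof. intros H. unfold restrict. destruct (excluded_middle_informative (P t)); tauto. Qed.

Lemma asum_restrict {T : Type} (P : T -> Prop) (f : T -> C) : asum f -> asum (restrict P f).
Proof.
  apply bsum_le. intros t. unfold restrict.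
  destruct (excluded_middle_informative (P t)); [lra|rewrite Cmod_0; apply Cmod_ge_0].
Qed.

Lemma is_usum_image {T U : Type} (P : T -> Prop) (h : U -> T) (f : T -> C) s :
  (forall u v, h u = h v -> u = v) -> (forall u, P (h u)) -> (forall t, P t -> exists u, h u = t) ->
  is_usum (fun u => f (h u)) s -> is_usum (restrict P f) s.
Proof.
  intros Hh HP Hs H. apply (is_usum_reindex _ h); auto.
  - intros t Hn. apply restrict_false. intros Ht. destruct (Hs t Ht) as [u Hu]. apply (Hn u Hu).
  - eapply is_usum_ext; [|exact H]. intros u. rewrite restrict_true; auto.
Qed.

Lemma restrict_compl {T : Type} (P : T -> Prop) f t : restrict P f t + restrict (fun t => ~ P t) f t = f t.
Proof.
  destruct (classic (P t)); [rewrite restrict_true, restrict_false|rewrite restrict_false, restrict_true];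
    try tauto; ring.
Qed.

Lemma is_usum_single {T : Type} (f : T -> C) (a : T) : is_usum (restrict (fun t => t = a) f) (f a).
Proof.
  replace (f a) with (sum_list (restrict (fun t => t = a) f) (a :: nil)).
  - apply is_usum_finite; [repeat constructor; simpl; tauto|]. intros t Ht. apply restrict_false.
    intros E. apply Ht. left. auto.
  - cbn [sum_list fold_right]. rewrite restrict_true by auto. ring.
Qed.

Lemma is_usum_remove {T : Type} (f : T -> C) (a : T) s :
  is_usum (restrict (fun t => t <> a) f) s -> is_usum f (f a + s).
Proof.
  intros H. eapply is_usum_ext; [|apply is_usum_plus; [apply (is_usum_single f a)|exact H]].
  intros t. apply restrict_compl.
Qed.

Lemma usum_shift (f : nat -> C) : asum f -> usum f = f O + usum (fun n => f (S n)).
Proof.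
  intros Hf. apply usum_unique, is_usum_remove.
  apply (is_usum_image _ S); [intros; lia|auto| |apply asum_usum, (asum_comp f S); auto].
  intros [|n] Hn; [lia|exists n; auto].
Qed.

(** Summation by fibres. Let [F0] carry all but [eps / 2] of the absolute sum. For a finite [G]
    containing the image of [F0], the sum of [g] over [G] differs from [s] only by terms outside the
    fibres over [G], and these avoid [F0]. *)
Lemma is_usum_fibers {T U : Type} (f : T -> C) (phi : T -> U) (g : U -> C) s :
  asum f -> is_usum f s -> (forall u, is_usum (restrict (fun t => phi t = u) f) (g u)) ->
  is_usum g s.
Proof.
  intros Hf Hs Hg. rewrite is_usum_eps. intros eps Heps.
  destruct (bsum_tail _ (fun t => Cmod_ge_0 (f t)) Hf (eps / 2)) as [F0 [N0 H0]]; [lra|].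
  exists (map phi F0). intros G NG HI.
  assert (K : forall G, NoDup G -> is_usum (restrict (fun t => In (phi t) G) f) (sum_list g G)).
  { clear G NG HI. intros G NG. induction G as [|u G IH].
    - apply is_usum_ext with (fun _ => 0); [|apply is_usum_zero].
      intros t. rewrite restrict_false; auto.
    - inversion_clear NG. simpl.
      eapply is_usum_ext; [|apply is_usum_plus; [apply Hg|apply IH; auto]].
      intros t. simpl. unfold restrict.
      destruct (excluded_middle_informative (phi t = u)) as [E|E];
        destruct (excluded_middle_informative (In (phi t) G)) as [E'|E'];
        destruct (excluded_middle_informative (u = phi t \/ In (phi t) G)) as [E2|E2];
        try ring; exfalso; subst; intuition congruence. }
  specialize (K G NG).
  assert (K2 := is_usum_minus _ _ _ _ K Hs).
  apply Rle_lt_trans with (eps / 2)%R; [|lra].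
  apply is_usum_bound with (1 := K2). intros F N.
  set (F' := filter (fun t => if in_dec eqdec (phi t) G then false else true) F).
  apply Rle_trans with (rsum (fun t => Cmod (f t)) F').
  - unfold F'. clear -F. induction F as [|t F IH]; simpl; [lra|].
    destruct (in_dec eqdec (phi t) G) as [E|E]; simpl.
    + rewrite restrict_true by auto. replace (f t - f t) with (RtoC 0) by ring. rewrite Cmod_0. lra.
    + rewrite restrict_false by auto. replace (0 - f t) with (- f t) by ring. rewrite Cmod_opp. lra.
  - apply H0.
    + apply NoDup_filter, N.
    + intros t Ht Ht0. apply filter_In in Ht. destruct Ht as [_ Ht].
      destruct (in_dec eqdec (phi t) G) as [E|E]; [discriminate|]. apply E, HI, in_map, Ht0.
Qed.

Lemma is_usum_prod {A B : Type} (f : A * B -> C) (g : A -> C) s :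
  asum f -> is_usum f s -> (forall a, is_usum (fun b => f (a, b)) (g a)) -> is_usum g s.
Proof.
  intros Hf Hs Hg. apply (is_usum_fibers f fst g s Hf Hs). intros a.
  apply (is_usum_reindex (restrict (fun t => fst t = a) f) (fun b : B => (a, b))).
  - intros u v E; congruence.
  - intros [a' b] H. apply restrict_false. simpl. intros ->. apply (H b); auto.
  - eapply is_usum_ext; [|apply Hg]. intros b. simpl. rewrite restrict_true; auto.
Qed.

Lemma is_usum_swap {A B : Type} (f : A * B -> C) s :
  is_usum f s -> is_usum (fun p : B * A => f (snd p, fst p)) s.
Proof.
  intros H. apply (is_usum_reindex f (fun p : B * A => (snd p, fst p))); auto.
  - intros [u1 u2] [v1 v2]; simpl; congruence.
  - intros [a b] Hn. exfalso. apply (Hn (b, a)); auto.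
Qed.

(** A finite set of pairs lies in the rectangle spanned by its two projections, over which the sum
    factors. *)
Lemma bsum_prod {A B : Type} (g : A -> R) (h : B -> R) :
  (forall a, 0 <= g a)%R -> (forall b, 0 <= h b)%R -> bsum g -> bsum h ->
  bsum (fun p : A * B => g (fst p) * h (snd p))%R.
Proof.
  intros Hg Hh [B1 HB1] [B2 HB2]. exists (B1 * B2)%R. intros F N.
  set (LA := nodup eqdec (map fst F)). set (LB := nodup eqdec (map snd F)).
  assert (HL : forall (LA : list A), rsum (fun p : A * B => g (fst p) * h (snd p))%R (list_prod LA LB)
    = (rsum g LA * rsum h LB)%R).
  { clear. induction LA as [|a LA IH]; simpl; [ring|].
    rewrite rsum_app, IH, rsum_map. simpl. rewrite rsum_scal. ring. }
  apply Rle_trans with (rsum (fun p : A * B => g (fst p) * h (snd p))%R (list_prod LA LB)).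
  - destruct (split_incl F (list_prod LA LB)) as [F1 [HP [N1 HD]]]; auto.
    + assert (NB : NoDup LB) by apply NoDup_nodup.
      assert (NA : NoDup LA) by apply NoDup_nodup. clear -NA NB.
      induction NA as [|a LA Ha NA IH]; simpl; [constructor|]. apply NoDup_app; auto.
      * apply FinFun.Injective_map_NoDup; auto. intros u v E; congruence.
      * intros [x y] H1 H2. apply in_map_iff in H1. destruct H1 as [b [E _]].
        injection E; intros; subst. apply in_prod_iff in H2. tauto.
    + intros [a b] H. apply in_prod; apply nodup_In.
      * apply (in_map fst) in H; auto.
      * apply (in_map snd) in H; auto.
    + rewrite (rsum_perm _ _ _ HP), rsum_app.
      assert (0 <= rsum (fun p : A * B => g (fst p) * h (snd p))%R F1)%R; [|lra].
      apply rsum_nonneg. intros t. apply Rmult_le_pos; auto.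
  - rewrite HL. apply Rmult_le_compat; try (apply rsum_nonneg; assumption).
    + apply HB1, NoDup_nodup.
    + apply HB2, NoDup_nodup.
Qed.

Lemma asum_prod {A B : Type} (f : A -> C) (g : B -> C) :
  asum f -> asum g -> asum (fun p : A * B => f (fst p) * g (snd p)).
Proof.
  intros Hf Hg. eapply asum_le; [|apply (bsum_prod (fun a => Cmod (f a)) (fun b => Cmod (g b)))]; auto.
  - intros t; simpl. rewrite Cmod_mult. lra.
  - intros; apply Cmod_ge_0.
  - intros; apply Cmod_ge_0.
Qed.

Lemma is_usum_mult {A B : Type} (f : A -> C) (g : B -> C) s r :
  asum f -> asum g -> is_usum f s -> is_usum g r ->
  is_usum (fun p : A * B => f (fst p) * g (snd p)) (s * r).
Proof.
  intros Hf Hg Hs Hr. assert (Hp := asum_prod f g Hf Hg).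
  destruct (asum_is_usum _ Hp) as [t Ht].
  assert (H := is_usum_prod _ (fun a => f a * r) t Hp Ht).
  rewrite (is_usum_unique (fun a => f a * r) (s * r) t); auto.
  - apply is_usum_ext with (fun a => r * f a); [intros; ring|].
    rewrite Cmult_comm. apply is_usum_scal, Hs.
  - apply H. intros a. apply (is_usum_scal g (f a) r Hr).
Qed.

Lemma is_usum_series (a : nat -> C) s :
  is_usum a s -> is_series (K := C_AbsRing) (V := C_NormedModule) a s.
Proof.
  intros H. apply (filterlim_ext (fun n => sum_list a (rev (seq 0 (S n))))).
  - induction x as [|n IH].
    + simpl. rewrite sum_O. unfold sum_list; simpl. ring.
    + rewrite sum_Sn, <- IH.
      rewrite (seq_S (S n) 0), rev_app_distr. simpl. unfold plus; simpl. ring.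
  - eapply filterlim_comp; [|exact H]. intros P [F0 HF0].
    exists (fold_right max 0%nat F0). intros n Hn. apply HF0.
    + apply NoDup_rev, seq_NoDup.
    + intros x Hx. rewrite <- in_rev. apply in_seq. split; [lia|].
      assert (x <= fold_right max 0%nat F0)%nat; [|lia].
      clear -Hx. induction F0 as [|y F0 IH]; simpl in *; [tauto|].
      destruct Hx as [->|Hx]; [lia|]. specialize (IH Hx). lia.
Qed.

Lemma Cseries_usum (a : nat -> C) s : is_usum a s -> Cseries a = s.
Proof.
  intros H. unfold Cseries. apply is_usum_series in H. apply (iota_unique (V := C_R_CompleteNormedModule)); auto.
  intros y Hy. apply (filterlim_locally_unique (K := C_AbsRing) (V := C_NormedModule) _ _ _ Hy H).
Qed.

Lemma bsum_nat (g : nat -> R) B :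
  (forall n, 0 <= g n)%R -> (forall n, (rsum g (seq 0 n) <= B)%R) -> bsum g.
Proof.
  intros Hg HB. exists B. intros F N. set (n := S (fold_right max 0%nat F)).
  eapply Rle_trans; [|apply (HB n)].
  destruct (split_incl F (seq 0 n)) as [F1 [HP [N1 HD]]]; auto.
  - apply seq_NoDup.
  - intros x Hx. apply in_seq. split; [lia|]. unfold n. clear -Hx.
    induction F as [|y F IH]; simpl in *; [tauto|].
    destruct Hx as [->|Hx]; [lia|]. specialize (IH Hx). lia.
  - rewrite (rsum_perm _ _ _ HP), rsum_app.
    assert (0 <= rsum g F1)%R by (apply rsum_nonneg; auto). lra.
Qed.

(** Zero occurs in both halves and is counted twice, which is harmless for an upper bound. *)
Lemma bsum_Z (g : Z -> R) :
  (forall n, 0 <= g n)%R -> bsum (fun n => g (Z.of_nat n)) -> bsum (fun n => g (- Z.of_nat n)%Z) ->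
  bsum g.
Proof.
  intros Hg [B HB] [D HD]. exists (B + D)%R. intros F N.
  set (F1 := nodup eqdec (map Z.abs_nat F)).
  specialize (HB F1 (NoDup_nodup _ _)). specialize (HD F1 (NoDup_nodup _ _)).
  assert (H : (rsum g F <= rsum g (nodup eqdec (map Z.of_nat F1 ++ map (fun n => (- Z.of_nat n)%Z) F1)))%R).
  { match goal with |- (_ <= rsum g ?G)%R => destruct (split_incl F G) as [F2 [HP [N1 HX]]] end; auto.
    - apply NoDup_nodup.
    - intros x Hx. apply nodup_In, in_or_app.
      assert (Hx' : In (Z.abs_nat x) F1) by (apply nodup_In, in_map, Hx).
      destruct (Z_le_dec 0 x).
      + left. apply in_map_iff. exists (Z.abs_nat x). split; auto. lia.
      + right. apply in_map_iff. exists (Z.abs_nat x). split; auto. lia.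
    - rewrite (rsum_perm _ _ _ HP), rsum_app.
      assert (0 <= rsum g F2)%R by (apply rsum_nonneg; auto). lra. }
  eapply Rle_trans; [exact H|].
  assert (K : forall G, (rsum g (nodup eqdec G) <= rsum g G)%R).
  { clear -Hg. induction G as [|x G IH]; simpl; [lra|].
    destruct (in_dec eqdec x G); simpl; specialize (Hg x); lra. }
  eapply Rle_trans; [apply K|]. rewrite rsum_app, !rsum_map. lra.
Qed.

Lemma is_usum_Z_punctured (f : Z -> C) (j : Z) (r s : C) :
  is_usum (fun k : nat => f (j - Z.of_nat (S k))%Z) r ->
  is_usum (fun k : nat => f (j + Z.of_nat (S k))%Z) s ->
  is_usum (restrict (fun n => n <> j) f) (r + s).
Proof.
  intros Hr Hs.
  assert (H1 : is_usum (restrict (fun n => n < j)%Z f) r).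
  { apply (is_usum_image _ (fun k : nat => j - Z.of_nat (S k))%Z); auto; try (intros; lia).
    intros t Ht. exists (Z.to_nat (j - t - 1)). lia. }
  assert (H2 : is_usum (restrict (fun n => j < n)%Z f) s).
  { apply (is_usum_image _ (fun k : nat => j + Z.of_nat (S k))%Z); auto; try (intros; lia).
    intros t Ht. exists (Z.to_nat (t - j - 1)). lia. }
  eapply is_usum_ext; [|apply (is_usum_plus _ _ _ _ H1 H2)].
  intros n. cbv beta. unfold restrict.
  destruct (excluded_middle_informative (n < j)%Z), (excluded_middle_informative (j < n)%Z),
    (excluded_middle_informative (n <> j)); try ring; lia.
Qed.

Lemma is_usum_Z (f : Z -> C) s :
  asum f -> is_usum (fun n : nat => f (Z.of_nat (S n)) + f (- Z.of_nat (S n))%Z) s ->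
  is_usum f (f 0%Z + s).
Proof.
  intros Hf Hs. apply is_usum_remove.
  assert (A1 : asum (fun k : nat => f (0 - Z.of_nat (S k))%Z)) by (apply (asum_comp f); auto; intros; lia).
  assert (A2 : asum (fun k : nat => f (0 + Z.of_nat (S k))%Z)) by (apply (asum_comp f); auto; intros; lia).
  assert (E := is_usum_plus _ _ _ _ (asum_usum _ A1) (asum_usum _ A2)).
  rewrite (is_usum_unique _ _ _ Hs (is_usum_ext _ _ _ (fun n => Cplus_comm _ _) E)).
  apply is_usum_Z_punctured; apply asum_usum; assumption.
Qed.

(** * Quadratic relations between Lambert series *)

Lemma exp_le (x y : R) : (x <= y)%R -> (exp x <= exp y)%R.
Proof. intros [H| ->]; [left; apply exp_increasing, H|right; reflexivity]. Qed.

Lemma exp_pow (x : R) (n : nat) : (exp x ^ n = exp (x * INR n))%R.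
Proof.
  induction n as [|n IH]; [simpl; rewrite Rmult_0_r, exp_0; reflexivity|].
  rewrite S_INR. simpl. rewrite IH, <- exp_plus. f_equal. ring.
Qed.

(** With [e = d / (j + 1)], the inequality [e x <= exp (e x)] raised to the power [j] has exponent
    [e j x <= d x]. The [+ 1] covers [j = 0]. *)
Lemma pow_le_exp (j : nat) (d : R) : (0 < d)%R ->
  exists K, (0 < K)%R /\ forall x, (0 <= x)%R -> (x ^ j <= K * exp (d * x))%R.
Proof.
  intros Hd. assert (Hj := pos_INR j).
  assert (Hd' : (0 < d / (INR j + 1))%R) by (apply Rdiv_lt_0_compat; lra).
  set (e := (d / (INR j + 1))%R) in *.
  exists ((/ e) ^ j)%R. split; [apply pow_lt, Rinv_0_lt_compat; auto|].
  intros x Hx.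
  assert (H1 : (x <= / e * exp (e * x))%R).
  { apply Rmult_le_reg_l with e; auto. rewrite <- Rmult_assoc, Rinv_r, Rmult_1_l by lra.
    assert (H := exp_ineq1_le (e * x)). lra. }
  apply Rle_trans with ((/ e * exp (e * x)) ^ j)%R; [apply pow_incr; lra|].
  rewrite Rpow_mult_distr. apply Rmult_le_compat_l; [apply pow_le, Rlt_le, Rinv_0_lt_compat; auto|].
  rewrite exp_pow. apply exp_le.
  assert (e * x * INR j <= d * x)%R; [|lra].
  replace (d * x)%R with (e * x * (INR j + 1))%R by (unfold e; field; lra).
  assert (0 <= e * x)%R by (apply Rmult_le_pos; lra). nra.
Qed.

Lemma bsum_geom (r : R) : (0 <= r < 1)%R -> bsum (fun n : nat => r ^ n)%R.
Proof.
  intros Hr. apply bsum_nat with (/ (1 - r))%R.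
  - intros n. apply pow_le; lra.
  - intros n. assert (H : (rsum (fun n => r ^ n)%R (seq 0 n) = (1 - r ^ n) / (1 - r))%R).
    { induction n as [|n IH].
      - simpl. field. lra.
      - rewrite seq_S, rsum_app, IH. simpl. field. lra. }
    rewrite H. unfold Rdiv. rewrite <- (Rmult_1_l (/ (1 - r))) at 2.
    apply Rmult_le_compat_r; [apply Rlt_le, Rinv_0_lt_compat; lra|].
    assert (0 <= r ^ n)%R by (apply pow_le; lra). lra.
Qed.

(** Half of the decay of [rho^n] absorbs the polynomial. The ratio is first enlarged to
    [rho = (1 + r) / 2], which has a logarithm even when [r = 0]. *)
Lemma bsum_pow_geom (j : nat) (r : R) : (0 <= r < 1)%R -> bsum (fun n : nat => INR n ^ j * r ^ n)%R.
Proof.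
  intros Hr. set (rho := ((1 + r) / 2)%R).
  assert (Hrho : (0 < rho < 1 /\ r <= rho)%R) by (unfold rho; lra).
  assert (Hl : (ln rho < 0)%R) by (rewrite <- ln_1; apply ln_increasing; lra).
  destruct (pow_le_exp j (- ln rho / 2)) as [K [HK H]]; [lra|].
  apply bsum_le with (fun n => K * (exp (ln rho / 2)) ^ n)%R.
  - intros n. apply Rle_trans with (K * exp (- ln rho / 2 * INR n) * rho ^ n)%R.
    + apply Rmult_le_compat; try (apply pow_le; try lra; apply pos_INR).
      * apply H, pos_INR.
      * apply pow_incr; lra.
    + right. rewrite Rmult_assoc. f_equal.
      rewrite <- (exp_ln rho) at 2 by lra. rewrite !exp_pow, <- exp_plus. f_equal. field.
  - apply bsum_scal; [lra|]. apply bsum_geom. split; [apply Rlt_le, exp_pos|].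
    rewrite <- exp_0. apply exp_increasing. lra.
Qed.

(** An index [n] stands for the positive integer [n + 1]; hence [S (a + b)] is the index of the sum
    of the integers with indices [a] and [b]. Pairs of distinct integers are parametrized by their
    smaller member and their difference. *)
Lemma usum_trichotomy (g : nat * nat -> C) : asum g ->
  usum g = usum (fun p => g (S (fst p + snd p), snd p)) +
           usum (fun p => g (snd p, S (fst p + snd p))) + usum (fun a => g (a, a)).
Proof.
  intros Hg. apply usum_unique.
  assert (I1 : forall p r : nat * nat, (S (fst p + snd p), snd p) = (S (fst r + snd r), snd r) -> p = r).
  { intros [a b] [c d] E; injection E; simpl; intros; f_equal; lia. }
  assert (I2 : forall p r : nat * nat, (snd p, S (fst p + snd p)) = (snd r, S (fst r + snd r)) -> p = r).
  { intros [a b] [c d] E; injection E; simpl; intros; f_equal; lia. }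
  assert (H1 : is_usum (restrict (fun p => snd p < fst p)%nat g) (usum (fun p => g (S (fst p + snd p), snd p)))).
  { apply (is_usum_image _ (fun p : nat * nat => (S (fst p + snd p), snd p))); auto.
    - intros p. simpl. lia.
    - intros [a b] L. exists ((a - b - 1)%nat, b). simpl in *. f_equal; lia.
    - apply asum_usum, (asum_comp g (fun p => (S (fst p + snd p), snd p))); auto. }
  assert (H2 : is_usum (restrict (fun p => fst p < snd p)%nat g) (usum (fun p => g (snd p, S (fst p + snd p))))).
  { apply (is_usum_image _ (fun p : nat * nat => (snd p, S (fst p + snd p)))); auto.
    - intros p. simpl. lia.
    - intros [a b] L. exists ((b - a - 1)%nat, a). simpl in *. f_equal; lia.
    - apply asum_usum, (asum_comp g (fun p => (snd p, S (fst p + snd p)))); auto. }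
  assert (H3 : is_usum (restrict (fun p => fst p = snd p)%nat g) (usum (fun a => g (a, a)))).
  { apply (is_usum_image _ (fun a : nat => (a, a))); auto.
    - intros; congruence.
    - intros [a b] L. exists a. simpl in L. congruence.
    - apply asum_usum, (asum_comp g (fun a => (a, a))); auto. intros; congruence. }
  eapply is_usum_ext; [|apply is_usum_plus; [apply is_usum_plus; [apply H1|apply H2]|apply H3]].
  intros [a b]. simpl. destruct (lt_eq_lt_dec a b) as [[L|L]|L].
  - rewrite restrict_false, restrict_true, restrict_false by (simpl; lia). ring.
  - rewrite restrict_false, restrict_false, restrict_true by (simpl; lia). ring.
  - rewrite restrict_true, restrict_false, restrict_false by (simpl; lia). ring.
Qed.

Lemma usum_antidiagonal (g : nat * nat -> C) : asum g ->
  usum g = usum (fun n => sum_list (fun b => g ((n - b)%nat, b)) (seq 0 (S n))).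
Proof.
  intros Hg. symmetry. apply usum_unique.
  apply (is_usum_fibers g (fun p => fst p + snd p)%nat _ _ Hg (asum_usum g Hg)).
  intros n.
  replace (sum_list (fun b => g ((n - b)%nat, b)) (seq 0 (S n))) with
    (sum_list (restrict (fun p => fst p + snd p = n)%nat g) (map (fun b => ((n - b)%nat, b)) (seq 0 (S n)))).
  - apply is_usum_finite.
    + apply FinFun.Injective_map_NoDup; [intros a b E; congruence|apply seq_NoDup].
    + intros [a b] Hn. apply restrict_false. simpl. intros E. apply Hn. apply in_map_iff.
      exists b. split; [f_equal; lia|apply in_seq; lia].
  - rewrite sum_list_map. apply sum_list_ext_in. intros b Hb. apply in_seq in Hb.
    apply restrict_true. simpl. lia.
Qed.

Lemma usum_plus {T : Type} (f g : T -> C) : asum f -> asum g ->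
  usum (fun t => f t + g t) = usum f + usum g.
Proof. intros Hf Hg. apply usum_unique, is_usum_plus; apply asum_usum; auto. Qed.

Lemma usum_scal {T : Type} (f : T -> C) c : asum f -> usum (fun t => c * f t) = c * usum f.
Proof. intros Hf. apply usum_unique, is_usum_scal, asum_usum, Hf. Qed.

Lemma usum_ext {T : Type} (f g : T -> C) : (forall t, f t = g t) -> usum f = usum g.
Proof. intros H. rewrite (functional_extensionality f g H). reflexivity. Qed.

Lemma Cmod_RtoC_nonneg (x : R) : (0 <= x)%R -> Cmod (RtoC x) = x.
Proof. intros H. rewrite Cmod_R. apply Rabs_pos_eq, H. Qed.

Lemma sum_list_RtoC {T : Type} (g : T -> R) F : sum_list (fun t => RtoC (g t)) F = RtoC (rsum g F).
Proof.
  induction F as [|t F IH]; [reflexivity|]. unfold sum_list, rsum in *. simpl.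
  rewrite IH, RtoC_plus. reflexivity.
Qed.

Section lambert_algebra.

Variable q : C.
Hypothesis Hq : (Cmod q < 1)%R.

Definition lambert_term (n : nat) : C := q ^ n / (1 - q ^ n).

Lemma pow_q_le (n : nat) : (Cmod (q ^ S n) <= Cmod q)%R.
Proof using Hq.
  rewrite Cmod_pow. assert (H := Cmod_ge_0 q). simpl.
  assert (Cmod q ^ n <= 1 ^ n)%R by (apply pow_incr; lra). rewrite pow1 in *. nra.
Qed.

Lemma pow_q_ne (n : nat) : 1 - q ^ S n <> 0.
Proof using Hq.
  intros E. assert (E' : q ^ S n = 1).
  { replace (q ^ S n) with (1 - (1 - q ^ S n)) by ring. rewrite E. ring. }
  assert (H := pow_q_le n). rewrite E', Cmod_1 in H. lra.
Qed.

(** With [x = q^a] and [y = q^b] one has [1 + u_a + u_b = (1 - x y) / ((1 - x) (1 - y))]. *)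
Lemma lambert_term_mult (a b : nat) :
  lambert_term (S a) * lambert_term (S b) = lambert_term (S a + S b) * (1 + lambert_term (S a) + lambert_term (S b)).
Proof using Hq.
  unfold lambert_term. assert (H1 := pow_q_ne a). assert (H2 := pow_q_ne b).
  assert (H3 := pow_q_ne (a + S b)). change (S (a + S b)) with (S a + S b)%nat in H3.
  rewrite Cpow_add_r in *. set (x := q ^ S a) in *. set (y := q ^ S b) in *. clearbody x y.
  field. auto.
Qed.

Lemma lambert_term_bound : exists M, (0 <= M)%R /\ forall n, (Cmod (lambert_term (S n)) <= M * Cmod q ^ S n)%R.
Proof using Hq.
  exists (/ (1 - Cmod q))%R. split; [apply Rlt_le, Rinv_0_lt_compat; lra|].
  intros n. unfold lambert_term, Cdiv. rewrite Cmod_mult, Cmod_inv, Cmod_pow by apply pow_q_ne.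
  rewrite Rmult_comm. apply Rmult_le_compat_r; [apply pow_le, Cmod_ge_0|].
  apply Rinv_le_contravar; [lra|].
  assert (H : (Cmod 1 <= Cmod (1 - q ^ S n) + Cmod (q ^ S n))%R).
  { replace (RtoC 1) with ((1 - q ^ S n) + q ^ S n) at 1 by ring. apply Cmod_triangle. }
  rewrite Cmod_1 in H. assert (H0 := pow_q_le n). lra.
Qed.

Lemma bsum_weight (j : nat) : bsum (fun n : nat => (1 + INR (S n)) ^ j * Cmod q ^ S n)%R.
Proof using Hq.
  assert (H0 := Cmod_ge_0 q).
  apply bsum_le with (fun n => 2 ^ j * (INR (S n) ^ j * Cmod q ^ S n))%R.
  - intros n. rewrite <- Rmult_assoc, <- Rpow_mult_distr.
    apply Rmult_le_compat_r; [apply pow_le; auto|]. apply pow_incr.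
    rewrite S_INR. assert (H := pos_INR n). lra.
  - apply bsum_scal; [apply pow_le; lra|].
    apply (bsum_comp (fun n => INR n ^ j * Cmod q ^ n)%R S); [intros; lia|].
    apply bsum_pow_geom. lra.
Qed.

(** The common majorant of all double sums below: a polynomial weight times [q^(a + b)], in product
    form. *)
Lemma asum_weight2 (j : nat) (c : nat * nat -> C) (K : R) : (0 <= K)%R ->
  (forall a b, Cmod (c (a, b)) <=
    K * (((1 + INR (S a)) ^ j * Cmod q ^ S a) * ((1 + INR (S b)) ^ j * Cmod q ^ S b)))%R -> asum c.
Proof using Hq.
  intros HK H.
  apply asum_le with (fun p => K * (((1 + INR (S (fst p))) ^ j * Cmod q ^ S (fst p)) *
     ((1 + INR (S (snd p))) ^ j * Cmod q ^ S (snd p))))%R.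
  - intros [a b]. apply H.
  - apply bsum_scal; auto.
    assert (P : forall a : nat, (0 <= (1 + INR (S a)) ^ j * Cmod q ^ S a)%R).
    { intros a. apply Rmult_le_pos; apply pow_le; [assert (Ha := pos_INR (S a)); lra|apply Cmod_ge_0]. }
    apply (bsum_prod (fun a => (1 + INR (S a)) ^ j * Cmod q ^ S a)%R
      (fun a => (1 + INR (S a)) ^ j * Cmod q ^ S a)%R); auto; apply bsum_weight.
Qed.

Definition Ssum (k : nat) : C := usum (fun n => RtoC (INR (S n) ^ k) * lambert_term (S n)).
(** Since [u_n + u_n^2 = q^n / (1 - q^n)^2], the sum [Vsum (k + 1)] is the logarithmic derivative
    [q d/dq] of [Ssum k]. *)
Definition Vsum (k : nat) : C :=
  usum (fun n => RtoC (INR (S n) ^ k) * (lambert_term (S n) + lambert_term (S n) * lambert_term (S n))).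

Lemma asum_S (k : nat) : asum (fun n => RtoC (INR (S n) ^ k) * lambert_term (S n)).
Proof using Hq.
  destruct lambert_term_bound as [M [HM HB]].
  apply asum_le with (fun n => M * ((1 + INR (S n)) ^ k * Cmod q ^ S n))%R.
  - intros n. assert (Hn := pos_INR (S n)). rewrite Cmod_mult, Cmod_RtoC_nonneg by (apply pow_le; auto).
    replace (M * ((1 + INR (S n)) ^ k * Cmod q ^ S n))%R with
      ((1 + INR (S n)) ^ k * (M * Cmod q ^ S n))%R by ring.
    apply Rmult_le_compat; auto; [apply pow_le; auto|apply Cmod_ge_0|apply pow_incr; lra].
  - apply bsum_scal, bsum_weight; auto.
Qed.

Lemma asum_U2 (k : nat) : asum (fun n => RtoC (INR (S n) ^ k) * (lambert_term (S n) * lambert_term (S n))).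
Proof using Hq.
  assert (H := asum_prod _ _ (asum_S k) (asum_S 0)).
  apply (asum_comp _ (fun n : nat => (n, n))) in H; [|intros; congruence].
  eapply asum_ext; [|exact H]. intros n. simpl. ring.
Qed.

Lemma usum_SS (i j : nat) :
  is_usum (fun p => RtoC (INR (S (fst p)) ^ i * INR (S (snd p)) ^ j) * (lambert_term (S (fst p)) * lambert_term (S (snd p))))
   (Ssum i * Ssum j).
Proof using Hq.
  eapply is_usum_ext; [|apply is_usum_mult; try apply asum_S; apply asum_usum; apply asum_S].
  intros [a b]. simpl fst; simpl snd. rewrite RtoC_mult. ring.
Qed.

Lemma asum_SS (i j : nat) :
  asum (fun p => RtoC (INR (S (fst p)) ^ i * INR (S (snd p)) ^ j) * (lambert_term (S (fst p)) * lambert_term (S (snd p)))).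
Proof using Hq.
  eapply asum_ext; [|exact (asum_prod _ _ (asum_S i) (asum_S j))].
  intros [a b]. simpl fst; simpl snd. rewrite RtoC_mult. ring.
Qed.

(** After [u_a u_b = u_(a+b) (1 + u_a + u_b)], the terms quadratic in [u] on the two sides are
    both sums over pairs of distinct indices. *)
Lemma lambert_quadratic (k sigma : R -> R -> R) (j : nat) :
  (forall x y, k x y = k y x) -> (forall x y, sigma x y = sigma y x) ->
  (forall x y, k (x + y) y - k x y = sigma (x + y) y)%R ->
  (forall x y, 0 <= x -> 0 <= y -> Rabs (k x y) <= ((1 + x) * (1 + y)) ^ j)%R ->
  asum (fun p => RtoC (sigma (INR (S (fst p))) (INR (S (snd p)))) * (lambert_term (S (fst p)) * lambert_term (S (snd p)))) ->
  usum (fun p => RtoC (sigma (INR (S (fst p))) (INR (S (snd p)))) * (lambert_term (S (fst p)) * lambert_term (S (snd p))))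
  + usum (fun n => RtoC (k (INR (S n)) (INR (S n))) * (lambert_term (S n) * lambert_term (S n)))
  - usum (fun n => RtoC (sigma (INR (S n)) (INR (S n))) * (lambert_term (S n) * lambert_term (S n)))
  = usum (fun n => lambert_term (S (S n)) *
      RtoC (rsum (fun b => k (INR (S (S n)) - INR (S b)) (INR (S b)))%R (seq 0 (S n)))).
Proof using Hq.
  intros Ks Ss Kd Kb As.
  destruct lambert_term_bound as [M [HM HB]].
  assert (Hu : forall n, (Cmod (lambert_term (S n)) <= M)%R).
  { intros n. eapply Rle_trans; [apply HB|]. assert (H0 := Cmod_ge_0 q).
    assert (H : (Cmod q ^ S n <= 1 ^ S n)%R) by (apply pow_incr; lra). rewrite pow1 in H. nra. }
  assert (Pos : forall n, (0 <= INR n)%R) by apply pos_INR.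
  assert (AX : asum (fun p : nat * nat => RtoC (k (INR (S (fst p))) (INR (S (snd p)))) * lambert_term (S (fst p) + S (snd p)))).
  { apply (asum_weight2 j _ M HM). intros a b. simpl fst; simpl snd.
    rewrite Cmod_mult, Cmod_R.
    eapply Rle_trans; [apply Rmult_le_compat; [apply Rabs_pos|apply Cmod_ge_0|apply Kb; auto|apply (HB (a + S b)%nat)]|].
    right. change (S (a + S b)) with (S a + S b)%nat. rewrite pow_add, Rpow_mult_distr. ring. }
  assert (AE : asum (fun p : nat * nat => RtoC (k (INR (S (fst p))) (INR (S (snd p)))) * (lambert_term (S (fst p)) * lambert_term (S (snd p))))).
  { apply (asum_weight2 j _ (M * M)); [nra|]. intros a b. simpl fst; simpl snd.
    rewrite !Cmod_mult, Cmod_R.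
    apply Rle_trans with (((1 + INR (S a)) * (1 + INR (S b))) ^ j * ((M * Cmod q ^ S a) * (M * Cmod q ^ S b)))%R.
    - apply Rmult_le_compat; auto; try apply Rabs_pos.
      + apply Rmult_le_pos; apply Cmod_ge_0.
      + apply Rmult_le_compat; auto; apply Cmod_ge_0.
    - right. rewrite Rpow_mult_distr. ring. }
  (* Here [u_b] is merely bounded: [u_(a+b)] alone supplies the decay in both indices. *)
  assert (AZ : asum (fun p : nat * nat => RtoC (k (INR (S (fst p))) (INR (S (snd p)))) * (lambert_term (S (fst p) + S (snd p)) * lambert_term (S (snd p))))).
  { apply (asum_weight2 j _ (M * M)); [nra|]. intros a b. simpl fst; simpl snd.
    rewrite !Cmod_mult, Cmod_R.
    apply Rle_trans with (((1 + INR (S a)) * (1 + INR (S b))) ^ j * ((M * Cmod q ^ (S a + S b)) * M))%R.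
    - apply Rmult_le_compat; auto; try apply Rabs_pos.
      + apply Rmult_le_pos; apply Cmod_ge_0.
      + apply Rmult_le_compat; auto; try apply Cmod_ge_0. apply (HB (a + S b)%nat).
    - right. rewrite Rpow_mult_distr, pow_add. ring. }
  set (X := usum (fun p : nat * nat => RtoC (k (INR (S (fst p))) (INR (S (snd p)))) * lambert_term (S (fst p) + S (snd p)))).
  set (Z := usum (fun p : nat * nat => RtoC (k (INR (S (fst p))) (INR (S (snd p)))) * (lambert_term (S (fst p) + S (snd p)) * lambert_term (S (snd p))))).
  (* [X] holds the terms linear in [u]; the terms with [u_(a+b) u_a] and [u_(a+b) u_b] have the same
     sum [Z] because [k] is symmetric. *)
  assert (E1 : usum (fun p : nat * nat => RtoC (k (INR (S (fst p))) (INR (S (snd p)))) * (lambert_term (S (fst p)) * lambert_term (S (snd p)))) = X + Z + Z).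
  { apply usum_unique.
    eapply is_usum_ext; [|apply is_usum_plus; [apply is_usum_plus; [apply (asum_usum _ AX)|apply (asum_usum _ AZ)]|apply is_usum_swap, (asum_usum _ AZ)]].
    intros [a b]. cbv beta. cbn [fst snd]. rewrite lambert_term_mult, (Ks (INR (S b))), (Nat.add_comm (S b)). ring. }
  (* The product sum is cut into pairs above, below and on the diagonal, for both [k] and [sigma].
     The off-diagonal parts run over [u_(a+b) u_b], as [Z] does, so the difference equation for [k]
     compares them and cancels both copies of [Z]. *)
  assert (S2 : forall g : R -> R -> R, (forall x y, g x y = g y x) ->
    asum (fun p : nat * nat => RtoC (g (INR (S (fst p))) (INR (S (snd p)))) * (lambert_term (S (fst p)) * lambert_term (S (snd p)))) ->
    usum (fun p : nat * nat => RtoC (g (INR (S (fst p))) (INR (S (snd p)))) * (lambert_term (S (fst p)) * lambert_term (S (snd p)))) =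
    2 * usum (fun p : nat * nat => RtoC (g (INR (S (fst p)) + INR (S (snd p)))%R (INR (S (snd p)))) * (lambert_term (S (fst p) + S (snd p)) * lambert_term (S (snd p)))) +
    usum (fun n => RtoC (g (INR (S n)) (INR (S n))) * (lambert_term (S n) * lambert_term (S n)))).
  { intros g Gs Ag. rewrite usum_trichotomy by exact Ag. cbn [fst snd].
    lazymatch goal with |- _ + ?a + _ = ?d2 * ?b + _ => 
      replace a with b; [|apply usum_ext] end.
    - lazymatch goal with |- ?a + _ + _ = ?d2 * ?b + _ => 
      replace a with b; [ring|apply usum_ext] end.
      intros [a b]. cbn [fst snd]. replace (S (S (a + b))) with (S a + S b)%nat by lia.
      rewrite <- plus_INR. reflexivity.
    - intros [a b]. cbn [fst snd]. replace (S (S (a + b))) with (S a + S b)%nat by lia.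
      rewrite <- plus_INR, (Gs (INR (S b))). ring. }
  assert (E2 := S2 k Ks AE). assert (E3 := S2 sigma Ss As).
  assert (E4 : usum (fun p : nat * nat => RtoC (sigma (INR (S (fst p)) + INR (S (snd p)))%R (INR (S (snd p)))) * (lambert_term (S (fst p) + S (snd p)) * lambert_term (S (snd p)))) =
    usum (fun p : nat * nat => RtoC (k (INR (S (fst p)) + INR (S (snd p)))%R (INR (S (snd p)))) * (lambert_term (S (fst p) + S (snd p)) * lambert_term (S (snd p)))) - Z).
  { apply usum_unique. eapply is_usum_ext; [|apply is_usum_minus; [apply asum_usum|apply (asum_usum _ AZ)]].
    - intros [a b]. cbn [fst snd]. rewrite <- Kd, RtoC_minus. ring.
    - apply (asum_comp _ (fun p : nat * nat => (S (fst p + snd p), snd p))) in AE.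
      + eapply asum_ext; [|exact AE]. intros [a b]. cbn [fst snd].
        replace (S (S (a + b))) with (S a + S b)%nat by lia. rewrite <- plus_INR. reflexivity.
      + intros [a b] [c d] E; injection E; simpl; intros; f_equal; lia. }
  assert (E5 : X = usum (fun n => lambert_term (S (S n)) *
      RtoC (rsum (fun b => k (INR (S (S n)) - INR (S b)) (INR (S b)))%R (seq 0 (S n))))).
  { unfold X. rewrite usum_antidiagonal by exact AX. apply usum_ext. intros n.
    transitivity (sum_list (fun b => lambert_term (S (S n)) * RtoC (k (INR (S (S n)) - INR (S b)) (INR (S b)))%R) (seq 0 (S n))).
    - apply sum_list_ext_in. intros b Hb. apply in_seq in Hb. cbn [fst snd].
      replace (S (n - b) + S b)%nat with (S (S n)) by lia.
      rewrite <- minus_INR by lia. replace (S (S n) - S b)%nat with (S (n - b)) by lia. ring.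
    - rewrite sum_list_scal, sum_list_RtoC. reflexivity. }
  rewrite <- E5, E3, E4. rewrite E1 in E2. 
  match goal with |- ?d2 * (?a - Z) + ?b + ?c - ?b = X => 
    replace (d2 * (a - Z) + b + c - b) with ((d2 * a + c) - Z - Z) by ring end.
  rewrite <- E2. ring.
Qed.

(** The form used with concrete polynomials. [kappa N] is the sum of [k(N - b, b)] over [0 < b < N];
    it is empty for [N = 1], so [kappa 1 = 0] lets the right-hand side start at the first term of an
    [Ssum]. The diagonal difference [d x] is [k(0, x)]. *)
Lemma lambert_convolution (k sigma : R -> R -> R) (d kappa : R -> R) (j : nat) (Q D s : C) :
  (forall x y, k x y = k y x) -> (forall x y, sigma x y = sigma y x) ->
  (forall x y, k (x + y) y - k x y = sigma (x + y) y)%R ->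
  (forall x y, 0 <= x -> 0 <= y -> 0 <= k x y <= ((1 + x) * (1 + y)) ^ j)%R ->
  (forall x, k x x - sigma x x = d x)%R ->
  kappa 1%R = 0%R ->
  (forall n, rsum (fun b => k (INR (S (S n)) - INR (S b)) (INR (S b)))%R (seq 0 (S n)) = kappa (INR (S (S n)))) ->
  asum (fun p => RtoC (sigma (INR (S (fst p))) (INR (S (snd p)))) * (lambert_term (S (fst p)) * lambert_term (S (snd p)))) ->
  is_usum (fun p => RtoC (sigma (INR (S (fst p))) (INR (S (snd p)))) * (lambert_term (S (fst p)) * lambert_term (S (snd p)))) Q ->
  is_usum (fun n => RtoC (d (INR (S n))) * (lambert_term (S n) * lambert_term (S n))) D ->
  asum (fun n => RtoC (kappa (INR (S n))) * lambert_term (S n)) ->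
  is_usum (fun n => RtoC (kappa (INR (S n))) * lambert_term (S n)) s ->
  Q + D = s.
Proof using Hq.
  intros Ks Ss Kd Kb Hd K1 KE As HQ HD KA KS.
  assert (H := lambert_quadratic k sigma j Ks Ss Kd).
  assert (Kb' : forall x y, (0 <= x -> 0 <= y -> Rabs (k x y) <= ((1 + x) * (1 + y)) ^ j)%R).
  { intros x y Hx Hy. rewrite Rabs_pos_eq; apply Kb; auto. }
  specialize (H Kb' As). rewrite (usum_unique _ _ HQ) in H.
  assert (Ad : asum (fun n => RtoC (sigma (INR (S n)) (INR (S n))) * (lambert_term (S n) * lambert_term (S n)))).
  { apply (asum_comp _ (fun n : nat => (n, n)) ltac:(intros; congruence) As). }
  assert (E1 : usum (fun n => RtoC (k (INR (S n)) (INR (S n))) * (lambert_term (S n) * lambert_term (S n))) =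
    D + usum (fun n => RtoC (sigma (INR (S n)) (INR (S n))) * (lambert_term (S n) * lambert_term (S n)))).
  { apply usum_unique. eapply is_usum_ext; [|apply is_usum_plus; [exact HD|apply (asum_usum _ Ad)]].
    intros n. cbv beta. rewrite <- Hd, RtoC_minus. ring. }
  rewrite E1 in H. rewrite <- (usum_unique _ _ KS), (usum_shift _ KA).
  simpl (INR 1). rewrite K1.
  match goal with |- Q + D = ?z * _ + ?t => replace (z * lambert_term 1 + t) with t by ring end.
  transitivity (usum (fun n => lambert_term (S (S n)) *
      RtoC (rsum (fun b => k (INR (S (S n)) - INR (S b)) (INR (S b)))%R (seq 0 (S n))))).
  - rewrite <- H. ring.
  - apply usum_ext. intros n. rewrite KE. ring.
Qed.

Lemma is_usum_V (e : nat) :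
  is_usum (fun n => RtoC (INR (S n) ^ e) * (lambert_term (S n) * lambert_term (S n))) (Vsum e - Ssum e).
Proof using Hq.
  unfold Vsum, Ssum.
  eapply is_usum_ext; [|apply is_usum_minus; [apply asum_usum|apply (asum_usum _ (asum_S e))]].
  - intros n. cbv beta. ring.
  - eapply asum_ext; [|apply (asum_plus _ _ (asum_S e) (asum_U2 e))]. intros n. cbv beta. ring.
Qed.

Lemma quad_form_bound (x y : R) : (0 <= x -> 0 <= y ->
  0 <= x * x + x * y + y * y <= ((1 + x) * (1 + y)) ^ 2)%R.
Proof using Type. intros Hx Hy. assert (Hxy := Rmult_le_pos _ _ Hx Hy). split; nra. Qed.

Definition quad (x y : R) : R := (x * x + x * y + y * y)%R.

(** The closed form is proved by induction on the number [j] of terms with [N] independent of it;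
    [j = N - 1] is substituted only afterwards. *)
Ltac faulhaber := 
  let N := fresh "N" in let j := fresh "j" in let IH := fresh "IH" in
  intros N j; induction j as [|j IH]; [simpl; unfold quad; field|];
  rewrite seq_S, rsum_app, IH; cbn [rsum fold_right Nat.add]; unfold quad; rewrite !S_INR; field.

Ltac lin_usum := intros; cbv beta; repeat rewrite ?RtoC_plus, ?RtoC_minus, ?RtoC_mult; ring.

(** Here [sigma = 2 x y], the difference of [x^2 + x y + y^2] and [x^2 - x y + y^2]. The term
    [Ssum 2] occurs on both sides and cancels, so the relation has only odd indices besides
    [Vsum 2]. *)
Lemma Ramanujan_V2 :
  2 * (Ssum 1 * Ssum 1) + (Vsum 2 - Ssum 2) = RtoC (5 / 6) * Ssum 3 - Ssum 2 + RtoC (1 / 6) * Ssum 1.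
Proof using Hq.
  apply (lambert_convolution quad (fun x y => 2 * (x ^ 1 * y ^ 1))%R (fun x => x ^ 2)%R
    (fun N => 5 / 6 * N ^ 3 - N ^ 2 + 1 / 6 * N ^ 1)%R 2); try (intros; unfold quad; ring).
  - apply quad_form_bound.
  - field.
  - assert (G : forall N j, rsum (fun b => quad (N - INR (S b)) (INR (S b)))%R (seq 0 j) =
      (INR j * N ^ 2 - N * (INR j * (INR j + 1) / 2) + INR j * (INR j + 1) * (2 * INR j + 1) / 6)%R) by faulhaber.
    intros n. rewrite G, (S_INR (S n)). field.
  - eapply asum_ext; [|apply (asum_scal _ 2 (asum_SS 1 1))]. lin_usum.
  - eapply is_usum_ext; [|apply (is_usum_scal _ 2 _ (usum_SS 1 1))]. lin_usum.
  - apply is_usum_V.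
  - eapply asum_ext; [|apply (asum_plus _ _ (asum_minus _ _ (asum_scal _ (RtoC (5/6)) (asum_S 3)) (asum_S 2)) (asum_scal _ (RtoC (1/6)) (asum_S 1)))].
    lin_usum.
  - eapply is_usum_ext; [|apply (is_usum_plus _ _ _ _ (is_usum_minus _ _ _ _ (is_usum_scal _ (RtoC (5/6)) _ (asum_usum _ (asum_S 3))) (asum_usum _ (asum_S 2))) (is_usum_scal _ (RtoC (1/6)) _ (asum_usum _ (asum_S 1))))].
    lin_usum.
Qed.

Lemma pow_quad_bound (m : nat) (x y : R) : (0 <= x -> 0 <= y ->
  0 <= quad x y ^ m <= ((1 + x) * (1 + y)) ^ (2 * m))%R.
Proof using Type.
  intros Hx Hy. destruct (quad_form_bound x y Hx Hy) as [H1 H2]. split; [apply pow_le, H1|].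
  rewrite pow_mult. apply pow_incr. split; assumption.
Qed.

Lemma Ramanujan_V4 :
  4 * (Ssum 3 * Ssum 1 + Ssum 1 * Ssum 3) + (Vsum 4 - Ssum 4) =
  (RtoC (7 / 10) * Ssum 5 - Ssum 4) + (RtoC (1 / 3) * Ssum 3 - RtoC (1 / 30) * Ssum 1).
Proof using Hq.
  apply (lambert_convolution (fun x y => quad x y ^ 2)%R (fun x y => 4 * (x ^ 3 * y ^ 1 + x ^ 1 * y ^ 3))%R
    (fun x => x ^ 4)%R (fun N => (7 / 10 * N ^ 5 - N ^ 4) + (1 / 3 * N ^ 3 - 1 / 30 * N ^ 1))%R 4);
    try (intros; unfold quad; ring).
  - apply (pow_quad_bound 2).
  - field.
  - assert (G : forall N j, rsum (fun b => quad (N - INR (S b)) (INR (S b)) ^ 2)%R (seq 0 j) =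
      (INR j * N ^ 4 - 2 * N ^ 3 * (INR j * (INR j + 1) / 2) + 3 * N ^ 2 * (INR j * (INR j + 1) * (2 * INR j + 1) / 6)
       - 2 * N * (INR j ^ 2 * (INR j + 1) ^ 2 / 4)
       + INR j * (INR j + 1) * (2 * INR j + 1) * (3 * INR j ^ 2 + 3 * INR j - 1) / 30)%R) by faulhaber.
    intros n. rewrite G, (S_INR (S n)). field.
  - eapply asum_ext; [|apply (asum_scal _ 4 (asum_plus _ _ (asum_SS 3 1) (asum_SS 1 3)))]. lin_usum.
  - eapply is_usum_ext; [|apply (is_usum_scal _ 4 _ (is_usum_plus _ _ _ _ (usum_SS 3 1) (usum_SS 1 3)))]. lin_usum.
  - apply is_usum_V.
  - eapply asum_ext; [|apply (asum_plus _ _ (asum_minus _ _ (asum_scal _ (RtoC (7/10)) (asum_S 5)) (asum_S 4))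
      (asum_minus _ _ (asum_scal _ (RtoC (1/3)) (asum_S 3)) (asum_scal _ (RtoC (1/30)) (asum_S 1))))].
    lin_usum.
  - eapply is_usum_ext; [|apply (is_usum_plus _ _ _ _
      (is_usum_minus _ _ _ _ (is_usum_scal _ (RtoC (7/10)) _ (asum_usum _ (asum_S 5))) (asum_usum _ (asum_S 4)))
      (is_usum_minus _ _ _ _ (is_usum_scal _ (RtoC (1/3)) _ (asum_usum _ (asum_S 3))) (is_usum_scal _ (RtoC (1/30)) _ (asum_usum _ (asum_S 1)))))].
    lin_usum.
Qed.

Lemma Ramanujan_V6 :
  (6 * (Ssum 5 * Ssum 1 + Ssum 1 * Ssum 5) + 14 * (Ssum 3 * Ssum 3)) + (Vsum 6 - Ssum 6) =
  (RtoC (83 / 140) * Ssum 7 - Ssum 6) + ((RtoC (1 / 2) * Ssum 5 - RtoC (7 / 60) * Ssum 3) + RtoC (1 / 42) * Ssum 1).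
Proof using Hq.
  apply (lambert_convolution (fun x y => quad x y ^ 3)%R
    (fun x y => 6 * (x ^ 5 * y ^ 1 + x ^ 1 * y ^ 5) + 14 * (x ^ 3 * y ^ 3))%R
    (fun x => x ^ 6)%R
    (fun N => (83 / 140 * N ^ 7 - N ^ 6) + ((1 / 2 * N ^ 5 - 7 / 60 * N ^ 3) + 1 / 42 * N ^ 1))%R 6);
    try (intros; unfold quad; ring).
  - apply (pow_quad_bound 3).
  - field.
  - assert (G : forall N j, rsum (fun b => quad (N - INR (S b)) (INR (S b)) ^ 3)%R (seq 0 j) =
      (INR j * N ^ 6 - 3 * N ^ 5 * (INR j * (INR j + 1) / 2) + 6 * N ^ 4 * (INR j * (INR j + 1) * (2 * INR j + 1) / 6)
       - 7 * N ^ 3 * (INR j ^ 2 * (INR j + 1) ^ 2 / 4)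
       + 6 * N ^ 2 * (INR j * (INR j + 1) * (2 * INR j + 1) * (3 * INR j ^ 2 + 3 * INR j - 1) / 30)
       - 3 * N * (INR j ^ 2 * (INR j + 1) ^ 2 * (2 * INR j ^ 2 + 2 * INR j - 1) / 12)
       + INR j * (INR j + 1) * (2 * INR j + 1) * (3 * INR j ^ 4 + 6 * INR j ^ 3 - 3 * INR j + 1) / 42)%R) by faulhaber.
    intros n. rewrite G, (S_INR (S n)). field.
  - eapply asum_ext; [|apply (asum_plus _ _ (asum_scal _ 6 (asum_plus _ _ (asum_SS 5 1) (asum_SS 1 5)))
      (asum_scal _ 14 (asum_SS 3 3)))]. lin_usum.
  - eapply is_usum_ext; [|apply (is_usum_plus _ _ _ _ (is_usum_scal _ 6 _ (is_usum_plus _ _ _ _ (usum_SS 5 1) (usum_SS 1 5)))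
      (is_usum_scal _ 14 _ (usum_SS 3 3)))]. lin_usum.
  - apply is_usum_V.
  - eapply asum_ext; [|apply (asum_plus _ _ (asum_minus _ _ (asum_scal _ (RtoC (83/140)) (asum_S 7)) (asum_S 6))
      (asum_plus _ _ (asum_minus _ _ (asum_scal _ (RtoC (1/2)) (asum_S 5)) (asum_scal _ (RtoC (7/60)) (asum_S 3)))
        (asum_scal _ (RtoC (1/42)) (asum_S 1))))].
    lin_usum.
  - eapply is_usum_ext; [|apply (is_usum_plus _ _ _ _
      (is_usum_minus _ _ _ _ (is_usum_scal _ (RtoC (83/140)) _ (asum_usum _ (asum_S 7))) (asum_usum _ (asum_S 6)))
      (is_usum_plus _ _ _ _ (is_usum_minus _ _ _ _ (is_usum_scal _ (RtoC (1/2)) _ (asum_usum _ (asum_S 5))) (is_usum_scal _ (RtoC (7/60)) _ (asum_usum _ (asum_S 3))))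
        (is_usum_scal _ (RtoC (1/42)) _ (asum_usum _ (asum_S 1)))))].
    lin_usum.
Qed.

(** The weight vanishes as soon as one argument is zero, so the diagonal contributes nothing and no
    [Vsum] appears. *)
Lemma Ssum_7 : 4 * (Ssum 3 * Ssum 3) + 0 = RtoC (1 / 30) * Ssum 7 - RtoC (1 / 30) * Ssum 3.
Proof using Hq.
  apply (lambert_convolution (fun x y => (x * y * (x + y)) ^ 2)%R (fun x y => 4 * (x ^ 3 * y ^ 3))%R
    (fun x => 0)%R (fun N => 1 / 30 * N ^ 7 - 1 / 30 * N ^ 3)%R 4);
    try (intros; ring).
  - intros x y Hx Hy. assert (Hxy := Rmult_le_pos _ _ Hx Hy). 
    assert (0 <= x * y * (x + y))%R by (apply Rmult_le_pos; lra).
    split; [apply pow_le; auto|]. change 4%nat with (2 * 2)%nat.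
    rewrite pow_mult. apply pow_incr. split; auto.
    simpl. rewrite Rmult_1_r. apply Rmult_le_compat; lra || nra.
  - assert (G : forall N j, rsum (fun b => ((N - INR (S b)) * (INR (S b)) * (N - INR (S b) + INR (S b))) ^ 2)%R (seq 0 j) =
      (N ^ 4 * (INR j * (INR j + 1) * (2 * INR j + 1) / 6)
       - 2 * N ^ 3 * (INR j ^ 2 * (INR j + 1) ^ 2 / 4)
       + N ^ 2 * (INR j * (INR j + 1) * (2 * INR j + 1) * (3 * INR j ^ 2 + 3 * INR j - 1) / 30))%R) by faulhaber.
    intros n. rewrite G, (S_INR (S n)). field.
  - eapply asum_ext; [|apply (asum_scal _ 4 (asum_SS 3 3))]. lin_usum.
  - eapply is_usum_ext; [|apply (is_usum_scal _ 4 _ (usum_SS 3 3))]. lin_usum.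
  - eapply is_usum_ext; [|apply is_usum_zero]. lin_usum.
  - eapply asum_ext; [|apply (asum_minus _ _ (asum_scal _ (RtoC (1/30)) (asum_S 7)) (asum_scal _ (RtoC (1/30)) (asum_S 3)))].
    lin_usum.
  - eapply is_usum_ext; [|apply (is_usum_minus _ _ _ _ (is_usum_scal _ (RtoC (1/30)) _ (asum_usum _ (asum_S 7))) (is_usum_scal _ (RtoC (1/30)) _ (asum_usum _ (asum_S 3))))].
    lin_usum.
Qed.

Lemma Ramanujan_algebraic :
  let P := 1 - 24 * Ssum 1 in let Q := 1 + 240 * Ssum 3 in let R := 1 - 504 * Ssum 5 in
  -24 * Vsum 2 = 1 / 12 * (P ^ 2 - Q) /\
  240 * Vsum 4 = 1 / 3 * (P * Q - R) /\
  -504 * Vsum 6 = 1 / 2 * (P * R - Q ^ 2).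
Proof using Hq.
  intros P Q R.
  assert (H2 := Ramanujan_V2). assert (H4 := Ramanujan_V4).
  assert (H6 := Ramanujan_V6). assert (H7 := Ssum_7).
  repeat rewrite RtoC_div in H2 by lra. repeat rewrite RtoC_div in H4 by lra.
  repeat rewrite RtoC_div in H6 by lra. repeat rewrite RtoC_div in H7 by lra.
  split; [|split].
  - replace (Vsum 2) with ((2 * (Ssum 1 * Ssum 1) + (Vsum 2 - Ssum 2)) - 2 * (Ssum 1 * Ssum 1) + Ssum 2) by ring.
    rewrite H2. unfold P, Q. field.
  - replace (Vsum 4) with ((4 * (Ssum 3 * Ssum 1 + Ssum 1 * Ssum 3) + (Vsum 4 - Ssum 4)) 
      - 4 * (Ssum 3 * Ssum 1 + Ssum 1 * Ssum 3) + Ssum 4) by ring.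
    rewrite H4. unfold P, Q, R. field.
  - replace (Vsum 6) with ((6 * (Ssum 5 * Ssum 1 + Ssum 1 * Ssum 5) + 14 * (Ssum 3 * Ssum 3) + (Vsum 6 - Ssum 6)) 
      - (6 * (Ssum 5 * Ssum 1 + Ssum 1 * Ssum 5) + 14 * (Ssum 3 * Ssum 3)) + Ssum 6) by ring.
    rewrite H6. 
    (* This is the coefficient form of [E8 = E4^2]; it rewrites the only sum that is not a
       polynomial in [P], [Q], [R]. *)
    assert (E : Ssum 7 = 120 * (Ssum 3 * Ssum 3) + Ssum 3).
    { replace (Ssum 7) with (30 * (1 / 30 * Ssum 7 - 1 / 30 * Ssum 3) + Ssum 3) by field.
      rewrite <- H7. ring. }
    rewrite E. unfold P, Q, R. field.
Qed.

End lambert_algebra.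

(** * Exponential series *)

Lemma Cexp_add (z w : C) : Cexp (z + w) = Cexp z * Cexp w.
Proof.
  unfold Cexp, Cmult, Cplus, Re, Im; simpl. rewrite exp_plus, cos_plus, sin_plus.
  f_equal; ring.
Qed.

Lemma Cexp_0 : Cexp 0 = 1.
Proof. unfold Cexp, Re, Im; simpl. rewrite exp_0, cos_0, sin_0. unfold RtoC. f_equal; ring. Qed.

Lemma Cmod_Cexp (z : C) : Cmod (Cexp z) = exp (Re z).
Proof.
  unfold Cmod, Cexp; simpl.
  replace (exp (Re z) * cos (Im z) * (exp (Re z) * cos (Im z) * 1) +
    exp (Re z) * sin (Im z) * (exp (Re z) * sin (Im z) * 1))%R with
    ((exp (Re z))² * ((sin (Im z))² + (cos (Im z))²))%R by (unfold Rsqr; ring).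
  rewrite sin2_cos2, Rmult_1_r. apply sqrt_Rsqr, Rlt_le, exp_pos.
Qed.

Lemma Cexp_neq_0 (z : C) : Cexp z <> 0.
Proof.
  intros E. apply (f_equal Cmod) in E. rewrite Cmod_Cexp, Cmod_0 in E.
  assert (H := exp_pos (Re z)). lra.
Qed.

Lemma Cexp_pow (z : C) (n : nat) : Cexp z ^ n = Cexp (INR n * z).
Proof.
  induction n as [|n IH].
  - simpl. rewrite Cmult_0_l, Cexp_0. reflexivity.
  - rewrite Cpow_S, IH, <- Cexp_add. f_equal. rewrite S_INR, RtoC_plus. ring.
Qed.

Lemma Cexp_opp (z : C) : Cexp (- z) = / Cexp z.
Proof.
  assert (H := Cexp_neq_0 z).
  assert (E : Cexp (- z) * Cexp z = 1).
  { rewrite <- Cexp_add, <- Cexp_0. f_equal. ring. }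
  replace (Cexp (- z)) with (Cexp (- z) * Cexp z * / Cexp z) by (field; auto).
  rewrite E. ring.
Qed.

(** Complex differentiability with explicit [eps] and [del], so that remainders of series can be
    estimated directly; [cderiv_is_derive] leads back to [is_derive]. *)
Definition cderiv (f : C -> C) (x l : C) : Prop :=
  forall eps : R, (0 < eps)%R -> exists del : R, (0 < del)%R /\
    forall y, (Cmod (y - x) < del)%R -> (Cmod (f y - f x - (y - x) * l) <= eps * Cmod (y - x))%R.

Definition ccont (f : C -> C) (x : C) : Prop :=
  forall eps : R, (0 < eps)%R -> exists del : R, (0 < del)%R /\
    forall y, (Cmod (y - x) < del)%R -> (Cmod (f y - f x) < eps)%R.

Lemma cderiv_is_derive (f : C -> C) (x l : C) :
  cderiv f x l -> is_derive (K := C_AbsRing) (V := C_NormedModule) f x l.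
Proof.
  intros H. split; [apply is_linear_scal_l|].
  intros x' Hx' eps.
  apply (is_filter_lim_locally_unique (K := C_AbsRing) (V := AbsRing_NormedModule C_AbsRing)) in Hx'. subst x'.
  destruct (H eps (cond_pos eps)) as [del [Hd HH]].
  exists (mkposreal del Hd). intros y Hy. apply (HH y). exact Hy.
Qed.

Lemma im_le_Cmod (z : C) : (Rabs (Im z) <= Cmod z)%R.
Proof. eapply Rle_trans; [apply Rmax_r|apply Rmax_Cmod]. Qed.

Lemma exp_sub_1_bound (a : R) : (Rabs (exp a - 1) <= Rabs a * exp (Rabs a))%R.
Proof.
  assert (H := exp_ineq1_le a). assert (H' := exp_ineq1_le (- a)).
  assert (P := exp_pos a). rewrite exp_Ropp in H'.
  assert (Hi : (exp a * / exp a = 1)%R) by (field; lra).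
  destruct (Rle_dec 0 a) as [Ha|Ha].
  - rewrite !Rabs_pos_eq by lra. nra.
  - rewrite !(Rabs_left1 a) by lra.
    assert (E := exp_ineq1_le (- a)). 
    assert (exp a <= 1)%R by (rewrite <- exp_0; apply exp_le; lra).
    rewrite Rabs_left1 by lra. nra.
Qed.

Lemma exp_Taylor2 (a : R) : (Rabs (exp a - 1 - a) <= a ^ 2 * exp (Rabs a))%R.
Proof.
  assert (H := exp_ineq1_le a). rewrite Rabs_pos_eq by lra.
  destruct (Rle_dec 0 a) as [Ha|Ha].
  - assert (H' := exp_sub_1_bound a). rewrite !(Rabs_pos_eq a) in * by lra.
    rewrite Rabs_pos_eq in H' by lra.
    assert (H2 := exp_ineq1_le (- a)). rewrite exp_Ropp in H2. assert (P := exp_pos a).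
    assert (Hi : (exp a * / exp a = 1)%R) by (field; lra).
    assert (exp a - 1 <= a * exp a)%R by nra. nra.
  - assert (H2 := exp_ineq1_le (- a)). rewrite exp_Ropp in H2. assert (P := exp_pos a).
    assert (Hi : (exp a * / exp a = 1)%R) by (field; lra).
    assert (E1 : (1 <= exp (Rabs a))%R) by (rewrite <- exp_0; apply exp_le, Rabs_pos).
    assert (E2 : (exp a * (1 - a) <= 1)%R) by nra.
    assert (exp a - 1 - a <= a ^ 2)%R; [|nra].
    assert ((exp a - 1 - a) * (1 - a) <= a ^ 2 * (1 - a))%R; [nra|].
    apply Rmult_le_reg_r with (1 - a)%R; lra.
Qed.

Lemma Rabs_sin_le (b : R) : (Rabs (sin b) <= Rabs b)%R.
Proof.
  destruct (Rtotal_order b 0) as [H|[->|H]].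
  - rewrite <- (Rabs_Ropp b), <- (Rabs_Ropp (sin b)), <- sin_neg.
    assert (H1 := sin_lt_x (- b)). rewrite (Rabs_pos_eq (- b)) by lra.
    apply Rabs_le. split; [|lra].
    destruct (Rle_dec (- b) 1) as [L|L].
    + assert (0 <= sin (- b))%R; [|lra]. apply sin_ge_0; [lra|]. assert (P := PI2_1). lra.
    + assert (S := SIN_bound (- b)). lra.
  - rewrite sin_0. lra.
  - assert (H1 := sin_lt_x b). rewrite (Rabs_pos_eq b) by lra.
    apply Rabs_le. split; [|lra].
    destruct (Rle_dec b 1) as [L|L].
    + assert (0 <= sin b)%R; [|lra]. apply sin_ge_0; [lra|]. assert (P := PI2_1). lra.
    + assert (S := SIN_bound b). lra.
Qed.

Lemma one_sub_cos_bound (b : R) : (0 <= 1 - cos b <= b ^ 2 / 2)%R.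
Proof.
  assert (S := COS_bound b). split; [lra|].
  assert (E : (1 - cos b = 2 * (sin (b / 2))²)%R).
  { replace b with (2 * (b / 2))%R at 1 by field. rewrite cos_2a_sin. unfold Rsqr. ring. }
  rewrite E. assert (H := Rabs_sin_le (b / 2)). apply Rsqr_le_abs_1 in H. unfold Rsqr in *. lra.
Qed.

Lemma sin_sub_bound (b : R) : (Rabs (sin b - b) <= b ^ 2)%R.
Proof.
  destruct (MVT_abs sin cos 0 b) as [c [Hc Hc2]].
  { intros c _. apply derivable_pt_lim_sin. }
  destruct (MVT_abs (fun x => sin x - x)%R (fun x => cos x - 1)%R 0 b) as [d [Hd Hd2]].
  { intros d _. apply derivable_pt_lim_minus; [apply derivable_pt_lim_sin|apply derivable_pt_lim_id]. }
  rewrite sin_0, !Rminus_0_r in Hd. rewrite Hd.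
  assert (K := one_sub_cos_bound d). assert (S := COS_bound d).
  assert (Hdb : (Rabs d <= Rabs b)%R).
  { unfold Rmin, Rmax in Hd2. destruct (Rle_dec 0 b); unfold Rabs; destruct (Rcase_abs d), (Rcase_abs b); lra. }
  assert (Rabs (cos d - 1) <= Rabs b)%R.
  { rewrite Rabs_left1 by lra. 
    apply Rsqr_incr_0_var; [|apply Rabs_pos].
    apply Rsqr_le_abs_1 in Hdb. rewrite <- Rsqr_abs. unfold Rsqr in *. nra. }
  assert (P := Rabs_pos b). replace (b ^ 2)%R with (Rabs b * Rabs b)%R.
  - apply Rmult_le_compat_r; auto.
  - rewrite <- Rabs_mult, Rabs_pos_eq; [ring|apply Rle_0_sqr].
Qed.

Lemma Cmod_le_abs (a b : R) : (Cmod (a, b) <= Rabs a + Rabs b)%R.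
Proof.
  replace (a, b) with (RtoC a + Ci * RtoC b) by (unfold RtoC, Ci, Cmult, Cplus; simpl; f_equal; ring).
  eapply Rle_trans; [apply Cmod_triangle|]. rewrite Cmod_mult, !Cmod_R.
  replace (Cmod Ci) with 1%R; [lra|]. unfold Cmod, Ci; simpl.
  replace (0 * (0 * 1) + 1 * (1 * 1))%R with 1%R by ring. rewrite sqrt_1. reflexivity.
Qed.

(** The constant is not sharp. What matters is a quadratic remainder valid for all [h], with a
    growth that the margin in [exp_summable] can absorb. *)
Lemma Cexp_Taylor2 (h : C) : (Cmod (Cexp h - 1 - h) <= 8 * Cmod h ^ 2 * exp (Cmod h))%R.
Proof.
  destruct h as [a b].
  assert (Ha : (Rabs a <= Cmod (a, b))%R) by apply (re_le_Cmod (a, b)).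
  assert (Hb : (Rabs b <= Cmod (a, b))%R) by apply (im_le_Cmod (a, b)).
  set (m := Cmod (a, b)) in *.
  assert (Hm : (0 <= m)%R) by apply Cmod_ge_0.
  assert (Em : (1 + m <= exp m)%R) by apply exp_ineq1_le.
  assert (Ea : (exp (Rabs a) <= exp m)%R) by (apply exp_le; auto).
  assert (Ea0 := exp_pos (Rabs a)).
  replace (Cexp (a, b) - 1 - (a, b)) with ((exp a * cos b - 1 - a)%R, (exp a * sin b - b)%R)
    by (unfold Cexp, RtoC, Cminus, Cplus, Copp; simpl; f_equal; ring).
  eapply Rle_trans; [apply Cmod_le_abs|].
  assert (Pa := Rabs_pos a). assert (Pb := Rabs_pos b).
  assert (Qa : (a ^ 2 <= m ^ 2)%R) by (rewrite <- (pow2_abs a); apply pow_incr; auto).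
  assert (Qb : (b ^ 2 <= m ^ 2)%R) by (rewrite <- (pow2_abs b); apply pow_incr; auto).
  assert (Q0 : (0 <= m ^ 2)%R) by (apply pow_le; auto).
  assert (Qa0 : (0 <= a ^ 2)%R) by (apply pow2_ge_0).
  assert (Qb0 : (0 <= b ^ 2)%R) by (apply pow2_ge_0).
  assert (H1 : (Rabs (exp a * cos b - 1 - a) <= 2 * m ^ 2 * exp m)%R).
  { replace (exp a * cos b - 1 - a)%R with ((exp a - 1 - a) * cos b + - ((1 + a) * (1 - cos b)))%R by ring.
    eapply Rle_trans; [apply Rabs_triang|]. rewrite Rabs_Ropp, !Rabs_mult.
    assert (K1 := exp_Taylor2 a). assert (K2 := one_sub_cos_bound b).
    assert (K3 : (Rabs (cos b) <= 1)%R) by (apply Rabs_le; assert (S := COS_bound b); lra).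
    rewrite (Rabs_pos_eq (1 - cos b)) by lra.
    assert (K4 : (Rabs (1 + a) <= 1 + m)%R).
    { eapply Rle_trans; [apply Rabs_triang|]. rewrite Rabs_R1. lra. }
    assert (K5 : (Rabs (exp a - 1 - a) * Rabs (cos b) <= (m ^ 2 * exp m) * 1)%R).
    { apply Rmult_le_compat; auto using Rabs_pos. eapply Rle_trans; [apply K1|].
      apply Rmult_le_compat; lra. }
    assert (K6 : (Rabs (1 + a) * (1 - cos b) <= exp m * m ^ 2)%R).
    { apply Rmult_le_compat; try lra. apply Rabs_pos. }
    lra. }
  assert (H2 : (Rabs (exp a * sin b - b) <= 2 * m ^ 2 * exp m)%R).
  { replace (exp a * sin b - b)%R with ((exp a - 1) * sin b + (sin b - b))%R by ring.
    eapply Rle_trans; [apply Rabs_triang|]. rewrite Rabs_mult.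
    assert (K1 := exp_sub_1_bound a). assert (K2 := Rabs_sin_le b). assert (K3 := sin_sub_bound b).
    assert (K5 : (Rabs (exp a - 1) * Rabs (sin b) <= (m * exp m) * m)%R).
    { apply Rmult_le_compat; auto using Rabs_pos; [|lra]. eapply Rle_trans; [apply K1|].
      apply Rmult_le_compat; lra. }
    nra. }
  nra.
Qed.

Lemma cderiv_ccont (f : C -> C) (x l : C) : cderiv f x l -> ccont f x.
Proof.
  intros H eps Heps. destruct (H 1%R Rlt_0_1) as [d [Hd HH]].
  assert (P := Cmod_ge_0 l).
  exists (Rmin d (eps / (2 + Cmod l))). split.
  { apply Rmin_pos; auto. apply Rdiv_lt_0_compat; lra. }
  intros y Hy.
  assert (Hy1 : (Cmod (y - x) < d)%R) by (eapply Rlt_le_trans; [apply Hy|apply Rmin_l]).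
  assert (Hy2 : (Cmod (y - x) < eps / (2 + Cmod l))%R) by (eapply Rlt_le_trans; [apply Hy|apply Rmin_r]).
  specialize (HH y Hy1).
  replace (f y - f x) with ((f y - f x - (y - x) * l) + (y - x) * l) by ring.
  eapply Rle_lt_trans; [apply Cmod_triangle|]. rewrite Cmod_mult.
  assert (Q := Cmod_ge_0 (y - x)).
  apply (Rmult_lt_compat_r (2 + Cmod l)) in Hy2; [|lra].
  replace (eps / (2 + Cmod l) * (2 + Cmod l))%R with eps in Hy2 by (field; lra). nra.
Qed.

Lemma cderiv_quadratic (f : C -> C) (x l : C) (K d : R) : (0 < d)%R ->
  (forall y, (Cmod (y - x) < d)%R -> (Cmod (f y - f x - (y - x) * l) <= K * Cmod (y - x) ^ 2)%R) ->
  cderiv f x l.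
Proof.
  intros Hd H eps Heps. set (K' := (Rabs K + 1)%R).
  assert (HK' : (0 < K' /\ K <= K')%R) by (unfold K'; assert (P := Rabs_pos K); assert (Q := Rle_abs K); lra).
  exists (Rmin d (eps / K')). split; [apply Rmin_pos; auto; apply Rdiv_lt_0_compat; lra|].
  intros y Hy.
  assert (Hy1 : (Cmod (y - x) < d)%R) by (eapply Rlt_le_trans; [apply Hy|apply Rmin_l]).
  assert (Hy2 : (Cmod (y - x) < eps / K')%R) by (eapply Rlt_le_trans; [apply Hy|apply Rmin_r]).
  eapply Rle_trans; [apply H; auto|]. assert (P := Cmod_ge_0 (y - x)).
  apply (Rmult_lt_compat_r K') in Hy2; [|lra].
  replace (eps / K' * K')%R with eps in Hy2 by (field; lra).
  simpl. nra.
Qed.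

(** Termwise differentiation from summable second-order remainders, without a separate argument on
    uniform convergence of the derivatives. *)
Lemma usum_cderiv {T : Type} (f : T -> C -> C) (f' : T -> C) (M : T -> R) (x : C) (d : R) :
  (0 < d)%R -> (forall t, 0 <= M t)%R -> bsum M ->
  (forall t y, (Cmod (y - x) < d)%R ->
     (Cmod (f t y - f t x - (y - x) * f' t) <= M t * Cmod (y - x) ^ 2)%R) ->
  (forall y, (Cmod (y - x) < d)%R -> asum (fun t => f t y)) -> asum f' ->
  cderiv (fun y => usum (fun t => f t y)) x (usum f').
Proof.
  intros Hd HM [B HB] Hf Hs Hs'. apply (cderiv_quadratic _ _ _ B d Hd).
  intros y Hy.
  assert (Hx : (Cmod (x - x) < d)%R) by (replace (x - x) with (RtoC 0) by ring; rewrite Cmod_0; auto).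
  eapply (is_usum_bound (fun t => f t y - f t x - (y - x) * f' t)).
  - apply is_usum_minus; [apply is_usum_minus; apply asum_usum; auto|].
    apply is_usum_scal, asum_usum, Hs'.
  - intros F N. eapply Rle_trans; [apply rsum_le; intros t; apply Hf, Hy|].
    rewrite (Rmult_comm B).
    replace (rsum (fun t => (M t * Cmod (y - x) ^ 2)%R) F) with (rsum (fun t => (Cmod (y - x) ^ 2 * M t)%R) F).
    + rewrite rsum_scal. apply Rmult_le_compat_l; [apply pow_le, Cmod_ge_0|auto].
    + f_equal. apply functional_extensionality. intros t. ring.
Qed.

(** One form serves both the q-series, as functions of [tau], and the Fourier series, as functions
    of [s]. *)
Definition exp_series {T : Type} (c mu : T -> C) (z : C) : C := usum (fun t => c t * Cexp (mu t * z)).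

(** The margin [d] makes the condition open in [z] and absorbs the factors [mu t] produced by
    differentiation. *)
Definition exp_summable {T : Type} (c mu : T -> C) (z : C) : Prop :=
  exists d : R, (0 < d)%R /\ bsum (fun t => Cmod (c t) * exp (Re (mu t * z)) * exp (d * Cmod (mu t)))%R.

Lemma exp_summable_asum {T : Type} (c mu : T -> C) z : exp_summable c mu z -> asum (fun t => c t * Cexp (mu t * z)).
Proof.
  intros [d [Hd H]]. eapply asum_le; [|exact H]. intros t. cbv beta.
  rewrite Cmod_mult, Cmod_Cexp.
  assert (E : (1 <= exp (d * Cmod (mu t)))%R).
  { rewrite <- exp_0. apply exp_le. apply Rmult_le_pos; [lra|apply Cmod_ge_0]. }
  assert (P : (0 <= Cmod (c t) * exp (Re (mu t * z)))%R).
  { apply Rmult_le_pos; [apply Cmod_ge_0|apply Rlt_le, exp_pos]. }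
  nra.
Qed.

Lemma exp_summable_deriv {T : Type} (c mu : T -> C) z : exp_summable c mu z -> exp_summable (fun t => c t * mu t) mu z.
Proof.
  intros [d [Hd H]]. exists (d / 2)%R. split; [lra|].
  destruct (pow_le_exp 1 (d / 2)) as [K [HK HH]]; [lra|].
  apply bsum_le with (2 := bsum_scal _ K (Rlt_le _ _ HK) H).
  intros t. rewrite Cmod_mult. assert (Hm := HH _ (Cmod_ge_0 (mu t))). rewrite pow_1 in Hm.
  replace (exp (d * Cmod (mu t)))%R with (exp (d / 2 * Cmod (mu t)) * exp (d / 2 * Cmod (mu t)))%R
    by (rewrite <- exp_plus; f_equal; field).
  set (e := exp (d / 2 * Cmod (mu t))) in *. 
  assert (Pe : (0 < e)%R) by apply exp_pos.
  assert (P : (0 <= Cmod (c t) * exp (Re (mu t * z)) * e)%R).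
  { apply Rmult_le_pos; [apply Rmult_le_pos; [apply Cmod_ge_0|apply Rlt_le, exp_pos]|lra]. }
  replace (Cmod (c t) * Cmod (mu t) * exp (Re (mu t * z)) * e)%R with
   ((Cmod (c t) * exp (Re (mu t * z)) * e) * Cmod (mu t))%R by ring.
  replace (K * (Cmod (c t) * exp (Re (mu t * z)) * (e * e)))%R with
   ((Cmod (c t) * exp (Re (mu t * z)) * e) * (K * e))%R by ring.
  apply Rmult_le_compat_l; auto.
Qed.

Lemma Re_mult_le (a b : C) : (Re (a * b) <= Cmod a * Cmod b)%R.
Proof. rewrite <- Cmod_mult. eapply Rle_trans; [apply Rle_abs|apply re_le_Cmod]. Qed.

Lemma exp_summable_near {T : Type} (c mu : T -> C) z : exp_summable c mu z ->
  exists d : R, (0 < d)%R /\ forall y, (Cmod (y - z) < d)%R -> exp_summable c mu y.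
Proof.
  intros [d [Hd H]]. exists (d / 2)%R. split; [lra|]. intros y Hy. exists (d / 2)%R. split; [lra|].
  apply bsum_le with (2 := H). intros t.
  rewrite !Rmult_assoc. apply Rmult_le_compat_l; [apply Cmod_ge_0|].
  rewrite <- !exp_plus. apply exp_le.
  replace (mu t * y) with (mu t * z + mu t * (y - z)) by ring.
  rewrite re_plus. assert (K := Re_mult_le (mu t) (y - z)).
  assert (P := Cmod_ge_0 (mu t)). nra.
Qed.

Lemma exp_series_cderiv {T : Type} (c mu : T -> C) z : exp_summable c mu z ->
  cderiv (exp_series c mu) z (exp_series (fun t => c t * mu t) mu z).
Proof.
  intros H. destruct (exp_summable_near c mu z H) as [d1 [Hd1 Hn]].
  (* The quadratic remainder of each term costs a factor [mu t ^ 2], hence summability of the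
     coefficients of the second derivative. *)
  assert (H1 := exp_summable_deriv _ _ _ H). assert (H2 := exp_summable_deriv _ _ _ H1).
  destruct H2 as [d2 [Hd2 [B HB]]].
  unfold exp_series.
  apply (usum_cderiv (fun t y => c t * Cexp (mu t * y)) (fun t => c t * mu t * Cexp (mu t * z))
    (fun t => 8 * (Cmod (c t * mu t * mu t) * exp (Re (mu t * z)) * exp (d2 * Cmod (mu t))))%R z (Rmin d1 d2)).
  - apply Rmin_pos; auto.
  - intros t. apply Rmult_le_pos; [lra|]. apply Rmult_le_pos; [apply Rmult_le_pos; [apply Cmod_ge_0|]|]; apply Rlt_le, exp_pos.
  - apply bsum_scal; [lra|]. exists B. exact HB.
  - intros t y Hy.
    assert (Hy2 : (Cmod (y - z) < d2)%R) by (eapply Rlt_le_trans; [apply Hy|apply Rmin_r]).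
    replace (c t * Cexp (mu t * y) - c t * Cexp (mu t * z) - (y - z) * (c t * mu t * Cexp (mu t * z)))
      with (c t * Cexp (mu t * z) * (Cexp (mu t * (y - z)) - 1 - mu t * (y - z))).
    + rewrite !Cmod_mult, Cmod_Cexp.
      assert (K := Cexp_Taylor2 (mu t * (y - z))). rewrite Cmod_mult in K.
      assert (P : (0 <= Cmod (c t) * exp (Re (mu t * z)))%R).
      { apply Rmult_le_pos; [apply Cmod_ge_0|apply Rlt_le, exp_pos]. }
      eapply Rle_trans; [apply Rmult_le_compat_l; [exact P|exact K]|].
      assert (E : (exp (Cmod (mu t) * Cmod (y - z)) <= exp (d2 * Cmod (mu t)))%R).
      { apply exp_le. assert (Q := Cmod_ge_0 (mu t)). nra. }
      rewrite Rpow_mult_distr.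
      assert (Q : (0 <= Cmod (c t) * exp (Re (mu t * z)) * (8 * (Cmod (mu t) ^ 2 * Cmod (y - z) ^ 2)))%R).
      { apply Rmult_le_pos; auto. apply Rmult_le_pos; [lra|]. apply Rmult_le_pos; apply pow_le, Cmod_ge_0. }
      apply Rmult_le_compat_l with (1 := Q) in E. simpl in *. nra.
    + replace (mu t * y) with (mu t * z + mu t * (y - z)) by ring. rewrite Cexp_add. ring.
  - intros y Hy. apply exp_summable_asum, Hn. eapply Rlt_le_trans; [apply Hy|apply Rmin_l].
  - apply exp_summable_asum, H1.
Qed.

(** * Eisenstein series and the Ramanujan identities *)

Lemma asum_pow_geom (i : nat) (x : C) : (Cmod x < 1)%R -> asum (fun n => RtoC (INR (S n) ^ i) * x ^ S n).
Proof.
  intros Hx. apply asum_le with (fun n => INR (S n) ^ i * Cmod x ^ S n)%R.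
  - intros n. rewrite Cmod_mult, Cmod_pow, Cmod_RtoC_nonneg by apply pow_le, pos_INR. lra.
  - apply (bsum_comp (fun n => INR n ^ i * Cmod x ^ n)%R S); [intros; lia|].
    apply bsum_pow_geom. split; [apply Cmod_ge_0|auto].
Qed.

Lemma one_sub_neq_0 (x : C) : (Cmod x < 1)%R -> 1 - x <> 0.
Proof.
  intros Hx E. assert (E' : x = 1) by (replace x with (1 - (1 - x)) by ring; rewrite E; ring).
  rewrite E', Cmod_1 in Hx. lra.
Qed.

Lemma is_usum_geom (x : C) : (Cmod x < 1)%R -> is_usum (fun n => RtoC (INR (S n) ^ 0) * x ^ S n) (x / (1 - x)).
Proof.
  intros Hx. assert (A := asum_pow_geom 0 x Hx). assert (N := one_sub_neq_0 x Hx).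
  assert (E := usum_shift _ A). cbv beta in E.
  assert (E2 : usum (fun n => RtoC (INR (S (S n)) ^ 0) * x ^ S (S n)) = x * usum (fun n => RtoC (INR (S n) ^ 0) * x ^ S n)).
  { rewrite <- usum_scal by exact A. apply usum_ext. intros n. simpl. ring. }
  rewrite E2 in E. assert (H := asum_usum _ A). set (s := usum _) in *. clearbody s.
  simpl (RtoC (INR 1 ^ 0)) in E.
  assert (E3 : (1 - x) * s = x) by (replace ((1 - x) * s) with (s - x * s) by ring; rewrite E at 1; simpl; ring).
  replace (x / (1 - x)) with s; auto. rewrite <- E3 at 1. field. auto.
Qed.

Lemma is_usum_geom1 (x : C) : (Cmod x < 1)%R ->
  is_usum (fun n => RtoC (INR (S n) ^ 1) * x ^ S n) (x / (1 - x) ^ 2).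
Proof.
  intros Hx. assert (A := asum_pow_geom 1 x Hx). assert (N := one_sub_neq_0 x Hx).
  assert (E := usum_shift _ A). cbv beta in E. assert (A0 := asum_pow_geom 0 x Hx).
  assert (E2 : usum (fun n => RtoC (INR (S (S n)) ^ 1) * x ^ S (S n)) =
    x * (usum (fun n => RtoC (INR (S n) ^ 1) * x ^ S n) + usum (fun n => RtoC (INR (S n) ^ 0) * x ^ S n))).
  { rewrite <- usum_plus, <- usum_scal by (auto; apply asum_plus; auto). apply usum_ext. intros n.
    rewrite (S_INR (S n)), !pow_1, RtoC_plus. simpl. ring. }
  rewrite E2, (usum_unique _ _ (is_usum_geom x Hx)) in E. assert (H := asum_usum _ A).
  set (s := usum _) in *. clearbody s.
  assert (E3 : (1 - x) * s = x / (1 - x)).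
  { replace ((1 - x) * s) with (s - x * s) by ring; rewrite E at 1; simpl. rewrite Rmult_1_r. field. auto. }
  replace (x / (1 - x) ^ 2) with s; auto.
  replace (x / (1 - x) ^ 2) with (x / (1 - x) / (1 - x)) by (field; auto). rewrite <- E3. field. auto.
Qed.

Lemma is_usum_geom2 (x : C) : (Cmod x < 1)%R ->
  is_usum (fun n => RtoC (INR (S n) ^ 2) * x ^ S n) (x * (1 + x) / (1 - x) ^ 3).
Proof.
  intros Hx. assert (A := asum_pow_geom 2 x Hx). assert (N := one_sub_neq_0 x Hx).
  assert (E := usum_shift _ A). cbv beta in E. assert (A0 := asum_pow_geom 0 x Hx). assert (A1 := asum_pow_geom 1 x Hx).
  assert (E2 : usum (fun n => RtoC (INR (S (S n)) ^ 2) * x ^ S (S n)) =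
    x * (usum (fun n => RtoC (INR (S n) ^ 2) * x ^ S n) + (2 * usum (fun n => RtoC (INR (S n) ^ 1) * x ^ S n)
      + usum (fun n => RtoC (INR (S n) ^ 0) * x ^ S n)))).
  { rewrite <- (usum_scal _ 2 A1), <- usum_plus, <- usum_plus, <- usum_scal;
      repeat (apply asum_plus || apply asum_scal || assumption). apply usum_ext. intros n.
    rewrite (S_INR (S n)). replace ((INR (S n) + 1) ^ 2)%R with (INR (S n) ^ 2 + (2 * INR (S n) ^ 1 + 1))%R by ring.
    rewrite !RtoC_plus, RtoC_mult. rewrite (Cpow_S x (S n)). simpl (INR (S n) ^ 0)%R. ring. }
  rewrite E2, (usum_unique _ _ (is_usum_geom x Hx)), (usum_unique _ _ (is_usum_geom1 x Hx)) in E.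
  assert (H := asum_usum _ A).
  set (s := usum _) in *. clearbody s.
  assert (E3 : (1 - x) * s = x * (1 + x) / (1 - x) ^ 2).
  { replace ((1 - x) * s) with (s - x * s) by ring; rewrite E at 1; simpl. rewrite !Rmult_1_r. field. auto. }
  replace (x * (1 + x) / (1 - x) ^ 3) with s; auto.
  replace (x * (1 + x) / (1 - x) ^ 3) with (x * (1 + x) / (1 - x) ^ 2 / (1 - x)) by (field; auto).
  rewrite <- E3. field. auto.
Qed.

Lemma Re_2PiCi (t : C) : Re (2 * PI * Ci * t) = (- (2 * PI * Im t))%R.
Proof. unfold Re, Im, Ci, Cmult, RtoC; simpl. ring. Qed.

Lemma Cmod_Ci : Cmod Ci = 1%R.
Proof.
  unfold Cmod, Ci; simpl.
  replace (0 * (0 * 1) + 1 * (1 * 1))%R with 1%R by ring. apply sqrt_1.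
Qed.

Lemma Cmod_qnome (t : C) : Cmod (qnome t) = exp (- (2 * PI * Im t)).
Proof. unfold qnome. rewrite Cmod_Cexp, Re_2PiCi. reflexivity. Qed.

Lemma Cmod_qnome_lt_1 (t : C) : (0 < Im t)%R -> (Cmod (qnome t) < 1)%R.
Proof.
  intros H. rewrite Cmod_qnome, <- exp_0. apply exp_increasing.
  assert (P := PI_RGT_0). assert (0 < PI * Im t)%R by (apply Rmult_lt_0_compat; auto). lra.
Qed.

(** [sum_(n, d >= 1) n^i d^j q^(n d)] *)
Definition qdouble (i j : nat) : C -> C :=
  exp_series (fun p : nat * nat => RtoC (INR (S (fst p)) ^ i * INR (S (snd p)) ^ j))
       (fun p => 2 * PI * Ci * RtoC (INR (S (fst p)) * INR (S (snd p)))).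

Lemma qdouble_summable (i j : nat) (t : C) : (0 < Im t)%R ->
  exp_summable (fun p : nat * nat => RtoC (INR (S (fst p)) ^ i * INR (S (snd p)) ^ j))
       (fun p => 2 * PI * Ci * RtoC (INR (S (fst p)) * INR (S (snd p)))) t.
Proof.
  intros Ht. assert (P := PI_RGT_0).
  assert (Py : (0 < PI * Im t)%R) by (apply Rmult_lt_0_compat; auto).
  exists (Im t / 2)%R. split; [lra|].
  (* The margin [Im t / 2] uses half of the decay of [q^(n d)] and leaves [r^(n d)]. As
     [n d >= n + d - 1], this is at most a product of powers of [r], at the price of the factor
     [/ r]. *)
  set (r := exp (- (PI * Im t))).
  assert (Hr : (0 < r < 1)%R).
  { split; [apply exp_pos|]. rewrite <- exp_0. apply exp_increasing. lra. }
  assert (Hb : forall k, bsum (fun n : nat => INR (S n) ^ k * r ^ S n)%R).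
  { intros k. apply (bsum_comp (fun n => INR n ^ k * r ^ n)%R S); [intros; lia|].
    apply bsum_pow_geom. lra. }
  assert (Hp : forall k (n : nat), (0 <= INR (S n) ^ k * r ^ S n)%R).
  { intros k n. apply Rmult_le_pos; apply pow_le; [apply pos_INR|lra]. }
  assert (HB := bsum_prod _ _ (Hp i) (Hp j) (Hb i) (Hb j)).
  assert (Hri : (0 < / r)%R) by (apply Rinv_0_lt_compat; lra).
  apply bsum_le with (2 := bsum_scal _ (/ r) (Rlt_le _ _ Hri) HB).
  intros [n m]. cbn [fst snd].
  assert (Pn := pos_INR (S n)). assert (Pm := pos_INR (S m)).
  assert (Pnm : (0 <= INR (S n) * INR (S m))%R) by (apply Rmult_le_pos; auto).
  rewrite Cmod_RtoC_nonneg by (apply Rmult_le_pos; apply pow_le; auto).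
  replace (2 * PI * Ci * RtoC (INR (S n) * INR (S m)) * t) with (2 * PI * Ci * (RtoC (INR (S n) * INR (S m)) * t)) by ring.
  rewrite Re_2PiCi, im_scal_l, !Cmod_mult, Cmod_Ci, !Cmod_RtoC_nonneg by (auto; lra).
  rewrite Rmult_assoc, <- exp_plus.
  replace (- (2 * PI * (INR (S n) * INR (S m) * Im t)) + Im t / 2 * (2 * PI * 1 * (INR (S n) * INR (S m))))%R
    with (- (PI * Im t) * (INR (S n) * INR (S m)))%R by field.
  replace (/ r * (INR (S n) ^ i * r ^ S n * (INR (S m) ^ j * r ^ S m)))%R with
   (INR (S n) ^ i * INR (S m) ^ j * r ^ (n + S m))%R.
  - apply Rmult_le_compat_l; [apply Rmult_le_pos; apply pow_le; auto|].
    unfold r. rewrite exp_pow. apply exp_le.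
    assert (INR (n + S m) <= INR (S n) * INR (S m))%R; [|nra].
    rewrite <- mult_INR. apply le_INR. lia.
  - rewrite pow_add. simpl (r ^ S n)%R. field. lra.
Qed.

(** The frequency of a term is [n d], so differentiation raises both exponents by one; all
    derivatives stay in the family [qdouble]. *)
Lemma qdouble_cderiv (i j : nat) (t : C) : (0 < Im t)%R ->
  cderiv (qdouble i j) t (2 * PI * Ci * qdouble (S i) (S j) t).
Proof.
  intros Ht. assert (H := exp_series_cderiv _ _ _ (qdouble_summable i j t Ht)).
  unfold qdouble at 2. unfold exp_series at 2 in H. unfold exp_series.
  rewrite <- usum_scal by apply (exp_summable_asum _ _ _ (qdouble_summable (S i) (S j) t Ht)).
  erewrite usum_ext; [exact H|]. intros [n m]. cbn [fst snd pow]. rewrite !RtoC_mult. ring.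
Qed.

Lemma Cexp_double (n m : nat) (t : C) :
  Cexp (2 * PI * Ci * RtoC (INR (S n) * INR (S m)) * t) = (qnome t ^ S n) ^ S m.
Proof.
  unfold qnome. rewrite !Cexp_pow. f_equal. rewrite RtoC_mult. ring.
Qed.

(** Summing over [d] first turns the double series into a Lambert series: [j = 0, 1, 2] give
    [x / (1 - x)], [x / (1 - x)^2] and [x (1 + x) / (1 - x)^3] at [x = q^n]. *)
Lemma qdouble_rows (i j : nat) (t : C) (g : C -> C) : (0 < Im t)%R ->
  (forall x, (Cmod x < 1)%R -> is_usum (fun n => RtoC (INR (S n) ^ j) * x ^ S n) (g x)) ->
  is_usum (fun n => RtoC (INR (S n) ^ i) * g (qnome t ^ S n)) (qdouble i j t).
Proof.
  intros Ht Hg. assert (A := exp_summable_asum _ _ _ (qdouble_summable i j t Ht)).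
  apply (is_usum_prod _ _ _ A (asum_usum _ A)).
  intros n. cbn [fst snd].
  eapply is_usum_ext; [|apply is_usum_scal, (Hg (qnome t ^ S n))].
  - intros m. cbv beta. rewrite Cexp_double, !RtoC_mult. ring.
  - assert (H := Cmod_qnome_lt_1 t Ht). assert (H0 := pow_q_le _ H n). lra.
Qed.

Lemma qdouble_Ssum (k : nat) (t : C) : (0 < Im t)%R -> qdouble k 0 t = Ssum (qnome t) k.
Proof.
  intros Ht. symmetry. apply usum_unique.
  apply (qdouble_rows k 0 t (fun x => x / (1 - x)) Ht is_usum_geom).
Qed.

Lemma qdouble_Vsum (k : nat) (t : C) : (0 < Im t)%R -> qdouble k 1 t = Vsum (qnome t) k.
Proof.
  intros Ht. symmetry. apply usum_unique.
  eapply is_usum_ext; [|apply (qdouble_rows k 1 t (fun x => x / (1 - x) ^ 2) Ht is_usum_geom1)].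
  intros n. cbv beta. f_equal. unfold lambert_term. field. apply pow_q_ne, Cmod_qnome_lt_1, Ht.
Qed.

Lemma lambert_qdouble (k : nat) (t : C) : (0 < Im t)%R -> lambert k t = qdouble k 0 t.
Proof.
  intros Ht. unfold lambert. apply Cseries_usum.
  eapply is_usum_ext; [|apply (qdouble_rows k 0 t (fun x => x / (1 - x)) Ht is_usum_geom)].
  intros n. cbv beta. rewrite RtoC_pow. unfold Cdiv. ring.
Qed.

Lemma cderiv_ext_near (f g : C -> C) (x l d : _) : (0 < d)%R ->
  (forall y, (Cmod (y - x) < d)%R -> f y = g y) -> cderiv f x l -> cderiv g x l.
Proof.
  intros Hd E H eps Heps. destruct (H eps Heps) as [e [He HH]].
  exists (Rmin d e). split; [apply Rmin_pos; auto|]. intros y Hy.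
  assert (Hy1 : (Cmod (y - x) < d)%R) by (eapply Rlt_le_trans; [apply Hy|apply Rmin_l]).
  assert (Hy2 : (Cmod (y - x) < e)%R) by (eapply Rlt_le_trans; [apply Hy|apply Rmin_r]).
  rewrite <- (E y Hy1), <- (E x); [auto|]. replace (x - x) with (RtoC 0) by ring. rewrite Cmod_0; auto.
Qed.

Lemma cderiv_affine (f : C -> C) (x l a b : C) : cderiv f x l -> cderiv (fun y => a + b * f y) x (b * l).
Proof.
  intros H eps Heps. assert (P := Cmod_ge_0 b).
  destruct (H (eps / (Cmod b + 1))%R) as [d [Hd HH]]; [apply Rdiv_lt_0_compat; lra|].
  exists d. split; auto. intros y Hy. specialize (HH y Hy).
  replace (a + b * f y - (a + b * f x) - (y - x) * (b * l)) with (b * (f y - f x - (y - x) * l)) by ring.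
  rewrite Cmod_mult. assert (Q := Cmod_ge_0 (y - x)). assert (Q' := Cmod_ge_0 (f y - f x - (y - x) * l)).
  apply Rle_trans with ((Cmod b + 1) * (eps / (Cmod b + 1) * Cmod (y - x)))%R; [nra|].
  right. field. lra.
Qed.

Lemma upper_half_near (t : C) : (0 < Im t)%R ->
  forall y, (Cmod (y - t) < Im t)%R -> (0 < Im y)%R.
Proof.
  intros Ht y Hy. assert (H := im_le_Cmod (y - t)).
  assert (E : Im (y - t) = (Im y - Im t)%R) by (unfold Im, Cminus, Cplus, Copp; simpl; ring).
  rewrite E in H. apply Rabs_le_between in H. lra.
Qed.

Lemma lambert_cderiv (k : nat) (a b t : C) : (0 < Im t)%R ->
  cderiv (fun t => a + b * lambert k t) t (b * (2 * PI * Ci * qdouble (S k) 1 t)).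
Proof.
  intros Ht. apply cderiv_ext_near with (fun y => a + b * qdouble k 0 y) (Im t); auto.
  - intros y Hy. rewrite lambert_qdouble; auto. apply (upper_half_near t Ht y Hy).
  - apply cderiv_affine, qdouble_cderiv, Ht.
Qed.

Lemma E2_cderiv (t : C) : (0 < Im t)%R -> cderiv E2 t (-24 * (2 * PI * Ci * qdouble 2 1 t)).
Proof.
  intros Ht. replace E2 with (fun t => 1 + -24 * lambert 1 t); [apply lambert_cderiv, Ht|].
  apply functional_extensionality. intros y. unfold E2. ring.
Qed.

Lemma E4_cderiv (t : C) : (0 < Im t)%R -> cderiv E4 t (240 * (2 * PI * Ci * qdouble 4 1 t)).
Proof. intros Ht. apply lambert_cderiv, Ht. Qed.

Lemma E6_cderiv (t : C) : (0 < Im t)%R -> cderiv E6 t (-504 * (2 * PI * Ci * qdouble 6 1 t)).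
Proof.
  intros Ht. replace E6 with (fun t => 1 + -504 * lambert 5 t); [apply lambert_cderiv, Ht|].
  apply functional_extensionality. intros y. unfold E6. ring.
Qed.

Lemma cderiv_C_derive (f : C -> C) (x l : C) : cderiv f x l -> C_derive f x = l.
Proof. intros H. apply is_C_derive_unique, cderiv_is_derive, H. Qed.

Lemma cderiv_C_differentiable (f : C -> C) (x l : C) : cderiv f x l -> C_differentiable f x.
Proof. intros H. exists l. apply cderiv_is_derive, H. Qed.

Lemma C_derive_E2_cderiv (t : C) : (0 < Im t)%R ->
  cderiv (C_derive E2) t (-24 * (2 * PI * Ci) * (2 * PI * Ci * qdouble 3 2 t)).
Proof.
  intros Ht.
  apply cderiv_ext_near with (fun y => 0 + (-24 * (2 * PI * Ci)) * qdouble 2 1 y) (Im t); auto.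
  - intros y Hy. rewrite (cderiv_C_derive _ _ _ (E2_cderiv y (upper_half_near t Ht y Hy))). ring.
  - apply cderiv_affine, qdouble_cderiv, Ht.
Qed.

Lemma Ramanujan_identities (t : C) : (0 < Im t)%R ->
    (C_differentiable E2 t /\ C_differentiable (C_derive E2) t /\
     C_differentiable E4 t /\ C_differentiable E6 t) /\
    1 / (2 * PI * Ci) * C_derive E2 t = 1 / 12 * (E2 t ^ 2 - E4 t) /\
    1 / (2 * PI * Ci) * C_derive E4 t = 1 / 3 * (E2 t * E4 t - E6 t) /\
    1 / (2 * PI * Ci) * C_derive E6 t = 1 / 2 * (E2 t * E6 t - E4 t ^ 2).
Proof.
  intros Ht. split.
  - repeat split; eapply cderiv_C_differentiable;
      [apply E2_cderiv|apply C_derive_E2_cderiv|apply E4_cderiv|apply E6_cderiv]; auto.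
  - rewrite (cderiv_C_derive _ _ _ (E2_cderiv t Ht)), (cderiv_C_derive _ _ _ (E4_cderiv t Ht)),
      (cderiv_C_derive _ _ _ (E6_cderiv t Ht)).
    unfold E2, E4, E6. rewrite !lambert_qdouble, !qdouble_Vsum, !qdouble_Ssum by auto.
    destruct (Ramanujan_algebraic (qnome t) (Cmod_qnome_lt_1 t Ht)) as [H2 [H4 H6]].
    rewrite <- H2, <- H4, <- H6.
    assert (HP : RtoC PI <> 0) by (intros E; apply RtoC_inj in E; assert (P := PI_RGT_0); lra).
    assert (HI : Ci <> 0) by (intros E; apply (f_equal snd) in E; simpl in E; lra).
    repeat split; field; auto.
Qed.

(** * Partial fractions of the squared cosecant *)

Lemma Im_plus (a b : C) : Im (a + b) = (Im a + Im b)%R.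
Proof. reflexivity. Qed.

(** The imaginary part controls [y], and then the triangle inequality controls [x]. *)
Lemma lattice_norm (tau : C) : (0 < Im tau)%R -> exists c, (0 < c)%R /\
  forall x y : R, (c * (Rabs x + Rabs y) <= Cmod (x + y * tau))%R.
Proof.
  intros Ht. assert (Pt := Cmod_ge_0 tau).
  set (K := (1 + (1 + Cmod tau) / Im tau)%R).
  assert (PK : (0 < K)%R).
  { unfold K. assert (0 < (1 + Cmod tau) / Im tau)%R by (apply Rdiv_lt_0_compat; lra). lra. }
  exists (/ K)%R. split; [apply Rinv_0_lt_compat; auto|]. intros x y.
  set (w := x + y * tau).
  assert (Hy : (Rabs y <= Cmod w / Im tau)%R).
  { apply Rmult_le_reg_r with (Im tau); auto. unfold Rdiv. rewrite Rmult_assoc, Rinv_l, Rmult_1_r by lra.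
    eapply Rle_trans; [|apply im_le_Cmod]. unfold w. rewrite Im_plus, im_scal_l.
    replace (Im (RtoC x)) with 0%R by reflexivity. rewrite Rplus_0_l, Rabs_mult, (Rabs_pos_eq (Im tau)) by lra. lra. }
  assert (Hx : (Rabs x <= Cmod w + Rabs y * Cmod tau)%R).
  { rewrite <- Cmod_R, <- Cmod_R, <- Cmod_mult, <- (Cmod_opp (y * tau)).
    replace (RtoC x) with (w + - (y * tau)) by (unfold w; ring). apply Cmod_triangle. }
  apply Rmult_le_reg_l with K; auto. rewrite <- Rmult_assoc, Rinv_r, Rmult_1_l by lra.
  unfold K. replace ((1 + (1 + Cmod tau) / Im tau) * Cmod w)%R with
    (Cmod w + (Cmod w / Im tau) * Cmod tau + Cmod w / Im tau)%R by (field; lra).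
  assert (Q := Rabs_pos y). nra.
Qed.

Lemma finite_lower {T : Type} (P : T -> Prop) (g h : T -> R) (L : list T) :
  (forall t, P t -> 0 < g t)%R -> (forall t, 0 < h t)%R ->
  exists c, (0 < c)%R /\ forall t, In t L -> P t -> (c * h t <= g t)%R.
Proof.
  intros Hg Hh. induction L as [|a L [c [Hc H]]].
  - exists 1%R. split; [lra|]. simpl; tauto.
  - destruct (classic (P a)) as [Ha|Ha].
    + exists (Rmin c (g a / h a)). split; [apply Rmin_pos; auto; apply Rdiv_lt_0_compat; auto|].
      intros t [->|Ht] Pt.
      * apply Rle_trans with (g t / h t * h t)%R.
        -- apply Rmult_le_compat_r; [apply Rlt_le, Hh|apply Rmin_r].
        -- right. field. specialize (Hh t). lra.
      * apply Rle_trans with (c * h t)%R; auto.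
        apply Rmult_le_compat_r; [apply Rlt_le, Hh|apply Rmin_l].
    + exists c. split; auto. intros t [->|Ht] Pt; auto. tauto.
Qed.

(** Far lattice points are handled by [lattice_norm], the finitely many near ones by [finite_lower].
    The threshold makes [Cmod s] at most a third of the norm bound; another third pays for the
    summand [1], and one third remains as [c0 / 3]. *)
Lemma lattice_lower (tau s : C) : (0 < Im tau)%R -> exists c, (0 < c)%R /\
  forall m n : Z, s <> IZR m + IZR n * tau ->
    (c * (1 + Rabs (IZR m) + Rabs (IZR n)) <= Cmod (s - (IZR m + IZR n * tau)))%R.
Proof.
  intros Ht. destruct (lattice_norm tau Ht) as [c0 [Hc0 H0]].
  assert (Ps := Cmod_ge_0 s).
  destruct (INR_unbounded (Rmax 1 (3 * Cmod s / c0))) as [K HK].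
  assert (HK1 : (1 < INR K)%R) by (eapply Rle_lt_trans; [apply Rmax_l|apply HK]).
  assert (HK2 : (3 * Cmod s < c0 * INR K)%R).
  { assert (E : (3 * Cmod s / c0 < INR K)%R) by (eapply Rle_lt_trans; [apply Rmax_r|apply HK]).
    apply (Rmult_lt_compat_l c0) in E; auto. replace (c0 * (3 * Cmod s / c0))%R with (3 * Cmod s)%R in E by (field; lra). auto. }
  set (I := map (fun k => (Z.of_nat k - Z.of_nat K)%Z) (seq 0 (S (2 * K)))).
  assert (HI : forall m : Z, (Z.abs m <= Z.of_nat K)%Z -> In m I).
  { intros m Hm. apply in_map_iff. exists (Z.to_nat (m + Z.of_nat K)). split; [lia|]. apply in_seq. lia. }
  destruct (finite_lower (fun p => s <> IZR (fst p) + IZR (snd p) * tau)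
    (fun p => Cmod (s - (IZR (fst p) + IZR (snd p) * tau)))
    (fun p => 1 + Rabs (IZR (fst p)) + Rabs (IZR (snd p)))%R (list_prod I I)) as [c1 [Hc1 H1]].
  - intros p Hp. apply Cmod_gt_0. intros E. apply Hp.
    replace s with (s - (IZR (fst p) + IZR (snd p) * tau) + (IZR (fst p) + IZR (snd p) * tau)) by ring.
    rewrite E. ring.
  - intros p. assert (A := Rabs_pos (IZR (fst p))). assert (B := Rabs_pos (IZR (snd p))). lra.
  - exists (Rmin c1 (c0 / 3)). split; [apply Rmin_pos; auto; lra|]. intros m n Hmn.
    assert (A := Rabs_pos (IZR m)). assert (B := Rabs_pos (IZR n)).
    destruct (classic (Z.abs m <= Z.of_nat K /\ Z.abs n <= Z.of_nat K)%Z) as [[Hm Hn]|Hn].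
    + eapply Rle_trans; [|apply (H1 (m, n)); auto].
      * apply Rmult_le_compat_r; [simpl; lra|apply Rmin_l].
      * apply in_prod; auto.
    + assert (HT : (INR K <= Rabs (IZR m) + Rabs (IZR n))%R).
      { rewrite <- !abs_IZR, INR_IZR_INZ, <- plus_IZR. apply IZR_le. lia. }
      apply Rle_trans with (c0 / 3 * (1 + Rabs (IZR m) + Rabs (IZR n)))%R.
      * apply Rmult_le_compat_r; [lra|apply Rmin_r].
      * specialize (H0 (IZR m) (IZR n)).
        assert (H2 : (Cmod (IZR m + IZR n * tau) <= Cmod (s - (IZR m + IZR n * tau)) + Cmod s)%R).
        { rewrite <- (Cmod_opp (s - _)).
          replace (IZR m + IZR n * tau) with (- (s - (IZR m + IZR n * tau)) + s) at 1 by ring. apply Cmod_triangle. }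
        replace (1 + Rabs (IZR m) + Rabs (IZR n))%R with (1 + (Rabs (IZR m) + Rabs (IZR n)))%R by ring.
        set (T := (Rabs (IZR m) + Rabs (IZR n))%R) in *.
        assert (E1 : (c0 * INR K <= c0 * T)%R) by (apply Rmult_le_compat_l; lra).
        assert (E2 : (c0 * 1 <= c0 * T)%R) by (apply Rmult_le_compat_l; lra). lra.
Qed.

(** The exponent [3/2] is summable over [Z], dominates the exponent [2] of a single row, and makes
    [decay m * decay n] dominate the inverse cube on the lattice, so that two-dimensional sums
    reduce to one-dimensional ones. *)
Definition decay (m : Z) : R := (/ ((1 + Rabs (IZR m)) * sqrt (1 + Rabs (IZR m))))%R.

Lemma decay_pos (m : Z) : (0 < decay m)%R.
Proof.
  unfold decay. assert (A := Rabs_pos (IZR m)). apply Rinv_0_lt_compat.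
  apply Rmult_lt_0_compat; [lra|apply sqrt_lt_R0; lra].
Qed.

Lemma bsum_decay : bsum decay.
Proof.
  assert (H : bsum (fun n => decay (Z.of_nat n))).
  { apply bsum_nat with 4%R.
    - intros n. apply Rlt_le, decay_pos.
    - assert (H : forall n, (rsum (fun n => decay (Z.of_nat n)) (seq 0 (S n)) <= 3 - 2 / sqrt (INR (S n)))%R).
      { induction n as [|n IH].
        - simpl. unfold decay. simpl (Z.of_nat 0). rewrite Rabs_R0. replace (1 + 0)%R with 1%R by ring. rewrite sqrt_1, Rmult_1_l, Rinv_1. lra.
        - rewrite seq_S, rsum_app. rewrite Nat.add_0_l. unfold rsum at 2; cbn [fold_right].
          assert (Hd : (decay (Z.of_nat (S n)) <= 2 / sqrt (INR (S n)) - 2 / sqrt (INR (S (S n))))%R); [|lra].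
          unfold decay. rewrite <- INR_IZR_INZ, Rabs_pos_eq, Rplus_comm, <- S_INR by apply pos_INR.
          set (a := INR (S n)). assert (Ea : INR (S (S n)) = (a + 1)%R) by (rewrite S_INR; reflexivity).
          rewrite Ea. assert (Ha : (0 < a)%R) by (apply lt_0_INR; lia).
          assert (S1 : (0 < sqrt a)%R) by (apply sqrt_lt_R0; auto).
          assert (S2 : (0 < sqrt (a + 1))%R) by (apply sqrt_lt_R0; lra).
          assert (S3 : (sqrt a <= sqrt (a + 1))%R) by (apply sqrt_le_1; lra).
          assert (Q1 : (sqrt a * sqrt a = a)%R) by (apply sqrt_sqrt; lra).
          assert (Q2 : (sqrt (a + 1) * sqrt (a + 1) = a + 1)%R) by (apply sqrt_sqrt; lra).
          rewrite <- Q2 at 1. set (x := sqrt a) in *. set (y := sqrt (a + 1)) in *.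
          replace (2 / x - 2 / y)%R with (2 * (y - x) / (x * y))%R by (field; lra).
          assert (E : (y - x = 1 / (x + y))%R) by (field_simplify_eq; [nra|lra]).
          rewrite E. replace (2 * (1 / (x + y)) / (x * y))%R with (/ ((x * y) * ((x + y) / 2)))%R by (field; lra).
          apply Rinv_le_contravar.
          + apply Rmult_lt_0_compat; [apply Rmult_lt_0_compat; auto|lra].
          + apply Rle_trans with (y * y * ((x + y) / 2))%R.
            * apply Rmult_le_compat_r; [lra|]. apply Rmult_le_compat_r; lra.
            * apply Rmult_le_compat_l; [nra|lra]. }
      intros [|n]; [simpl; lra|]. specialize (H n).
      assert (0 < 2 / sqrt (INR (S n)))%R; [|lra].
      apply Rdiv_lt_0_compat; [lra|]. apply sqrt_lt_R0, lt_0_INR. lia. }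
  apply bsum_Z; auto.
  - intros n. apply Rlt_le, decay_pos.
  - apply bsum_le with (2 := H). intros n. unfold decay. rewrite opp_IZR, Rabs_Ropp. lra.
Qed.

Lemma decay_square (m : Z) : (/ (1 + Rabs (IZR m)) ^ 2 <= decay m)%R.
Proof.
  unfold decay. assert (A := Rabs_pos (IZR m)). set (a := (1 + Rabs (IZR m))%R).
  assert (Ha : (1 <= a)%R) by (unfold a; lra).
  assert (S1 : (0 < sqrt a)%R) by (apply sqrt_lt_R0; lra).
  apply Rinv_le_contravar; [apply Rmult_lt_0_compat; lra|].
  simpl. rewrite Rmult_1_r. apply Rmult_le_compat_l; [lra|].
  rewrite <- (sqrt_Rsqr a) at 2 by lra. apply sqrt_le_1; unfold Rsqr; nra.
Qed.

Lemma decay_cube (m n : Z) : (/ (1 + Rabs (IZR m) + Rabs (IZR n)) ^ 3 <= decay m * decay n)%R.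
Proof.
  unfold decay. assert (A := Rabs_pos (IZR m)). assert (B := Rabs_pos (IZR n)).
  set (a := (1 + Rabs (IZR m))%R) in *. set (b := (1 + Rabs (IZR n))%R) in *.
  assert (Ha : (1 <= a)%R) by (unfold a; lra). assert (Hb : (1 <= b)%R) by (unfold b; lra).
  assert (S1 : (0 < sqrt a)%R) by (apply sqrt_lt_R0; lra).
  assert (S2 : (0 < sqrt b)%R) by (apply sqrt_lt_R0; lra).
  rewrite <- Rinv_mult. set (t := (a + Rabs (IZR n))%R).
  assert (Hta : (a <= t)%R) by (unfold t; lra). assert (Htb : (b <= t)%R) by (unfold t, b, a; lra).
  apply Rinv_le_contravar.
  - repeat apply Rmult_lt_0_compat; lra.
  - assert (T : (0 < sqrt t)%R) by (apply sqrt_lt_R0; lra).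
    assert (T2 : (sqrt t * sqrt t = t)%R) by (apply sqrt_sqrt; lra).
    assert (U1 : (sqrt a <= sqrt t)%R) by (apply sqrt_le_1; lra).
    assert (U2 : (sqrt b <= sqrt t)%R) by (apply sqrt_le_1; lra).
    replace (t ^ 3)%R with ((t * sqrt t) * (t * sqrt t))%R by (simpl; nra).
    apply Rmult_le_compat; try (apply Rmult_le_pos; lra); apply Rmult_le_compat; lra.
Qed.

Definition nonint (s : C) : Prop := forall m : Z, s <> IZR m.

Lemma inv_le_inv_mult (c t x : R) : (0 < c -> 0 < t -> c * t <= x -> / x <= / c * / t)%R.
Proof.
  intros Hc Ht H. rewrite <- Rinv_mult. apply Rinv_le_contravar; auto. apply Rmult_lt_0_compat; auto.
Qed.

Lemma asum_row (s : C) : nonint s -> asum (fun m : Z => / (s - IZR m) ^ 2).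
Proof.
  intros Hs. assert (Hi : (0 < Im Ci)%R) by (simpl; lra).
  destruct (lattice_lower Ci s Hi) as [c [Hc H]].
  apply asum_le with (fun m => (/ c) ^ 2 * decay m)%R.
  - intros m. assert (A := Rabs_pos (IZR m)).
    specialize (H m 0%Z). rewrite Rabs_R0, Rplus_0_r, Cmult_0_l, Cplus_0_r in H.
    specialize (H (Hs m)).
    assert (N : s - IZR m <> 0).
    { intros E. rewrite E, Cmod_0 in H. nra. }
    rewrite Cmod_inv, Cmod_pow by (apply Cpow_nz; auto). rewrite <- pow_inv.
    apply Rle_trans with ((/ c * / (1 + Rabs (IZR m))) ^ 2)%R.
    + apply pow_incr. split; [apply Rlt_le, Rinv_0_lt_compat, Cmod_gt_0, N|].
      apply inv_le_inv_mult; auto; lra.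
    + rewrite Rpow_mult_distr. apply Rmult_le_compat_l; [apply pow_le, Rlt_le, Rinv_0_lt_compat, Hc|].
      rewrite pow_inv. apply decay_square.
  - apply bsum_scal; [apply pow_le, Rlt_le, Rinv_0_lt_compat, Hc|apply bsum_decay].
Qed.

Definition row (s : C) : C := usum (fun m : Z => / (s - IZR m) ^ 2).

Lemma row_shift (s : C) (n : Z) : nonint s -> row (s + IZR n) = row s.
Proof.
  intros Hs. symmetry. apply usum_unique.
  apply (is_usum_reindex (fun m : Z => / (s - IZR m) ^ 2) (fun m => (m - n)%Z)).
  - intros; lia.
  - intros t Hn. exfalso. apply (Hn (t + n)%Z). lia.
  - eapply is_usum_ext; [|apply asum_usum, asum_row].
    + intros m. cbv beta. rewrite minus_IZR, RtoC_minus. do 2 f_equal. ring.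
    + intros m E. apply (Hs (m - n)%Z). rewrite minus_IZR, RtoC_minus, <- E. ring.
Qed.

Lemma nonint_half (s : C) : nonint s -> nonint (s / 2) /\ nonint ((s + 1) / 2).
Proof.
  intros Hs. split; intros m E.
  - apply (Hs (2 * m)%Z). rewrite mult_IZR, RtoC_mult, <- E. field.
  - apply (Hs (2 * m - 1)%Z). rewrite minus_IZR, mult_IZR, RtoC_minus, RtoC_mult, <- E. field.
Qed.

Lemma nonint_sub (s : C) (m : Z) : nonint s -> s - IZR m <> 0.
Proof. intros Hs E. apply (Hs m). replace s with (s - IZR m + IZR m) by ring. rewrite E. ring. Qed.

(** The two rows on the left are four times the even and the odd part of the row at [s]. *)
Lemma row_duplication (s : C) : nonint s -> row (s / 2) + row ((s + 1) / 2) = 4 * row s.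
Proof.
  intros Hs. destruct (nonint_half s Hs) as [H1 H2].
  set (f := fun m : Z => 4 * / (s - IZR m) ^ 2).
  transitivity (usum f); [|apply usum_scal, asum_row, Hs]. symmetry. apply usum_unique.
  assert (E1 : is_usum (restrict (fun m => Z.Even m) f) (row (s / 2))).
  { apply (is_usum_image _ (fun m => 2 * m)%Z); [intros; lia|intros m; exists m; lia|intros t [k Hk]; exists k; lia|].
    eapply is_usum_ext; [|apply asum_usum, asum_row, H1].
      intros m. cbv beta. unfold f.
      assert (N1 := nonint_sub _ m H1). assert (N2 := nonint_sub _ (2 * m) Hs).
      rewrite mult_IZR, RtoC_mult in *. 
      replace (s / 2 - IZR m) with ((s - 2 * IZR m) / 2) by field. field. auto. }
  assert (E2 : is_usum (restrict (fun m => ~ Z.Even m) f) (row ((s + 1) / 2))).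
  { apply (is_usum_image _ (fun m => 2 * m - 1)%Z); [intros; lia|intros m [k Hk]; lia| |].
    - intros t He. destruct (Z.Even_or_Odd t) as [|[k Hk]]; [tauto|]. exists (k + 1)%Z. lia.
    - eapply is_usum_ext; [|apply asum_usum, asum_row, H2].
      intros m. cbv beta. unfold f.
      assert (N1 := nonint_sub _ m H2). assert (N2 := nonint_sub _ (2 * m - 1) Hs).
      rewrite minus_IZR, mult_IZR, RtoC_minus, RtoC_mult in *. 
      replace ((s + 1) / 2 - IZR m) with ((s - (2 * IZR m - 1)) / 2) by field. field. auto. }
  eapply is_usum_ext; [|apply (is_usum_plus _ _ _ _ E1 E2)].
  intros m. apply restrict_compl.
Qed.

(** This is [pi^2 / sin^2 (pi s)]. *)
Definition csc2 (s : C) : C := (2 * PI * Ci) ^ 2 * (qnome s / (1 - qnome s) ^ 2).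
Lemma qnome_add (s t : C) : qnome (s + t) = qnome s * qnome t.
Proof. unfold qnome. rewrite <- Cexp_add. f_equal. ring. Qed.

Lemma Cexp_PiCi_even (n : Z) : Cexp (2 * PI * Ci * IZR n) = 1.
Proof.
  unfold Cexp.
  replace (Re (2 * PI * Ci * IZR n)) with 0%R by (unfold Re, Ci, Cmult, RtoC; simpl; ring).
  replace (Im (2 * PI * Ci * IZR n)) with (2 * IZR n * PI)%R by (unfold Im, Ci, Cmult, RtoC; simpl; ring).
  rewrite exp_0. assert (C1 : cos (2 * IZR n * PI) = 1%R /\ sin (2 * IZR n * PI) = 0%R).
  { destruct (Z_le_dec 0 n) as [Hn|Hn].
    - replace (2 * IZR n * PI)%R with (0 + 2 * INR (Z.to_nat n) * PI)%R.
      + rewrite cos_period, sin_period, cos_0, sin_0. auto.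
      + rewrite INR_IZR_INZ, Z2Nat.id by auto. ring.
    - replace (2 * IZR n * PI)%R with (- (0 + 2 * INR (Z.to_nat (- n)) * PI))%R.
      + rewrite cos_neg, sin_neg, cos_period, sin_period, cos_0, sin_0. split; ring.
      + rewrite INR_IZR_INZ, Z2Nat.id, opp_IZR by lia. ring. }
  destruct C1 as [-> ->]. unfold RtoC. f_equal; ring.
Qed.

Lemma qnome_Z (n : Z) : qnome (IZR n) = 1.
Proof. apply Cexp_PiCi_even. Qed.

Lemma csc2_shift (s : C) (n : Z) : csc2 (s + IZR n) = csc2 s.
Proof. unfold csc2. rewrite qnome_add, qnome_Z, Cmult_1_r. reflexivity. Qed.

(** Write [sin b = 2 sin (b/2) cos (b/2)] and [sin (b/2) = (b/2) cos c] by the mean value theorem.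
    Both cosines are at least [cos (PI/4)], whose square is [1/2]. *)
Lemma sin_half_bound (b : R) : (Rabs b <= PI / 2 -> Rabs b / 2 <= Rabs (sin b))%R.
Proof.
  assert (H : forall b, (0 <= b <= PI / 2 -> b / 2 <= sin b)%R).
  { clear b. intros b [Hb1 Hb2]. assert (P := PI_RGT_0).
    assert (C0 : (cos (PI / 4) <= cos (b / 2))%R) by (apply cos_decr_1; lra).
    destruct (MVT_abs sin cos 0 (b / 2)) as [c [Hc1 Hc2]].
    { intros c _. apply derivable_pt_lim_sin. }
    rewrite sin_0, !Rminus_0_r in Hc1. rewrite Rmin_left, Rmax_right in Hc2 by lra.
    assert (C1 : (cos (PI / 4) <= cos c)%R) by (apply cos_decr_1; lra).
    assert (C2 : (0 < cos (PI / 4))%R) by (apply cos_gt_0; lra).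
    assert (C3 : (cos (PI / 4) * cos (PI / 4) = 1 / 2)%R).
    { rewrite cos_PI4. assert (S := sqrt_sqrt 2). assert (sqrt 2 <> 0)%R by (apply Rgt_not_eq, sqrt_lt_R0; lra).
      replace (1 / sqrt 2 * (1 / sqrt 2))%R with (1 / (sqrt 2 * sqrt 2))%R by (field; auto). rewrite S by lra. field. }
    assert (S1 : (0 <= sin (b / 2))%R) by (apply sin_ge_0; lra).
    rewrite (Rabs_pos_eq (sin _)), (Rabs_pos_eq (cos c)), (Rabs_pos_eq (b / 2)) in Hc1 by lra.
    replace (sin b) with (sin (2 * (b / 2))) by (f_equal; field). rewrite sin_2a, Hc1.
    assert (cos (PI / 4) * cos (PI / 4) <= cos c * cos (b / 2))%R by (apply Rmult_le_compat; lra).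
    nra. }
  intros Hb. destruct (Rle_dec 0 b) as [L|L].
  - rewrite Rabs_pos_eq in * by lra. eapply Rle_trans; [apply H; lra|apply Rle_abs].
  - rewrite <- (Rabs_Ropp (sin b)), <- sin_neg. rewrite (Rabs_left1 b) in * by lra.
    eapply Rle_trans; [apply H; lra|apply Rle_abs].
Qed.

(** With [h = PI * Ci * s] this is [Ci] times [sin (PI s)]; the strip [Rabs (Re s) <= 1/2] becomes
    [Rabs (Im h) <= PI/2]. *)
Definition Csinh (h : C) : C := (Cexp h - Cexp (- h)) / 2.

Lemma Csinh_pair (a b : R) : Csinh (a, b) = ((sinh a * cos b)%R, (cosh a * sin b)%R).
Proof.
  unfold Csinh, Cexp, sinh, cosh. simpl Re. simpl Im. rewrite cos_neg, sin_neg.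
  unfold Cdiv, Cmult, Cminus, Cplus, Copp, Cinv, RtoC; simpl. f_equal; field.
Qed.

Lemma sinh_ge (a : R) : (Rabs a <= Rabs (sinh a))%R.
Proof.
  destruct (MVT_abs sinh cosh 0 a) as [c [Hc _]].
  { intros c _. apply derivable_pt_lim_sinh. }
  rewrite sinh_0, !Rminus_0_r in Hc. rewrite Hc.
  assert (H : (1 <= Rabs (cosh c))%R).
  { eapply Rle_trans; [|apply Rle_abs]. unfold cosh.
    assert (H1 := exp_ineq1_le c). assert (H2 := exp_ineq1_le (- c)). lra. }
  assert (P := Rabs_pos a). nra.
Qed.

Lemma cosh_sub_1_bound (a m : R) : (Rabs a <= m -> m <= 1 -> Rabs (cosh a - 1) <= 3 * m ^ 2)%R.
Proof.
  intros Ha Hm. assert (P := Rabs_pos a).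
  assert (H1 := exp_Taylor2 a). assert (H2 := exp_Taylor2 (- a)). rewrite Rabs_Ropp in H2.
  assert (E : (exp (Rabs a) <= 3)%R).
  { eapply Rle_trans; [apply exp_le; apply Rle_trans with 1%R; [lra|apply Rle_refl]|]. apply exp_le_3. }
  assert (E0 := exp_pos (Rabs a)).
  assert (A2 : (a ^ 2 <= m ^ 2)%R) by (rewrite <- (pow2_abs a); apply pow_incr; auto).
  assert (A0 : (0 <= a ^ 2)%R) by apply pow2_ge_0.
  replace ((- a) ^ 2)%R with (a ^ 2)%R in H2 by ring.
  apply Rabs_le_between in H1. apply Rabs_le_between in H2. unfold cosh.
  apply Rabs_le. split; nra.
Qed.

Lemma sinh_sub_bound (a m : R) : (Rabs a <= m -> m <= 1 -> Rabs (sinh a - a) <= 3 * m ^ 3)%R.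
Proof.
  intros Ha Hm.
  destruct (MVT_abs (fun x => sinh x - x)%R (fun x => cosh x - 1)%R 0 a) as [c [Hc Hc2]].
  { intros c _. apply derivable_pt_lim_minus; [apply derivable_pt_lim_sinh|apply derivable_pt_lim_id]. }
  rewrite sinh_0, !Rminus_0_r in Hc. rewrite Hc.
  assert (Hca : (Rabs c <= m)%R).
  { eapply Rle_trans; [|apply Ha]. unfold Rmin, Rmax in Hc2. destruct (Rle_dec 0 a); unfold Rabs; destruct (Rcase_abs c), (Rcase_abs a); lra. }
  assert (K := cosh_sub_1_bound c m Hca Hm). assert (Pa := Rabs_pos a).
  replace (3 * m ^ 3)%R with (3 * m ^ 2 * m)%R by ring. apply Rmult_le_compat; auto using Rabs_pos.
Qed.

Lemma sin_sub_bound3 (b m : R) : (Rabs b <= m -> Rabs (sin b - b) <= m ^ 3)%R.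
Proof.
  intros Hb.
  destruct (MVT_abs (fun x => sin x - x)%R (fun x => cos x - 1)%R 0 b) as [c [Hc Hc2]].
  { intros c _. apply derivable_pt_lim_minus; [apply derivable_pt_lim_sin|apply derivable_pt_lim_id]. }
  rewrite sin_0, !Rminus_0_r in Hc. rewrite Hc.
  assert (Hca : (Rabs c <= m)%R).
  { eapply Rle_trans; [|apply Hb]. unfold Rmin, Rmax in Hc2. destruct (Rle_dec 0 b); unfold Rabs; destruct (Rcase_abs c), (Rcase_abs b); lra. }
  assert (K := one_sub_cos_bound c). assert (Pa := Rabs_pos b).
  assert (A2 : (c ^ 2 <= m ^ 2)%R) by (rewrite <- (pow2_abs c); apply pow_incr; split; auto using Rabs_pos).
  rewrite Rabs_left1 by lra.
  replace (m ^ 3)%R with (m ^ 2 * m)%R by ring. apply Rmult_le_compat; lra.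
Qed.

(** For [h = a + i b] the squared modulus is [sinh(a)^2 + sin(b)^2], and both terms have linear
    lower bounds. *)
Lemma Csinh_lower (h : C) : (Rabs (Im h) <= PI / 2 -> Cmod h / 2 <= Cmod (Csinh h))%R.
Proof.
  destruct h as [a b]. simpl Im. intros Hb. rewrite Csinh_pair.
  assert (H1 := sinh_ge a). assert (H2 := sin_half_bound b Hb).
  unfold Cmod. simpl fst. simpl snd.
  replace (sqrt (a ^ 2 + b ^ 2) / 2)%R with (sqrt ((a ^ 2 + b ^ 2) / 4)).
  - apply sqrt_le_1_alt.
    assert (E1 : (a ^ 2 <= sinh a ^ 2)%R) by (rewrite <- (pow2_abs a), <- (pow2_abs (sinh a)); apply pow_incr; split; auto using Rabs_pos).
    assert (E2 : ((Rabs b / 2) ^ 2 <= sin b ^ 2)%R).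
    { rewrite <- (pow2_abs (sin b)); apply pow_incr; split; auto. assert (P := Rabs_pos b). lra. }
    replace ((Rabs b / 2) ^ 2)%R with (Rabs b ^ 2 / 4)%R in E2 by field. rewrite pow2_abs in E2.
    assert (E3 : (cosh a ^ 2 = 1 + sinh a ^ 2)%R).
    { unfold cosh, sinh. assert (X : (exp a * exp (- a) = 1)%R) by (rewrite <- exp_plus, Rplus_opp_r; apply exp_0). nra. }
    assert (E4 : (sin b ^ 2 + cos b ^ 2 = 1)%R) by (assert (S := sin2_cos2 b); unfold Rsqr in S; lra).
    replace ((sinh a * cos b) ^ 2 + (cosh a * sin b) ^ 2)%R with (sinh a ^ 2 * cos b ^ 2 + cosh a ^ 2 * sin b ^ 2)%R by ring.
    rewrite E3. assert (A0 : (0 <= a ^ 2)%R) by apply pow2_ge_0. nra.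
  - rewrite sqrt_div_alt by lra. f_equal. replace 4%R with (2 * 2)%R by ring. apply sqrt_square. lra.
Qed.

Lemma Csinh_sub_bound (h : C) : (Cmod h <= 1 -> Cmod (Csinh h - h) <= 8 * Cmod h ^ 3)%R.
Proof.
  destruct h as [a b]. intros Hm.
  assert (Ha : (Rabs a <= Cmod (a, b))%R) by apply (re_le_Cmod (a, b)).
  assert (Hb : (Rabs b <= Cmod (a, b))%R) by apply (im_le_Cmod (a, b)).
  set (m := Cmod (a, b)) in *. assert (Pm : (0 <= m)%R) by apply Cmod_ge_0.
  rewrite Csinh_pair.
  replace ((sinh a * cos b)%R, (cosh a * sin b)%R) with
    (((sinh a * cos b)%R, (cosh a * sin b)%R) : C) by reflexivity.
  replace (((sinh a * cos b)%R, (cosh a * sin b)%R) - (a, b)) with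
    ((sinh a * cos b - a)%R, (cosh a * sin b - b)%R) by (unfold Cminus, Cplus, Copp; reflexivity).
  eapply Rle_trans; [apply Cmod_le_abs|].
  assert (K1 := sinh_sub_bound a m Ha Hm). assert (K2 := cosh_sub_1_bound a m Ha Hm).
  assert (K3 := sin_sub_bound3 b m Hb). assert (K4 := one_sub_cos_bound b). assert (K5 := Rabs_sin_le b).
  assert (B2 : (b ^ 2 <= m ^ 2)%R) by (rewrite <- (pow2_abs b); apply pow_incr; split; auto using Rabs_pos).
  assert (C1 : (Rabs (cos b) <= 1)%R) by (apply Rabs_le; assert (S := COS_bound b); lra).
  assert (L1 : (Rabs (sinh a * cos b - a) <= 4 * m ^ 3)%R).
  { replace (sinh a * cos b - a)%R with ((sinh a - a) * cos b + - (a * (1 - cos b)))%R by ring.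
    eapply Rle_trans; [apply Rabs_triang|]. rewrite Rabs_Ropp, !Rabs_mult, (Rabs_pos_eq (1 - cos b)) by lra.
    assert (M1 : (Rabs (sinh a - a) * Rabs (cos b) <= 3 * m ^ 3 * 1)%R) by (apply Rmult_le_compat; auto using Rabs_pos).
    assert (M2 : (Rabs a * (1 - cos b) <= m * m ^ 2)%R) by (apply Rmult_le_compat; try lra; auto using Rabs_pos).
    simpl in *. lra. }
  assert (L2 : (Rabs (cosh a * sin b - b) <= 4 * m ^ 3)%R).
  { replace (cosh a * sin b - b)%R with ((cosh a - 1) * sin b + (sin b - b))%R by ring.
    eapply Rle_trans; [apply Rabs_triang|]. rewrite !Rabs_mult.
    assert (M1 : (Rabs (cosh a - 1) * Rabs (sin b) <= 3 * m ^ 2 * m)%R) by (apply Rmult_le_compat; auto using Rabs_pos; lra).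
    simpl in *. lra. }
  lra.
Qed.

(** For [Cmod h <= 1] the cubic remainder of [Csinh] cancels the pole, with bound
    [8 * 10 * 4 = 320]; otherwise the two terms are bounded separately by [4] and [1]. *)
Lemma inv_Csinh_bound (h : C) : h <> 0 -> (Rabs (Im h) <= PI / 2)%R ->
  (Cmod (/ Csinh h ^ 2 - / h ^ 2) <= 400)%R.
Proof.
  intros Hh Hi. assert (L := Csinh_lower h Hi). assert (P := Cmod_gt_0 h). apply P in Hh as Ph. clear P.
  assert (Ps : (0 < Cmod (Csinh h))%R) by lra.
  assert (Hs : Csinh h <> 0) by (apply Cmod_gt_0; auto).
  destruct (Rle_dec (Cmod h) 1) as [H1|H1].
  - assert (B := Csinh_sub_bound h H1). set (m := Cmod h) in *.
    replace (/ Csinh h ^ 2 - / h ^ 2) with (- ((Csinh h - h) * (Csinh h - h + 2 * h)) * (/ h ^ 2 * / Csinh h ^ 2)) by (field; auto).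
    assert (B3 : (8 * m ^ 3 <= 8 * m)%R).
    { assert (m ^ 3 <= m)%R; [|lra]. simpl. rewrite Rmult_1_r. assert (m * m <= 1)%R by nra. nra. }
    assert (B2 : (Cmod (Csinh h - h + 2 * h) <= 10 * m)%R).
    { eapply Rle_trans; [apply Cmod_triangle|]. rewrite Cmod_mult, (Cmod_RtoC_nonneg 2) by lra. fold m. lra. }
    rewrite Cmod_mult, Cmod_opp, !Cmod_mult, !Cmod_inv, !Cmod_pow by (try apply Cpow_nz; auto). fold m.
    assert (E1 : (/ Cmod (Csinh h) ^ 2 <= / (m / 2) ^ 2)%R).
    { apply Rinv_le_contravar; [apply pow_lt; lra|]. apply pow_incr. lra. }
    assert (E0 : (0 < / m ^ 2)%R) by (apply Rinv_0_lt_compat, pow_lt; auto).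
    assert (E2 : (0 < / Cmod (Csinh h) ^ 2)%R) by (apply Rinv_0_lt_compat, pow_lt; auto).
    apply Rle_trans with ((8 * m ^ 3) * (10 * m) * (/ m ^ 2 * / (m / 2) ^ 2))%R.
    + apply Rmult_le_compat.
      * apply Rmult_le_pos; apply Cmod_ge_0.
      * apply Rmult_le_pos; lra.
      * apply Rmult_le_compat; auto using Cmod_ge_0.
      * apply Rmult_le_compat_l; lra.
    + replace (8 * m ^ 3 * (10 * m) * (/ m ^ 2 * / (m / 2) ^ 2))%R with 320%R by (field; lra). lra.
  - eapply Rle_trans; [apply Cmod_triangle|]. rewrite Cmod_opp, !Cmod_inv, !Cmod_pow by (try apply Cpow_nz; auto).
    assert (E1 : (/ Cmod (Csinh h) ^ 2 <= / (1 / 2) ^ 2)%R).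
    { apply Rinv_le_contravar; [apply pow_lt; lra|]. apply pow_incr. lra. }
    assert (E2 : (/ Cmod h ^ 2 <= / 1 ^ 2)%R).
    { apply Rinv_le_contravar; [apply pow_lt; lra|]. apply pow_incr. lra. }
    replace (/ (1 / 2) ^ 2)%R with 4%R in E1 by field. rewrite pow1, Rinv_1 in E2. lra.
Qed.

Lemma RtoC_PI_neq_0 : RtoC PI <> 0.
Proof. intros E. apply RtoC_inj in E. assert (P := PI_RGT_0). lra. Qed.

Lemma Ci_neq_0 : Ci <> 0.
Proof. intros E. apply (f_equal snd) in E. simpl in E. lra. Qed.

Lemma csc2_Csinh (s : C) : Csinh (PI * Ci * s) <> 0 -> csc2 s = (PI * Ci) ^ 2 * / Csinh (PI * Ci * s) ^ 2.
Proof.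
  intros H. unfold csc2, Csinh in *. set (x := Cexp (PI * Ci * s)) in *.
  assert (Nx : x <> 0) by apply Cexp_neq_0.
  rewrite Cexp_opp in *. fold x in H. fold x.
  replace (qnome s) with (x * x) by (unfold qnome, x; rewrite <- Cexp_add; f_equal; ring).
  assert (N1 : x - / x <> 0).
  { intros E. apply H. rewrite E. field. }
  assert (N2 : 1 - x * x <> 0).
  { intros E. apply N1. replace (x - / x) with (- (1 - x * x) / x) by (field; auto). rewrite E. field. auto. }
  field. repeat split; auto.
  replace (x * x - 1) with (- (1 - x * x)) by ring. intros E. apply N2.
  replace (1 - x * x) with (- - (1 - x * x)) by ring. rewrite E. ring.
Qed.

(** Both functions have the pole [s^(-2)] at the only integer of the strip, and each stays bounded
    once it is removed. In the row, [Cmod (s - m) >= (1 + Rabs m) / 4] for [m <> 0] gives the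
    constant [16]. *)
Lemma csc2_row_bounded_strip : exists M, forall s, nonint s -> (Rabs (Re s) <= 1 / 2)%R ->
  (Cmod (csc2 s - row s) <= M)%R.
Proof.
  destruct bsum_decay as [B HB].
  exists (PI ^ 2 * 400 + 16 * B)%R. intros s Hs Hre.
  assert (Ns : s <> 0) by apply (Hs 0%Z).
  assert (P := PI_RGT_0).
  set (h := PI * Ci * s).
  assert (Nh : h <> 0) by (unfold h; apply Cmult_neq_0; auto; apply Cmult_neq_0; [apply RtoC_PI_neq_0|apply Ci_neq_0]).
  assert (Hi : (Rabs (Im h) <= PI / 2)%R).
  { replace (Im h) with (PI * Re s)%R by (unfold h, Im, Re, Ci, Cmult, RtoC; simpl; ring).
    rewrite Rabs_mult, Rabs_pos_eq by lra. nra. }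
  assert (Nsh : Csinh h <> 0).
  { apply Cmod_gt_0. assert (L := Csinh_lower h Hi). assert (Q : (0 < Cmod h)%R) by (apply Cmod_gt_0; auto). lra. }
  assert (Hrow : row s - / s ^ 2 = usum (restrict (fun m : Z => m <> 0%Z) (fun m => / (s - IZR m) ^ 2))).
  { assert (H := is_usum_remove _ _ _ (asum_usum _ (asum_restrict (fun m => m <> 0%Z) _ (asum_row s Hs)))).
    unfold row. rewrite (usum_unique _ _ H). replace (s - 0) with s by ring. ring. }
  replace (csc2 s - row s) with ((csc2 s - / s ^ 2) + - (row s - / s ^ 2)) by ring.
  eapply Rle_trans; [apply Cmod_triangle|]. rewrite Cmod_opp. apply Rplus_le_compat.
  - rewrite csc2_Csinh by exact Nsh. fold h.
    replace (/ s ^ 2) with ((PI * Ci) ^ 2 * / h ^ 2).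
    + replace ((PI * Ci) ^ 2 * / Csinh h ^ 2 - (PI * Ci) ^ 2 * / h ^ 2) with ((PI * Ci) ^ 2 * (/ Csinh h ^ 2 - / h ^ 2)) by ring.
      rewrite Cmod_mult, Cmod_pow, Cmod_mult, Cmod_Ci, Cmod_RtoC_nonneg by lra. rewrite Rmult_1_r.
      apply Rmult_le_compat_l; [apply pow2_ge_0|apply inv_Csinh_bound; auto].
    + unfold h. field. repeat split; auto; [apply Ci_neq_0|apply RtoC_PI_neq_0].
  - rewrite Hrow. eapply is_usum_bound; [apply asum_usum, asum_restrict, asum_row, Hs|].
    intros F N. apply Rle_trans with (rsum (fun m => 16 * decay m)%R F).
    + apply rsum_le. intros m. unfold restrict.
      destruct (excluded_middle_informative (m <> 0%Z)) as [E|E].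
      * assert (N1 := nonint_sub s m Hs). rewrite Cmod_inv, Cmod_pow by (apply Cpow_nz; auto).
        assert (A : (1 <= Rabs (IZR m))%R).
        { rewrite <- abs_IZR. apply IZR_le. lia. }
        assert (L : (/ 4 * (1 + Rabs (IZR m)) <= Cmod (s - IZR m))%R).
        { apply Rle_trans with (Rabs (Re (s - IZR m))); [|apply re_le_Cmod].
          replace (Re (s - IZR m)) with (- (IZR m - Re s))%R by (unfold Re, Cminus, Cplus, Copp, RtoC; simpl; ring).
          rewrite Rabs_Ropp. assert (T := Rabs_triang_inv (IZR m) (Re s)). lra. }
        rewrite <- pow_inv.
        apply Rle_trans with ((/ / 4 * / (1 + Rabs (IZR m))) ^ 2)%R.
        -- apply pow_incr. split; [apply Rlt_le, Rinv_0_lt_compat, Cmod_gt_0, N1|].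
           apply inv_le_inv_mult; auto; lra.
        -- rewrite Rpow_mult_distr. assert (D := decay_square m).
           rewrite Rinv_inv, pow_inv. lra.
      * rewrite Cmod_0. assert (D := decay_pos m). lra.
    + rewrite rsum_scal. apply Rmult_le_compat_l; [lra|apply HB, N].
Qed.

Lemma nonint_shift (s : C) (n : Z) : nonint s -> nonint (s + IZR n).
Proof.
  intros Hs m E. apply (Hs (m - n)%Z). rewrite minus_IZR, RtoC_minus, <- E. ring.
Qed.

Lemma strip_representative (s : C) : exists n : Z, (Rabs (Re (s + IZR n)) <= 1 / 2)%R.
Proof.
  exists (- up (Re s - 1 / 2))%Z. destruct (archimed (Re s - 1 / 2)) as [H1 H2].
  rewrite re_plus, opp_IZR. simpl (Re (RtoC _)). apply Rabs_le. lra.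
Qed.

(** After a shift into the strip, [qnome s = 1] would force [Csinh (PI * Ci * s) = 0], against its
    lower bound. *)
Lemma qnome_neq_1 (s : C) : nonint s -> 1 - qnome s <> 0.
Proof.
  intros Hs. destruct (strip_representative s) as [n Hn].
  assert (H := nonint_shift s n Hs). set (s' := s + IZR n) in *.
  assert (E : qnome s = qnome s') by (unfold s'; rewrite qnome_add, qnome_Z; ring).
  rewrite E. assert (N : s' <> 0) by apply (H 0%Z).
  assert (P := PI_RGT_0).
  assert (Hi : (Rabs (Im (PI * Ci * s')) <= PI / 2)%R).
  { replace (Im (PI * Ci * s')) with (PI * Re s')%R by (unfold Im, Re, Ci, Cmult, RtoC; simpl; ring).
    rewrite Rabs_mult, Rabs_pos_eq by lra. nra. }
  assert (L := Csinh_lower _ Hi).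
  assert (Q : (0 < Cmod (PI * Ci * s'))%R).
  { apply Cmod_gt_0. apply Cmult_neq_0; auto; apply Cmult_neq_0; [apply RtoC_PI_neq_0|apply Ci_neq_0]. }
  intros E1. assert (Z : Csinh (PI * Ci * s') = 0).
  { unfold Csinh. rewrite Cexp_opp. assert (Nx := Cexp_neq_0 (PI * Ci * s')).
    assert (E2 : qnome s' = Cexp (PI * Ci * s') * Cexp (PI * Ci * s')) by (unfold qnome; rewrite <- Cexp_add; f_equal; ring).
    rewrite E2 in E1. set (x := Cexp (PI * Ci * s')) in *.
    replace ((x - / x) / 2) with (- (1 - x * x) / (2 * x)) by (field; auto). rewrite E1. field. auto. }
  rewrite Z, Cmod_0 in L. lra.
Qed.

Lemma qnome_half : qnome (1 / 2) = - (1).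
Proof.
  unfold qnome. replace (2 * PI * Ci * (1 / 2)) with (PI * Ci) by field.
  unfold Cexp. replace (Re (PI * Ci)) with 0%R by (unfold Re, Ci, Cmult, RtoC; simpl; ring).
  replace (Im (PI * Ci)) with PI by (unfold Im, Ci, Cmult, RtoC; simpl; ring).
  rewrite cos_PI, sin_PI, exp_0. unfold RtoC, Copp; simpl. f_equal; ring.
Qed.

(** With [y = qnome (s / 2)] the three values of [qnome] are [y], [- y] and [y^2], and the claim is
    a rational identity. *)
Lemma csc2_duplication (s : C) : nonint s -> csc2 (s / 2) + csc2 ((s + 1) / 2) = 4 * csc2 s.
Proof.
  intros Hs. assert (N := qnome_neq_1 s Hs). unfold csc2. set (y := qnome (s / 2)).
  assert (E1 : qnome s = y * y) by (unfold y; rewrite <- qnome_add; f_equal; field).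
  assert (E2 : qnome ((s + 1) / 2) = - y).
  { replace ((s + 1) / 2) with (s / 2 + 1 / 2) by field. rewrite qnome_add, qnome_half. fold y. ring. }
  rewrite E1 in N. rewrite E1, E2. clearbody y.
  assert (N1 : 1 - y <> 0).
  { intros E. apply N. replace (1 - y * y) with ((1 - y) * (1 + y)) by ring. rewrite E. ring. }
  assert (N2 : 1 + y <> 0).
  { intros E. apply N. replace (1 - y * y) with ((1 - y) * (1 + y)) by ring. rewrite E. ring. }
  replace (1 - - y) with (1 + y) by ring.
  replace (1 - y * y) with ((1 - y) * (1 + y)) by ring. field. auto.
Qed.

(** Herglotz: the difference is bounded, and the duplication formula halves any bound. *)
Lemma csc2_row (s : C) : nonint s -> csc2 s = row s.
Proof.
  destruct csc2_row_bounded_strip as [M HM].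
  assert (HB : forall s, nonint s -> (Cmod (csc2 s - row s) <= M)%R).
  { intros s' Hs. destruct (strip_representative s') as [n Hn].
    rewrite <- (csc2_shift s' n), <- (row_shift s' n Hs). apply HM; auto. apply nonint_shift, Hs. }
  destruct (completeness (fun x => exists s, nonint s /\ x = Cmod (csc2 s - row s))) as [L [HL1 HL2]].
  - exists M. intros x [s' [Hs ->]]. auto.
  - assert (Hi : nonint Ci) by (intros m E; apply (f_equal snd) in E; simpl in E; lra).
    exists (Cmod (csc2 Ci - row Ci)). exists Ci. auto.
  - assert (H : forall s, nonint s -> (Cmod (csc2 s - row s) <= L)%R) by (intros s' Hs; apply HL1; exists s'; auto).
    assert (L0 : (L <= L / 2)%R).
    { apply HL2. intros x [s' [Hs ->]]. destruct (nonint_half s' Hs) as [H1 H2].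
      assert (E : 4 * (csc2 s' - row s') = (csc2 (s' / 2) - row (s' / 2)) + (csc2 ((s' + 1) / 2) - row ((s' + 1) / 2))).
      { assert (E1 := csc2_duplication s' Hs). assert (E2 := row_duplication s' Hs).
        replace (4 * (csc2 s' - row s')) with (4 * csc2 s' - 4 * row s') by ring. rewrite <- E1, <- E2. ring. }
      apply (f_equal Cmod) in E. rewrite Cmod_mult, (Cmod_RtoC_nonneg 4) in E by lra.
      assert (T := Cmod_triangle (csc2 (s' / 2) - row (s' / 2)) (csc2 ((s' + 1) / 2) - row ((s' + 1) / 2))).
      specialize (H _ H1) as K1. specialize (H _ H2) as K2. lra. }
    intros Hs. specialize (H s Hs). assert (P := Cmod_ge_0 (csc2 s - row s)).
    assert (E : csc2 s - row s = 0) by (apply Cmod_eq_0; lra).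
    replace (csc2 s) with (csc2 s - row s + row s) by ring. rewrite E. ring.
Qed.

Lemma csc2_opp (s : C) : nonint s -> csc2 (- s) = csc2 s.
Proof.
  intros Hs. assert (N := qnome_neq_1 s Hs). unfold csc2.
  replace (qnome (- s)) with (/ qnome s) by (unfold qnome; rewrite <- Cexp_opp; f_equal; ring).
  assert (N2 : qnome s <> 0) by apply Cexp_neq_0. set (x := qnome s) in *. clearbody x.
  field. repeat split; auto. intros E. apply N. replace (1 - x) with (- (x - 1)) by ring. rewrite E. ring.
Qed.

Definition inv_sq (m : Z) : C := restrict (fun m => m <> 0%Z) (fun m => / IZR m ^ 2) m.

Lemma asum_inv_sq : asum inv_sq.
Proof.
  apply asum_le with (fun m => 4 * decay m)%R; [|apply bsum_scal; [lra|apply bsum_decay]].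
  intros m. unfold inv_sq, restrict. assert (D := decay_square m). assert (D0 := decay_pos m).
  destruct (excluded_middle_informative (m <> 0%Z)) as [E|E]; [|rewrite Cmod_0; lra].
  assert (N : RtoC (IZR m) <> 0) by (intros E'; apply RtoC_inj, eq_IZR in E'; auto).
  assert (A : (1 <= Rabs (IZR m))%R) by (rewrite <- abs_IZR; apply IZR_le; lia).
  rewrite Cmod_inv, Cmod_pow, Cmod_R by (apply Cpow_nz; auto).
  apply Rle_trans with (4 * / (1 + Rabs (IZR m)) ^ 2)%R; [|lra].
  rewrite <- !pow_inv. replace 4%R with (2 ^ 2)%R by ring. rewrite <- Rpow_mult_distr. apply pow_incr.
  split; [apply Rlt_le, Rinv_0_lt_compat; lra|].
  replace (2 * / (1 + Rabs (IZR m)))%R with (/ ((1 + Rabs (IZR m)) / 2))%R by (field; lra).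
  apply Rinv_le_contravar; lra.
Qed.

(** The even [m] give a quarter of the whole sum, and the odd ones a quarter of
    [row (1/2) = csc2 (1/2) = PI^2]. The value is twice [zeta(2)], as [m] runs over both signs. *)
Lemma Basel : usum inv_sq = RtoC PI ^ 2 / 3.
Proof.
  set (B := usum inv_sq).
  assert (Hh : nonint (1 / 2)).
  { intros m E. assert (E2 : RtoC (2 * IZR m - 1)%R = 0).
    { rewrite RtoC_minus, RtoC_mult, <- E. field. }
    apply RtoC_inj in E2. rewrite <- (mult_IZR 2), <- (minus_IZR _ 1) in E2. apply eq_IZR in E2. lia. }
  assert (R1 : row (1 / 2) = RtoC PI ^ 2).
  { rewrite <- csc2_row by exact Hh. unfold csc2. rewrite qnome_half.
    replace ((2 * PI * Ci) ^ 2) with (4 * RtoC PI ^ 2 * (Ci * Ci)) by ring.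
    replace (Ci * Ci) with (- (1)) by (unfold Ci, Cmult, Copp, RtoC; simpl; f_equal; ring). field.  }
  assert (E1 : is_usum (restrict (fun m => Z.Even m) inv_sq) (/ 4 * B)).
  { apply (is_usum_image _ (fun m => 2 * m)%Z); [intros; lia|intros m; exists m; lia|intros t [k Hk]; exists k; lia|].
    eapply is_usum_ext; [|apply is_usum_scal, asum_usum, asum_inv_sq].
      intros m. cbv beta. unfold inv_sq, restrict.
      destruct (excluded_middle_informative (m <> 0%Z)) as [E|E], (excluded_middle_informative (2 * m <> 0)%Z) as [E'|E']; try lia; [|ring].
      assert (N : RtoC (IZR m) <> 0) by (intros F; apply RtoC_inj, eq_IZR in F; auto).
      rewrite mult_IZR, RtoC_mult. field. auto. }
  assert (E2 : is_usum (restrict (fun m => ~ Z.Even m) inv_sq) (/ 4 * row (1 / 2))).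
  { apply (is_usum_image _ (fun m => 2 * m - 1)%Z); [intros; lia|intros m [k Hk]; lia| |].
    - intros t He. destruct (Z.Even_or_Odd t) as [|[k Hk]]; [tauto|]. exists (k + 1)%Z. lia.
    - eapply is_usum_ext; [|apply is_usum_scal, asum_usum, asum_row, Hh].
      intros m. cbv beta. unfold inv_sq. rewrite restrict_true by lia.
      assert (N1 := nonint_sub _ m Hh).
      assert (N2 : RtoC (IZR (2 * m - 1)) <> 0) by (intros F; apply RtoC_inj, eq_IZR in F; lia).
      rewrite minus_IZR, mult_IZR, RtoC_minus, RtoC_mult in *.
      replace (1 / 2 - IZR m) with (- (2 * IZR m - 1) / 2) in * by field.
      field. auto. }
  assert (E3 : B = / 4 * B + / 4 * row (1 / 2)).
  { unfold B at 1. apply usum_unique. eapply is_usum_ext; [|apply (is_usum_plus _ _ _ _ E1 E2)].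
    intros m. apply restrict_compl. }
  rewrite R1 in E3.
  replace B with (4 / 3 * (B - / 4 * B)) by field. rewrite E3 at 1. field.
Qed.

(** * Fourier expansion of the Weierstrass function *)

(** From here on the lattice is normalized to [Z + Z tau] by [z = 2 w1 s]. *)
Definition off_lattice (tau s : C) : Prop := forall m n : Z, s <> IZR m + IZR n * tau.

Lemma is_usum_rows {A B : Type} (g : A * B -> C) (r : B -> C) :
  asum g -> (forall b, is_usum (fun a => g (a, b)) (r b)) -> is_usum r (usum g).
Proof.
  intros Hg Hr. apply (is_usum_prod (fun p : B * A => g (snd p, fst p)) r (usum g)).
  - apply (asum_comp g (fun p : B * A => (snd p, fst p))); auto.
    intros [a b] [c d] E; simpl in E; congruence.
  - apply is_usum_swap, asum_usum, Hg.
  - intros b. apply Hr.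
Qed.

Definition inv_lattice (tau s : C) (p : Z * Z) : C := / (s - (IZR (fst p) + IZR (snd p) * tau)).

Definition nonzero_pair (p : Z * Z) : Prop := p <> (0%Z, 0%Z).

Lemma off_lattice_sub (tau s : C) (m n : Z) : off_lattice tau s -> s - (IZR m + IZR n * tau) <> 0.
Proof.
  intros Hs E. apply (Hs m n). replace s with (s - (IZR m + IZR n * tau) + (IZR m + IZR n * tau)) by ring.
  rewrite E. ring.
Qed.

Lemma lattice_neq_0 (tau : C) (m n : Z) : (0 < Im tau)%R -> nonzero_pair (m, n) -> IZR m + IZR n * tau <> 0.
Proof.
  intros Ht Hp E. assert (E2 := f_equal Im E). rewrite Im_plus, im_scal_l in E2. simpl in E2.
  assert (Hn : IZR n = 0%R) by nra. apply eq_IZR in Hn. subst n.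
  replace (IZR m + IZR 0 * tau) with (RtoC (IZR m)) in E by ring. apply RtoC_inj, eq_IZR in E. subst m.
  apply Hp. reflexivity.
Qed.

Lemma inv_lattice_bound (tau s : C) : (0 < Im tau)%R -> exists K, (0 <= K)%R /\
  forall m n, s <> IZR m + IZR n * tau -> (Cmod (inv_lattice tau s (m, n)) <= K * / (1 + Rabs (IZR m) + Rabs (IZR n)))%R.
Proof.
  intros Ht. destruct (lattice_lower tau s Ht) as [c [Hc H]].
  exists (/ c)%R. split; [apply Rlt_le, Rinv_0_lt_compat, Hc|]. intros m n Hmn. unfold inv_lattice. cbn [fst snd].
  assert (A := Rabs_pos (IZR m)). assert (B := Rabs_pos (IZR n)).
  rewrite Cmod_inv.
  - apply inv_le_inv_mult; auto; lra.
  - intros E. apply Hmn. replace s with (s - (IZR m + IZR n * tau) + (IZR m + IZR n * tau)) by ring. rewrite E. ring.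
Qed.

Lemma decay_0 : decay 0 = 1%R.
Proof. unfold decay. rewrite Rabs_R0. replace (1 + 0)%R with 1%R by ring. rewrite sqrt_1, Rmult_1_l. apply Rinv_1. Qed.

(** The hypothesis has the shape that the summands of both [wp] and [wzeta] take after factoring.
    The origin is exempt from it: its value is charged to the constant, as [decay 0 = 1]. *)
Lemma asum_cubic (tau s : C) (g : Z * Z -> C) (K : R) : (0 < Im tau)%R -> off_lattice tau s -> (0 <= K)%R ->
  (forall p, nonzero_pair p -> (Cmod (g p) <= K * (Cmod (inv_lattice tau s p) * Cmod (inv_lattice tau 0 p) * (Cmod (inv_lattice tau s p) + Cmod (inv_lattice tau 0 p))))%R) ->
  asum g.
Proof.
  intros Ht Hs HK H.
  destruct (inv_lattice_bound tau s Ht) as [K1 [HK1 H1]]. destruct (inv_lattice_bound tau 0 Ht) as [K2 [HK2 H2]].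
  apply asum_le with (fun p => (K * (K1 * K2 * (K1 + K2)) + Cmod (g (0%Z, 0%Z))) * (decay (fst p) * decay (snd p)))%R.
  - intros [m n]. cbn [fst snd].
    assert (D := decay_cube m n). assert (D1 := decay_pos m). assert (D2 := decay_pos n).
    assert (P0 := Cmod_ge_0 (g (0%Z, 0%Z))).
    assert (P1 : (0 <= K * (K1 * K2 * (K1 + K2)))%R).
    { apply Rmult_le_pos; auto. apply Rmult_le_pos; [apply Rmult_le_pos; auto|lra]. }
    assert (PD : (0 < decay m * decay n)%R) by (apply Rmult_lt_0_compat; auto).
    destruct (classic (nonzero_pair (m, n))) as [Hp|Hp].
    + eapply Rle_trans; [apply H, Hp|].
      specialize (H1 m n (Hs m n)).
      specialize (H2 m n (fun E => lattice_neq_0 tau m n Ht Hp (eq_sym E))).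
      assert (A := Rabs_pos (IZR m)). assert (B := Rabs_pos (IZR n)).
      set (T := (/ (1 + Rabs (IZR m) + Rabs (IZR n)))%R) in *.
      assert (HT : (0 < T)%R) by (apply Rinv_0_lt_compat; lra).
      assert (HT3 : (T ^ 3 <= decay m * decay n)%R) by (unfold T; rewrite pow_inv; exact D).
      set (x := Cmod (inv_lattice tau s (m, n))) in *. set (y := Cmod (inv_lattice tau 0 (m, n))) in *.
      assert (Px : (0 <= x)%R) by apply Cmod_ge_0. assert (Py : (0 <= y)%R) by apply Cmod_ge_0.
      assert (E : (x * y * (x + y) <= (K1 * T) * (K2 * T) * (K1 * T + K2 * T))%R).
      { apply Rmult_le_compat; try lra; [apply Rmult_le_pos; auto|]. apply Rmult_le_compat; auto. }
      replace ((K1 * T) * (K2 * T) * (K1 * T + K2 * T))%R with ((K1 * K2 * (K1 + K2)) * T ^ 3)%R in E by ring.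
      apply Rle_trans with (K * ((K1 * K2 * (K1 + K2)) * T ^ 3))%R; [apply Rmult_le_compat_l; auto|].
      rewrite <- Rmult_assoc. 
      apply Rle_trans with (K * (K1 * K2 * (K1 + K2)) * (decay m * decay n))%R; [apply Rmult_le_compat_l; auto|].
      apply Rmult_le_compat_r; lra.
    + assert (E : (m, n) = (0%Z, 0%Z)) by (apply NNPP, Hp). injection E; intros -> ->.
      rewrite decay_0. lra.
  - apply bsum_scal.
    + apply Rplus_le_le_0_compat; [|apply Cmod_ge_0].
      apply Rmult_le_pos; auto. apply Rmult_le_pos; [apply Rmult_le_pos; auto|lra].
    + apply bsum_prod; try apply bsum_decay; intros a; apply Rlt_le, decay_pos.
Qed.

Lemma nonzero_part_true (f : Z * Z -> C) p : nonzero_pair p -> nonzero_part f p = f p.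
Proof.
  intros Hp. destruct p as [m n]. destruct m, n; try reflexivity. exfalso. apply Hp. reflexivity.
Qed.

Lemma nonzero_part_restrict (f : Z * Z -> C) p : nonzero_part f p = restrict nonzero_pair f p.
Proof.
  destruct (classic (nonzero_pair p)) as [Hp|Hp].
  - rewrite nonzero_part_true, restrict_true; auto.
  - rewrite restrict_false by auto. apply NNPP in Hp. subst p. reflexivity.
Qed.

Lemma lattice_pt_tau (w1 tau : C) (p : Z * Z) :
  lattice_pt w1 (tau * w1) p = 2 * w1 * (IZR (fst p) + IZR (snd p) * tau).
Proof. unfold lattice_pt. ring. Qed.

(** [sum_m (m + n tau)^(-2)], without the term [m = 0] when [n = 0] *)
Definition eis_row (tau : C) (n : Z) : C :=
  if Z.eq_dec n 0 then usum inv_sq else csc2 (IZR n * tau).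

Lemma nonint_row (tau s : C) (n : Z) : off_lattice tau s -> nonint (s - IZR n * tau).
Proof.
  intros Hs m E. apply (Hs m n). rewrite <- E. ring.
Qed.

Lemma nonint_mult_tau (tau : C) (n : Z) : (0 < Im tau)%R -> n <> 0%Z -> nonint (IZR n * tau).
Proof.
  intros Ht Hn m E. apply (lattice_neq_0 tau (- m) n Ht).
  - intros E'. injection E'. intros. lia.
  - rewrite E, opp_IZR, RtoC_opp. ring.
Qed.

Lemma is_usum_eis_row (tau : C) (n : Z) : (0 < Im tau)%R ->
  is_usum (fun m => restrict nonzero_pair (fun p => inv_lattice tau 0 p ^ 2) (m, n)) (eis_row tau n).
Proof.
  intros Ht. unfold eis_row. destruct (Z.eq_dec n 0) as [->|Hn].
  - eapply is_usum_ext; [|apply (asum_usum _ asum_inv_sq)]. intros m. unfold inv_sq, restrict, nonzero_pair.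
    destruct (excluded_middle_informative (m <> 0%Z)) as [E|E],
      (excluded_middle_informative ((m, 0%Z) <> (0%Z, 0%Z))) as [E'|E']; try reflexivity.
    + unfold inv_lattice. cbn [fst snd]. assert (N : RtoC (IZR m) <> 0) by (intros E2; apply RtoC_inj, eq_IZR in E2; auto).
      replace (0 - (IZR m + 0 * tau)) with (- IZR m) by ring. field. auto.
    + exfalso. apply E'. congruence.
    + exfalso. apply E. congruence.
  - assert (Hi := nonint_mult_tau tau n Ht Hn).
    assert (Hi' : nonint (- (IZR n * tau))).
    { intros m E. apply (Hi (- m)%Z). rewrite opp_IZR, RtoC_opp, <- E. ring. }
    rewrite <- csc2_opp, csc2_row by auto.
    eapply is_usum_ext; [|apply (asum_usum _ (asum_row _ Hi'))]. intros m. cbv beta.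
    rewrite restrict_true by (unfold nonzero_pair; congruence). unfold inv_lattice. cbn [fst snd].
    rewrite Cpow_inv.
    + do 2 f_equal. ring.
    + assert (N := lattice_neq_0 tau m n Ht). intros E. apply N; [unfold nonzero_pair; congruence|].
      replace (IZR m + IZR n * tau) with (- (0 - (IZR m + IZR n * tau))) by ring. rewrite E. ring.
Qed.

(** Only the difference of the two inverse squares is summable over the lattice, but within one row
    each part is; so the row sums, and not the total, split. *)
Lemma wp_rows (w1 tau s : C) : w1 <> 0 -> (0 < Im tau)%R -> off_lattice tau s ->
  is_usum (fun n => csc2 (s - IZR n * tau) - eis_row tau n) (wp w1 (tau * w1) (2 * w1 * s) * (2 * w1) ^ 2).
Proof.
  intros Hw Ht Hs.
  set (f := fun p : Z * Z => inv_lattice tau s p ^ 2 - restrict nonzero_pair (fun p => inv_lattice tau 0 p ^ 2) p).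
  assert (Ns : s <> 0).
  { intros E. apply (Hs 0%Z 0%Z). rewrite E. ring. }
  assert (Af : asum f).
  { apply (asum_cubic tau s f (Cmod s) Ht Hs (Cmod_ge_0 s)). intros [m n] Hp. unfold f.
    rewrite restrict_true by exact Hp.
    set (A := inv_lattice tau s (m, n)). set (B := inv_lattice tau 0 (m, n)).
    (* Because [B] is [1 / (0 - w)], the difference [A - B] equals [- s * A * B]. *)
    assert (E : A ^ 2 - B ^ 2 = - s * (A * B * (A + B))).
    { unfold A, B, inv_lattice. cbn [fst snd]. assert (N1 := off_lattice_sub tau s m n Hs).
      assert (N2 := lattice_neq_0 tau m n Ht Hp). set (w := IZR m + IZR n * tau) in *. clearbody w.
      field; auto. }
    rewrite E, !Cmod_mult, Cmod_opp. apply Rmult_le_compat_l; [apply Cmod_ge_0|].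
    apply Rmult_le_compat_l; [apply Rmult_le_pos; apply Cmod_ge_0|apply Cmod_triangle]. }
  assert (E : wp w1 (tau * w1) (2 * w1 * s) * (2 * w1) ^ 2 = usum f).
  { unfold wp. symmetry. apply usum_unique.
    assert (N2 : 2 * w1 <> 0) by (apply Cmult_neq_0; auto; intros E; apply RtoC_inj in E; lra).
    set (g := nonzero_part _).
    assert (Eg : forall p, (2 * w1) ^ 2 * g p = restrict nonzero_pair f p).
    { intros [m n]. unfold g. rewrite nonzero_part_restrict. destruct (classic (nonzero_pair (m, n))) as [Hp|Hp].
      - rewrite !restrict_true by exact Hp. cbv zeta. rewrite lattice_pt_tau. unfold f. rewrite restrict_true by exact Hp.
        unfold inv_lattice. cbn [fst snd]. assert (N1 := off_lattice_sub tau s m n Hs).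
        assert (N3 := lattice_neq_0 tau m n Ht Hp). set (w := IZR m + IZR n * tau) in *. clearbody w.
        field. repeat split; auto; replace (2 * w1 * s - 2 * w1 * w) with (2 * w1 * (s - w)) by ring; auto using Cmult_neq_0.
      - rewrite !restrict_false by exact Hp. ring. }
    assert (Ag : asum g).
    { apply asum_ext with (fun p => / (2 * w1) ^ 2 * restrict nonzero_pair f p).
      - intros p. rewrite <- Eg. field. auto.
      - apply asum_scal, asum_restrict, Af. }
    replace ((/ (2 * w1 * s) ^ 2 + usum g) * (2 * w1) ^ 2) with (f (0%Z, 0%Z) + (2 * w1) ^ 2 * usum g).
    - eapply is_usum_ext; [|apply is_usum_plus; [apply (is_usum_single f (0%Z, 0%Z))|apply is_usum_scal, (asum_usum _ Ag)]].
      intros p. cbv beta. rewrite Eg. apply restrict_compl.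
    - unfold f. rewrite restrict_false by (intros H; apply H; reflexivity). unfold inv_lattice. cbn [fst snd].
      replace (s - (0 + 0 * tau)) with s by ring. field. auto. }
  rewrite E. apply (is_usum_rows f _ Af). intros n.
  apply is_usum_minus; [|apply is_usum_eis_row, Ht].
  assert (Hi := nonint_row tau s n Hs). rewrite csc2_row by exact Hi.
  eapply is_usum_ext; [|apply (asum_usum _ (asum_row _ Hi))]. intros m. cbv beta.
  unfold inv_lattice. cbn [fst snd]. rewrite Cpow_inv by apply off_lattice_sub, Hs. do 2 f_equal. ring.
Qed.

(** [sum_(d >= 1) d u_d e(d s)] as a function of [s] *)
Definition lambert_exp_series (tau : C) : C -> C :=
  exp_series (fun d : nat => RtoC (INR (S d) ^ 1) * lambert_term (qnome tau) (S d)) (fun d => 2 * PI * Ci * RtoC (INR (S d))).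

(** The factor [u_d] decays like [q^d], which extends convergence below the real axis as far as
    [- Im tau]; half of the remaining distance is the margin. *)
Lemma lambert_exp_summable (tau sigma : C) : (0 < Im tau)%R -> (- Im tau < Im sigma)%R ->
  exp_summable (fun d : nat => RtoC (INR (S d) ^ 1) * lambert_term (qnome tau) (S d)) (fun d => 2 * PI * Ci * RtoC (INR (S d))) sigma.
Proof.
  intros Ht Hs. assert (P := PI_RGT_0).
  set (e := ((Im tau + Im sigma) / 2)%R). assert (He : (0 < e)%R) by (unfold e; lra).
  exists e. split; auto.
  destruct (lambert_term_bound (qnome tau) (Cmod_qnome_lt_1 tau Ht)) as [M [HM HB]].
  set (r := exp (- (2 * PI * e))).
  assert (Hr : (0 < r < 1)%R).
  { split; [apply exp_pos|]. rewrite <- exp_0. apply exp_increasing. assert (0 < PI * e)%R by (apply Rmult_lt_0_compat; auto). lra. }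
  assert (Hb := bsum_pow_geom 1 r). apply (bsum_comp _ S) in Hb; [|intros; lia|lra].
  apply bsum_le with (2 := bsum_scal _ M HM Hb). intros d.
  assert (Pd := pos_INR (S d)).
  rewrite Cmod_mult, !Cmod_mult, Cmod_Ci, !Cmod_RtoC_nonneg by (try apply pow_le; auto; lra).
  replace (2 * PI * Ci * RtoC (INR (S d)) * sigma) with (2 * PI * Ci * (RtoC (INR (S d)) * sigma)) by ring.
  rewrite Re_2PiCi, im_scal_l. specialize (HB d). rewrite Cmod_qnome, exp_pow in HB.
  rewrite Rmult_assoc, <- exp_plus.
  replace (M * (INR (S d) ^ 1 * r ^ S d))%R with (INR (S d) ^ 1 * (M * r ^ S d))%R by ring.
  rewrite Rmult_assoc. apply Rmult_le_compat_l; [apply pow_le; auto|].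
  eapply Rle_trans; [apply Rmult_le_compat_r; [apply Rlt_le, exp_pos|apply HB]|].
  rewrite Rmult_assoc, <- exp_plus. unfold r. rewrite exp_pow. apply Rmult_le_compat_l; auto.
  right. f_equal. unfold e. field.
Qed.

Lemma qnome_mult_INR (n : nat) (s : C) : Cexp (2 * PI * Ci * RtoC (INR n) * s) = qnome s ^ n.
Proof. unfold qnome. rewrite Cexp_pow. f_equal. ring. Qed.

Lemma Im_shift (a b : C) (x : R) : Im (a + x * b) = (Im a + x * Im b)%R.
Proof. rewrite Im_plus, im_scal_l. reflexivity. Qed.

(** Each [sigma + k tau] with [k >= 1] lies in the upper half-plane, where [csc2] is [(2 PI i)^2]
    times the sum of [d e(d s)]. Exchanging the sums leaves the geometric series of [q^(d k)] over
    [k], which is [u_d]. *)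
Lemma is_usum_csc2_tail (tau sigma : C) : (0 < Im tau)%R -> (- Im tau < Im sigma)%R ->
  is_usum (fun k : nat => csc2 (sigma + RtoC (INR (S k)) * tau)) ((2 * PI * Ci) ^ 2 * lambert_exp_series tau sigma).
Proof.
  intros Ht Hs.
  set (g := fun p : nat * nat => RtoC (INR (S (snd p)) ^ 1) * qnome (sigma + RtoC (INR (S (fst p))) * tau) ^ S (snd p)).
  assert (Hq : forall d k : nat, qnome (sigma + RtoC (INR (S k)) * tau) ^ S d = qnome sigma ^ S d * (qnome tau ^ S d) ^ S k).
  { intros d k. rewrite qnome_add, Cpow_mult_l. f_equal. unfold qnome. rewrite !Cexp_pow. f_equal. ring. }
  assert (Ag : asum g).
  { assert (P := PI_RGT_0).
    set (r := exp (- (2 * PI * (Im tau + Im sigma)))). set (r2 := exp (- (2 * PI * Im tau))).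
    assert (P1 : (0 < PI * (Im tau + Im sigma))%R) by (apply Rmult_lt_0_compat; lra).
    assert (P2 : (0 < PI * Im tau)%R) by (apply Rmult_lt_0_compat; lra).
    assert (Hr : (0 < r < 1)%R) by (split; [apply exp_pos|]; rewrite <- exp_0; apply exp_increasing; lra).
    assert (Hr2 : (0 < r2 < 1)%R) by (split; [apply exp_pos|]; rewrite <- exp_0; apply exp_increasing; lra).
    assert (Hb := bsum_pow_geom 1 r). apply (bsum_comp _ S) in Hb; [|intros; lia|lra].
    assert (Hb2 := bsum_geom r2 ltac:(lra)).
    assert (Hp : forall n : nat, (0 <= INR (S n) ^ 1 * r ^ S n)%R).
    { intros n. apply Rmult_le_pos; apply pow_le; [apply pos_INR|lra]. }
    assert (Hp2 : forall n : nat, (0 <= r2 ^ n)%R) by (intros n; apply pow_le; lra).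
    apply asum_le with (2 := bsum_prod _ _ Hp2 Hp Hb2 Hb). intros [k d]. unfold g. cbn [fst snd].
    assert (Pd := pos_INR (S d)). assert (Pk := pos_INR k).
    rewrite Cmod_mult, Cmod_RtoC_nonneg, Cmod_pow, Cmod_qnome, Im_shift by (apply pow_le; auto).
    replace (r2 ^ k * (INR (S d) ^ 1 * r ^ S d))%R with (INR (S d) ^ 1 * (r2 ^ k * r ^ S d))%R by ring. apply Rmult_le_compat_l; [apply pow_le; auto|].
    unfold r, r2. rewrite !exp_pow, <- exp_plus. apply exp_le.
    rewrite S_INR. assert (1 <= INR (S d))%R by (rewrite S_INR; assert (X := pos_INR d); lra).
    assert (0 <= (PI * Im tau) * INR k)%R by (apply Rmult_le_pos; lra).
    nra. }
  assert (H1 := is_usum_rows g (fun d => (RtoC (INR (S d) ^ 1) * lambert_term (qnome tau) (S d)) * Cexp (2 * PI * Ci * RtoC (INR (S d)) * sigma)) Ag).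
  assert (E : usum g = lambert_exp_series tau sigma).
  { symmetry. apply usum_unique. apply H1. intros d. unfold g. cbn [fst snd].
    rewrite qnome_mult_INR.
    assert (Hqd : (Cmod (qnome tau ^ S d) < 1)%R).
    { assert (X := Cmod_qnome_lt_1 tau Ht). assert (X0 := pow_q_le _ X d). lra. }
    assert (G := is_usum_scal _ (RtoC (INR (S d) ^ 1) * qnome sigma ^ S d) _ (is_usum_geom _ Hqd)).
    unfold lambert_term. replace (RtoC (INR (S d) ^ 1) * (qnome tau ^ S d / (1 - qnome tau ^ S d)) * qnome sigma ^ S d) with
      (RtoC (INR (S d) ^ 1) * qnome sigma ^ S d * (qnome tau ^ S d / (1 - qnome tau ^ S d))) by ring.
    eapply is_usum_ext; [|exact G]. intros k. cbv beta. rewrite Hq. simpl (INR (S k) ^ 0)%R. ring. }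
  rewrite <- E.
  assert (H2 := is_usum_prod _ (fun k => / (2 * PI * Ci) ^ 2 * csc2 (sigma + RtoC (INR (S k)) * tau)) _ Ag (asum_usum _ Ag)).
  assert (N : 2 * PI * Ci <> 0).
  { apply Cmult_neq_0; [apply Cmult_neq_0|apply Ci_neq_0]; [intros X; apply RtoC_inj in X; lra|apply RtoC_PI_neq_0]. }
  eapply is_usum_ext; [|apply is_usum_scal, H2].
  - intros k. cbv beta. field. repeat split; auto. apply Ci_neq_0. apply RtoC_PI_neq_0.
  - intros k. cbv beta. unfold csc2.
    replace (/ (2 * PI * Ci) ^ 2 * ((2 * PI * Ci) ^ 2 * (qnome (sigma + RtoC (INR (S k)) * tau) / (1 - qnome (sigma + RtoC (INR (S k)) * tau)) ^ 2)))
     with (qnome (sigma + RtoC (INR (S k)) * tau) / (1 - qnome (sigma + RtoC (INR (S k)) * tau)) ^ 2).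
    + apply is_usum_geom1. apply Cmod_qnome_lt_1. rewrite Im_shift, S_INR. assert (X := pos_INR k). nra.
    + set (y := _ / _). field. split; [apply Ci_neq_0|apply RtoC_PI_neq_0].
Qed.

Lemma two_PiCi_neq_0 : 2 * PI * Ci <> 0.
Proof.
  apply Cmult_neq_0; [apply Cmult_neq_0|apply Ci_neq_0]; [intros X; apply RtoC_inj in X; lra|apply RtoC_PI_neq_0].
Qed.

Lemma Ci_sq : Ci * Ci = - (1).
Proof. unfold Ci, Cmult, Copp, RtoC; simpl; f_equal; ring. Qed.

Lemma lambert_exp_series_0 (tau : C) : lambert_exp_series tau 0 = Ssum (qnome tau) 1.
Proof.
  unfold lambert_exp_series, exp_series, Ssum. apply usum_ext. intros d. rewrite Cmult_0_r, Cexp_0. ring.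
Qed.

(** The Eisenstein summation of [w^(-2)]: row zero is [PI^2 / 3], the rows above and below give
    equal tails, and the total is [PI^2 E2 / 3]. *)
Lemma is_usum_eis_rows (tau : C) : (0 < Im tau)%R ->
  is_usum (eis_row tau) (- (2 * PI * Ci) ^ 2 / 12 * E2 tau).
Proof.
  intros Ht.
  assert (T := is_usum_csc2_tail tau 0 Ht ltac:(simpl; lra)). rewrite lambert_exp_series_0 in T.
  assert (H : is_usum (restrict (fun n => n <> 0%Z) (eis_row tau))
    ((2 * PI * Ci) ^ 2 * Ssum (qnome tau) 1 + (2 * PI * Ci) ^ 2 * Ssum (qnome tau) 1)).
  { apply is_usum_Z_punctured; (eapply is_usum_ext; [|exact T]); intros k; cbv beta; rewrite Cplus_0_l;
      unfold eis_row.
    - destruct (Z.eq_dec (0 - Z.of_nat (S k)) 0) as [E|E]; [lia|].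
      assert (Hi := nonint_mult_tau tau (Z.of_nat (S k)) Ht ltac:(lia)).
      rewrite INR_IZR_INZ, <- (csc2_opp _ Hi). f_equal. rewrite minus_IZR, RtoC_minus. ring.
    - destruct (Z.eq_dec (0 + Z.of_nat (S k)) 0) as [E|E]; [lia|].
      rewrite INR_IZR_INZ. reflexivity. }
  assert (H0 := is_usum_single (eis_row tau) 0%Z).
  replace (- (2 * PI * Ci) ^ 2 / 12 * E2 tau) with
    (eis_row tau 0%Z + ((2 * PI * Ci) ^ 2 * Ssum (qnome tau) 1 + (2 * PI * Ci) ^ 2 * Ssum (qnome tau) 1)).
  - eapply is_usum_ext; [|apply (is_usum_plus _ _ _ _ H0 H)]. intros n. apply restrict_compl.
  - unfold eis_row. destruct (Z.eq_dec 0 0) as [_|E]; [|lia].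
    rewrite Basel. unfold E2. rewrite lambert_qdouble, qdouble_Ssum by exact Ht.
    replace ((2 * PI * Ci) ^ 2) with (4 * RtoC PI ^ 2 * (Ci * Ci)) by ring. rewrite Ci_sq. field.
Qed.

Lemma off_lattice_strip (tau sigma : C) (j : Z) : (0 < Im tau)%R -> (Rabs (Im sigma) < Im tau)%R -> nonint sigma ->
  off_lattice tau (sigma + IZR j * tau).
Proof.
  intros Ht Hs Hi m n E. assert (E2 := f_equal Im E). rewrite !Im_shift in E2. simpl (Im (RtoC (IZR m))) in E2.
  assert (E3 : (Im sigma = IZR (n - j) * Im tau)%R) by (rewrite minus_IZR; lra).
  destruct (Z.eq_dec (n - j) 0) as [Z0|Z0].
  - apply (Hi m). replace j with n in E by lia. replace sigma with (sigma + IZR n * tau - IZR n * tau) by ring.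
    rewrite E. ring.
  - rewrite E3, Rabs_mult, (Rabs_pos_eq (Im tau)) in Hs by lra.
    assert (A : (1 <= Rabs (IZR (n - j)))%R) by (rewrite <- abs_IZR; apply IZR_le; lia). nra.
Qed.

(** Row [j] is kept as a closed form and the rows on either side become the two tails. Unlike
    [wp_fourier], this holds on both sides of row [j] and on it away from the lattice, as needed for
    the smoothness of [wp]. *)
Lemma wp_expansion (w1 tau sigma : C) (j : Z) : w1 <> 0 -> (0 < Im tau)%R ->
  (Rabs (Im sigma) < Im tau)%R -> nonint sigma ->
  wp w1 (tau * w1) (2 * w1 * (sigma + IZR j * tau)) * (2 * w1) ^ 2 =
  csc2 sigma + (2 * PI * Ci) ^ 2 * (E2 tau / 12 + (lambert_exp_series tau sigma + lambert_exp_series tau (- sigma))).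
Proof.
  intros Hw Ht Hs Hi. assert (Ho := off_lattice_strip tau sigma j Ht Hs Hi).
  assert (W := wp_rows w1 tau _ Hw Ht Ho). set (s := sigma + IZR j * tau) in *.
  apply Rabs_def2 in Hs.
  assert (T1 := is_usum_csc2_tail tau sigma Ht ltac:(lra)).
  assert (T2 := is_usum_csc2_tail tau (- sigma) Ht ltac:(rewrite im_opp; lra)).
  assert (H : is_usum (restrict (fun n => n <> j) (fun n => csc2 (s - IZR n * tau)))
    ((2 * PI * Ci) ^ 2 * lambert_exp_series tau sigma + (2 * PI * Ci) ^ 2 * lambert_exp_series tau (- sigma))).
  { apply is_usum_Z_punctured.
    - eapply is_usum_ext; [|exact T1]. intros k. cbv beta. unfold s. rewrite INR_IZR_INZ. f_equal.
      rewrite minus_IZR, RtoC_minus. ring.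
    - eapply is_usum_ext; [|exact T2]. intros k. cbv beta. unfold s. rewrite INR_IZR_INZ.
      replace (sigma + IZR j * tau - IZR (j + Z.of_nat (S k)) * tau) with (- (- sigma + IZR (Z.of_nat (S k)) * tau))
        by (rewrite plus_IZR, RtoC_plus; ring).
      symmetry. apply csc2_opp. intros m E.
      apply (Ho (- m)%Z (j + Z.of_nat (S k))%Z). unfold s. rewrite opp_IZR, RtoC_opp, <- E, plus_IZR, RtoC_plus. ring. }
  assert (H0 := is_usum_single (fun n => csc2 (s - IZR n * tau)) j).
  assert (HE := is_usum_eis_rows tau Ht).
  rewrite (is_usum_unique _ _ _ W (is_usum_ext _ _ _
    (fun n => f_equal (fun x => x - eis_row tau n) (restrict_compl (fun n => n = j) (fun n => csc2 (s - IZR n * tau)) n))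
    (is_usum_minus _ _ _ _ (is_usum_plus _ _ _ _ H0 H) HE))).
  replace (s - IZR j * tau) with sigma by (unfold s; ring). field.
Qed.

(** The value at [n = 0] is [0], as the numerator vanishes. *)
Definition wp_coef (tau : C) (n : Z) : C := IZR n / (1 - qnome (IZR n * tau)).

Definition freq (n : Z) : C := 2 * PI * Ci * RtoC (IZR n).

Lemma wp_coef_0 (tau : C) : wp_coef tau 0 = 0.
Proof. unfold wp_coef, Cdiv. ring. Qed.

Lemma qnome_mult_nat (n : nat) (tau : C) : qnome (IZR (Z.of_nat n) * tau) = qnome tau ^ n.
Proof. unfold qnome. rewrite Cexp_pow, INR_IZR_INZ. f_equal. ring. Qed.

Lemma wp_coef_pos (tau : C) (n : nat) : (0 < Im tau)%R ->
  wp_coef tau (Z.of_nat (S n)) = RtoC (INR (S n)) * (1 + lambert_term (qnome tau) (S n)).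
Proof.
  intros Ht. unfold wp_coef, lambert_term. rewrite qnome_mult_nat, INR_IZR_INZ.
  assert (N := pow_q_ne (qnome tau) (Cmod_qnome_lt_1 tau Ht) n). field. exact N.
Qed.

Lemma wp_coef_neg (tau : C) (n : nat) : (0 < Im tau)%R ->
  wp_coef tau (- Z.of_nat (S n)) = RtoC (INR (S n)) * lambert_term (qnome tau) (S n).
Proof.
  intros Ht. unfold wp_coef, lambert_term. 
  replace (qnome (IZR (- Z.of_nat (S n)) * tau)) with (/ qnome tau ^ S n).
  - rewrite opp_IZR, RtoC_opp, INR_IZR_INZ.
    assert (N := pow_q_ne (qnome tau) (Cmod_qnome_lt_1 tau Ht) n).
    assert (N2 : qnome tau ^ S n <> 0) by apply Cpow_nz, Cexp_neq_0.
    set (x := qnome tau ^ S n) in *. clearbody x. field. repeat split; auto.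
    replace (x - 1) with (- (1 - x)) by ring. intros E. apply N. replace (1 - x) with (- - (1 - x)) by ring. rewrite E. ring.
  - rewrite <- qnome_mult_nat. unfold qnome. rewrite <- Cexp_opp. f_equal. rewrite opp_IZR, RtoC_opp. ring.
Qed.

Lemma Re_freq (n : Z) (s : C) : Re (freq n * s) = (- (2 * PI * (IZR n * Im s)))%R.
Proof.
  unfold freq. replace (2 * PI * Ci * IZR n * s) with (2 * PI * Ci * (IZR n * s)) by ring.
  rewrite Re_2PiCi, im_scal_l. reflexivity.
Qed.

(** Polynomial growth at positive indices requires [Im s > 0], and decay [exp (- 2 PI r n)] at
    negative ones allows [Im s < r]. The margin is half the distance to the boundary of this
    strip. *)
Lemma fourier_summable (c : Z -> C) (K r : R) (p : nat) (s : C) : (0 <= K)%R ->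
  (forall n : nat, Cmod (c (Z.of_nat n)) <= K * (1 + INR n) ^ p)%R ->
  (forall n : nat, Cmod (c (- Z.of_nat n)%Z) <= K * (1 + INR n) ^ p * exp (- (2 * PI * (r * INR n))))%R ->
  (0 < Im s < r)%R -> exp_summable c freq s.
Proof.
  intros HK H1 H2 Hs. assert (P := PI_RGT_0).
  set (e := (Rmin (Im s) (r - Im s) / 2)%R).
  assert (He : (0 < e)%R) by (unfold e; assert (0 < Rmin (Im s) (r - Im s))%R by (apply Rmin_pos; lra); lra).
  assert (E1 : (2 * e <= Im s)%R) by (unfold e; assert (X := Rmin_l (Im s) (r - Im s)); lra).
  assert (E2 : (2 * e <= r - Im s)%R) by (unfold e; assert (X := Rmin_r (Im s) (r - Im s)); lra).
  exists e. split; auto.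
  set (rho := exp (- (2 * PI * e))).
  assert (P1 : (0 < PI * e)%R) by (apply Rmult_lt_0_compat; lra).
  assert (Hr : (0 < rho < 1)%R) by (split; [apply exp_pos|]; rewrite <- exp_0; apply exp_increasing; lra).
  assert (HB : bsum (fun n : nat => K * / rho * (INR (S n) ^ p * rho ^ S n))%R).
  { apply bsum_scal; [apply Rmult_le_pos; auto; apply Rlt_le, Rinv_0_lt_compat; lra|].
    apply (bsum_comp (fun n => INR n ^ p * rho ^ n)%R S); [intros; lia|]. apply bsum_pow_geom. lra. }
  assert (Key : forall (n : nat) (x y : R), (x <= K * (1 + INR n) ^ p * exp y -> y <= - (2 * PI * e) * INR n ->
    x <= K * / rho * (INR (S n) ^ p * rho ^ S n))%R).
  { intros n x y Hx Hy. eapply Rle_trans; [apply Hx|].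
    rewrite S_INR, (Rplus_comm 1).
    replace (K * / rho * ((INR n + 1) ^ p * rho ^ S n))%R with (K * (INR n + 1) ^ p * rho ^ n)%R by (simpl; field; lra).
    apply Rmult_le_compat_l; [apply Rmult_le_pos; auto; apply pow_le; assert (X := pos_INR n); lra|].
    unfold rho. rewrite exp_pow. apply exp_le. lra. }
  assert (Cm : forall n, Cmod (freq n) = (2 * PI * Rabs (IZR n))%R).
  { intros n. unfold freq. rewrite !Cmod_mult, Cmod_Ci, (Cmod_R (IZR n)), !Cmod_RtoC_nonneg by lra. ring. }
  apply bsum_Z.
  - intros n. apply Rmult_le_pos; [apply Rmult_le_pos; [apply Cmod_ge_0|]|]; apply Rlt_le, exp_pos.
  - apply bsum_le with (2 := HB). intros n. assert (X := pos_INR n). specialize (H1 n).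
    rewrite Re_freq, Cm, <- INR_IZR_INZ, Rabs_pos_eq by auto.
    apply (Key n _ (- (2 * PI * (INR n * Im s)) + e * (2 * PI * INR n))%R).
    + rewrite exp_plus, Rmult_assoc.
      apply Rmult_le_compat_r; [apply Rlt_le, Rmult_lt_0_compat; apply exp_pos|exact H1].
    + assert (0 <= PI * INR n * (Im s - 2 * e))%R by (apply Rmult_le_pos; [apply Rmult_le_pos; lra|lra]). lra.
  - apply bsum_le with (2 := HB). intros n. assert (X := pos_INR n). specialize (H2 n).
    rewrite Re_freq, Cm, opp_IZR, Rabs_Ropp, <- INR_IZR_INZ, Rabs_pos_eq by auto.
    apply (Key n _ (- (2 * PI * (r * INR n)) + (2 * PI * (INR n * Im s)) + e * (2 * PI * INR n))%R).
    + replace (- (2 * PI * (- INR n * Im s)))%R with (2 * PI * (INR n * Im s))%R by ring.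
      rewrite !exp_plus, Rmult_assoc.
      set (e1 := exp (2 * PI * (INR n * Im s))). set (e2 := exp (e * (2 * PI * INR n))).
      set (e3 := exp (- (2 * PI * (r * INR n)))) in *.
      replace (K * (1 + INR n) ^ p * (e3 * e1 * e2))%R with (K * (1 + INR n) ^ p * e3 * (e1 * e2))%R by ring.
      apply Rmult_le_compat_r; [apply Rlt_le, Rmult_lt_0_compat; apply exp_pos|exact H2].
    + assert (0 <= PI * INR n * (r - Im s - 2 * e))%R by (apply Rmult_le_pos; [apply Rmult_le_pos; lra|lra]). lra.
Qed.

Lemma wp_coef_bound (tau : C) : (0 < Im tau)%R -> exists K, (0 <= K)%R /\ forall n : nat,
  (Cmod (wp_coef tau (Z.of_nat n)) <= K * (1 + INR n) ^ 1)%R /\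
  (Cmod (wp_coef tau (- Z.of_nat n)) <= K * (1 + INR n) ^ 1 * exp (- (2 * PI * (Im tau * INR n))))%R.
Proof.
  intros Ht. destruct (lambert_term_bound (qnome tau) (Cmod_qnome_lt_1 tau Ht)) as [M [HM HB]].
  exists (1 + M)%R. split; [lra|]. intros n. assert (X := pos_INR n). rewrite pow_1.
  destruct n as [|n].
  - simpl Z.of_nat. change (- 0)%Z with 0%Z. rewrite wp_coef_0, Cmod_0. split.
    + apply Rmult_le_pos; lra.
    + apply Rmult_le_pos; [apply Rmult_le_pos; lra|apply Rlt_le, exp_pos].
  - specialize (HB n). assert (HB' : (Cmod (lambert_term (qnome tau) (S n)) <= M)%R).
    { eapply Rle_trans; [apply HB|]. assert (Q := Cmod_qnome_lt_1 tau Ht). assert (Q0 := Cmod_ge_0 (qnome tau)).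
      assert (Y : (Cmod (qnome tau) ^ S n <= 1 ^ S n)%R) by (apply pow_incr; lra). rewrite pow1 in Y.
      assert (0 <= Cmod (qnome tau) ^ S n)%R by (apply pow_le; auto). nra. }
    rewrite wp_coef_pos, wp_coef_neg, !Cmod_mult, !Cmod_RtoC_nonneg by auto.
    assert (P0 := Cmod_ge_0 (lambert_term (qnome tau) (S n))). split.
    + assert (T := Cmod_triangle 1 (lambert_term (qnome tau) (S n))). rewrite Cmod_1 in T. nra.
    + rewrite Cmod_qnome, exp_pow in HB.
      replace (- (2 * PI * Im tau) * INR (S n))%R with (- (2 * PI * (Im tau * INR (S n))))%R in HB by ring.
      set (ee := exp (- (2 * PI * (Im tau * INR (S n))))) in *. assert (Pe : (0 < ee)%R) by apply exp_pos.
      apply Rle_trans with (INR (S n) * (M * ee))%R; [apply Rmult_le_compat_l; auto|].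
      rewrite <- Rmult_assoc. apply Rmult_le_compat_r; [lra|]. nra.
Qed.

Lemma wp_coef_summable (tau s : C) : (0 < Im s < Im tau)%R -> exp_summable (wp_coef tau) freq s.
Proof.
  intros Hs. destruct (wp_coef_bound tau) as [K [HK H]]; [lra|].
  apply (fourier_summable _ K (Im tau) 1); auto; intros n; apply H.
Qed.

(** Squaring doubles the decay at negative indices and hence the width of the strip. The series of
    [phi3] lives here: its argument is a sum of two points of the simple strip. *)
Lemma wp_coef_sq_summable (tau s : C) : (0 < Im s < 2 * Im tau)%R -> exp_summable (fun n => wp_coef tau n * wp_coef tau n) freq s.
Proof.
  intros Hs. destruct (wp_coef_bound tau) as [K [HK H]]; [lra|].
  apply (fourier_summable _ (K * K) (2 * Im tau) 2); auto; [apply Rmult_le_pos; auto| |]; intros n;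
    destruct (H n) as [H1 H2]; rewrite Cmod_mult.
  - replace (K * K * (1 + INR n) ^ 2)%R with ((K * (1 + INR n) ^ 1) * (K * (1 + INR n) ^ 1))%R by ring.
    apply Rmult_le_compat; auto using Cmod_ge_0.
  - replace (- (2 * PI * (2 * Im tau * INR n)))%R with (- (2 * PI * (Im tau * INR n)) + - (2 * PI * (Im tau * INR n)))%R by ring.
    rewrite exp_plus.
    match goal with |- (_ <= _ * (?e * ?e))%R =>
    replace (K * K * (1 + INR n) ^ 2 * (e * e))%R with ((K * (1 + INR n) ^ 1 * e) * (K * (1 + INR n) ^ 1 * e))%R by ring end.
    apply Rmult_le_compat; auto using Cmod_ge_0.
Qed.

(** Above the real axis [csc2] also expands, with coefficients [n]; added to [n u_n] they give
    [n / (1 - q^n)] at [n > 0], while the other tail gives [n u_n] at [- n]. *)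
Lemma wp_fourier (w1 tau sigma : C) (j : Z) : w1 <> 0 -> (0 < Im sigma < Im tau)%R ->
  wp w1 (tau * w1) (2 * w1 * (sigma + IZR j * tau)) * (2 * w1) ^ 2 =
  (2 * PI * Ci) ^ 2 * (E2 tau / 12 + exp_series (wp_coef tau) freq sigma).
Proof.
  intros Hw Hs. assert (Ht : (0 < Im tau)%R) by lra.
  rewrite wp_expansion; auto.
  - assert (A := exp_summable_asum _ _ _ (wp_coef_summable tau sigma Hs)).
    assert (E : exp_series (wp_coef tau) freq sigma = qnome sigma / (1 - qnome sigma) ^ 2 + (lambert_exp_series tau sigma + lambert_exp_series tau (- sigma))).
    { apply usum_unique.
      replace (qnome sigma / (1 - qnome sigma) ^ 2 + (lambert_exp_series tau sigma + lambert_exp_series tau (- sigma))) with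
       (wp_coef tau 0 * Cexp (freq 0 * sigma) + (qnome sigma / (1 - qnome sigma) ^ 2 + (lambert_exp_series tau sigma + lambert_exp_series tau (- sigma))))
       by (rewrite wp_coef_0; ring).
      apply (is_usum_Z (fun n => wp_coef tau n * Cexp (freq n * sigma))); [exact A|].
      eapply is_usum_ext; [|apply is_usum_plus; [apply is_usum_geom1, Cmod_qnome_lt_1; lra|
        apply is_usum_plus; apply asum_usum, exp_summable_asum, lambert_exp_summable; auto; rewrite ?im_opp; lra]].
      intros n. cbv beta. rewrite wp_coef_pos, wp_coef_neg by auto. rewrite !qnome_mult_INR.
      replace (Cexp (freq (Z.of_nat (S n)) * sigma)) with (qnome sigma ^ S n).
      - replace (Cexp (freq (- Z.of_nat (S n)) * sigma)) with (qnome (- sigma) ^ S n).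
        + rewrite pow_1. ring.
        + unfold qnome, freq. rewrite Cexp_pow, opp_IZR, RtoC_opp, INR_IZR_INZ. f_equal. ring.
      - unfold qnome, freq. rewrite Cexp_pow, INR_IZR_INZ. f_equal. ring. }
    rewrite E. unfold csc2. ring.
  - rewrite Rabs_pos_eq; lra.
  - intros m E. rewrite E in Hs. simpl in Hs. lra.
Qed.

(** * The half-period value of the zeta function *)

Lemma sum_telescope_Z (t : Z -> C) (N : nat) :
  sum_list (fun m : Z => t m - t (m - 1)%Z) (map (fun k => (Z.of_nat k - Z.of_nat N)%Z) (seq 0 (S (2 * N)))) =
  t (Z.of_nat N) - t (- Z.of_nat N - 1)%Z.
Proof.
  rewrite sum_list_map.
  assert (H : forall K, sum_list (fun k => t (Z.of_nat k - Z.of_nat N)%Z - t (Z.of_nat k - Z.of_nat N - 1)%Z) (seq 0 K) =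
    t (Z.of_nat K - Z.of_nat N - 1)%Z - t (- Z.of_nat N - 1)%Z).
  { induction K as [|K IH].
    - unfold sum_list; simpl. ring.
    - rewrite seq_S, sum_list_app, IH, Nat.add_0_l. unfold sum_list. cbn [fold_right].
      replace (Z.of_nat (S K) - Z.of_nat N - 1)%Z with (Z.of_nat K - Z.of_nat N)%Z by lia. ring. }
  rewrite H. do 2 f_equal. lia.
Qed.

(** An unconditional sum may be evaluated along symmetric intervals, where only two end terms
    survive and tend to zero. *)
Lemma is_usum_telescope (t : Z -> C) (K : R) : 
  (forall m, Cmod (t m) <= K * / (1 + Rabs (IZR m)))%R ->
  asum (fun m : Z => t m - t (m - 1)%Z) -> is_usum (fun m : Z => t m - t (m - 1)%Z) 0.
Proof.
  intros HK HA. destruct (asum_is_usum _ HA) as [s Hs].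
  replace (RtoC 0) with s; auto.
  apply Cmod_eq_0. apply Rle_antisym; [|apply Cmod_ge_0]. apply le_epsilon. intros eps Heps.
  rewrite is_usum_eps in Hs. destruct (Hs (eps / 2)%R) as [F0 HF0]; [lra|].
  destruct (INR_unbounded (Rmax (INR (fold_right max 0%nat (map Z.abs_nat F0))) (4 * Rabs K / eps))) as [N HN].
  assert (HN1 : (fold_right max 0 (map Z.abs_nat F0) < N)%nat).
  { apply INR_lt. eapply Rle_lt_trans; [apply Rmax_l|apply HN]. }
  assert (HN2 : (4 * Rabs K / eps < INR N)%R) by (eapply Rle_lt_trans; [apply Rmax_r|apply HN]).
  specialize (HF0 (map (fun k => (Z.of_nat k - Z.of_nat N)%Z) (seq 0 (S (2 * N))))).
  rewrite sum_telescope_Z in HF0.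
  assert (H1 : (Cmod (t (Z.of_nat N) - t (- Z.of_nat N - 1)%Z - s) < eps / 2)%R).
  { apply HF0.
    - apply FinFun.Injective_map_NoDup; [intros a b E; lia|apply seq_NoDup].
    - intros m Hm. apply in_map_iff. exists (Z.to_nat (m + Z.of_nat N)).
      assert (Hb : (Z.abs_nat m <= fold_right max 0 (map Z.abs_nat F0))%nat).
      { clear -Hm. induction F0 as [|y F0 IH]; simpl in *; [tauto|].
        destruct Hm as [->|Hm]; [lia|]. specialize (IH Hm). lia. }
      split; [lia|]. apply in_seq. lia. }
  assert (Small : forall m : Z, (INR N <= Rabs (IZR m))%R -> (Cmod (t m) <= eps / 4)%R).
  { intros m Hm. eapply Rle_trans; [apply HK|]. assert (P := Rabs_pos K). assert (Pn := pos_INR N).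
    apply (Rmult_lt_compat_r eps) in HN2; auto. replace (4 * Rabs K / eps * eps)%R with (4 * Rabs K)%R in HN2 by (field; lra).
    apply Rmult_le_reg_r with (1 + Rabs (IZR m))%R; [lra|].
    rewrite Rmult_assoc, Rinv_l, Rmult_1_r by lra. assert (X := Rle_abs K). nra. }
  assert (S1 : (Cmod (t (Z.of_nat N)) <= eps / 4)%R).
  { apply Small. rewrite <- INR_IZR_INZ. apply Rle_abs. }
  assert (S2 : (Cmod (t (- Z.of_nat N - 1)%Z) <= eps / 4)%R).
  { apply Small. rewrite <- abs_IZR, INR_IZR_INZ. apply IZR_le. lia. }
  replace s with (t (Z.of_nat N) + (- t (- Z.of_nat N - 1)%Z + - (t (Z.of_nat N) - t (- Z.of_nat N - 1)%Z - s))) by ring.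
  eapply Rle_trans; [apply Cmod_triangle|]. eapply Rle_trans; [apply Rplus_le_compat_l, Cmod_triangle|].
  rewrite !Cmod_opp. lra.
Qed.

Lemma asum_mult_sq {T : Type} (f g : T -> C) :
  asum (fun t => f t ^ 2) -> asum (fun t => g t ^ 2) -> asum (fun t => f t * g t).
Proof.
  intros Hf Hg. apply asum_le with (fun t => Cmod (f t ^ 2) + Cmod (g t ^ 2))%R.
  - intros t. rewrite Cmod_mult, !Cmod_pow. assert (A := Cmod_ge_0 (f t)). assert (B := Cmod_ge_0 (g t)).
    assert (0 <= (Cmod (f t) - Cmod (g t)) ^ 2)%R by apply pow2_ge_0. nra.
  - apply bsum_plus; assumption.
Qed.

Lemma is_usum_row_telescope (s : C) : nonint s ->
  is_usum (fun m : Z => / (s - IZR m) - / (s - IZR (m - 1))) 0.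
Proof.
  intros Hs.
  assert (Hi : (0 < Im Ci)%R) by (simpl; lra).
  destruct (lattice_lower Ci s Hi) as [c [Hc H]].
  apply (is_usum_telescope (fun m => / (s - IZR m)) (/ c)).
  - intros m. assert (A := Rabs_pos (IZR m)).
    specialize (H m 0%Z). rewrite Rabs_R0, Rplus_0_r, Cmult_0_l, Cplus_0_r in H.
    rewrite Cmod_inv by (apply nonint_sub, Hs). apply inv_le_inv_mult; auto; lra.
  - assert (HA := asum_row s Hs).
    apply asum_ext with (fun m : Z => / (s - IZR m) * / (s - IZR (m - 1))).
    + intros m. assert (N1 := nonint_sub s m Hs). assert (N2 := nonint_sub s (m - 1) Hs).
      rewrite minus_IZR, RtoC_minus in *. set (x := RtoC (IZR m)) in *. clearbody x.
      replace (s - (x - 1)) with (s - x + 1) in * by ring. set (y := s - x) in *. clearbody y. field. auto.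
    + apply asum_mult_sq.
      * eapply asum_ext; [|exact HA]. intros m. cbv beta. rewrite Cpow_inv; [reflexivity|apply nonint_sub, Hs].
      * apply (asum_comp _ (fun m => (m - 1)%Z)) in HA; [|intros; lia].
        eapply asum_ext; [|exact HA]. intros m. cbv beta. rewrite Cpow_inv; [reflexivity|apply nonint_sub, Hs].
Qed.

Lemma off_lattice_half (tau : C) : (0 < Im tau)%R -> off_lattice tau (1 / 2).
Proof.
  intros Ht m n E. assert (E2 := f_equal Im E). rewrite Im_shift in E2.
  assert (E3 : Im (1 / 2) = 0%R).
  { replace (1 / 2) with (RtoC (1 / 2)%R) by (apply RtoC_div; lra). reflexivity. }
  rewrite E3 in E2. simpl (Im (RtoC (IZR m))) in E2.
  assert (Hn : IZR n = 0%R) by nra. apply eq_IZR in Hn. subst n.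
  assert (E4 : RtoC (2 * IZR m - 1)%R = 0).
  { rewrite RtoC_minus, RtoC_mult. replace (RtoC (IZR m)) with (IZR m + 0 * tau) by ring. rewrite <- E. field. }
  apply RtoC_inj in E4. rewrite <- (mult_IZR 2), <- (minus_IZR _ 1) in E4. apply eq_IZR in E4. lia.
Qed.

(** Averaging over [w -> -w] makes the terms of first order telescope along each row, and
    leaves the Eisenstein summation of [w^(-2)]. *)
Lemma wzeta_half_period (w1 tau : C) : w1 <> 0 -> (0 < Im tau)%R ->
  wzeta w1 (tau * w1) w1 = RtoC PI ^ 2 * E2 tau / (12 * w1).
Proof.
  intros Hw Ht. assert (Ho := off_lattice_half tau Ht). set (s := 1 / 2) in *.
  set (g := restrict nonzero_pair (fun p => inv_lattice tau s p - inv_lattice tau 0 p + s * inv_lattice tau 0 p ^ 2)).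
  assert (Ag : asum g).
  { apply (asum_cubic tau s g (Cmod s ^ 2) Ht Ho); [apply pow_le, Cmod_ge_0|].
    intros [m n] Hp. unfold g. rewrite restrict_true by exact Hp.
    set (A := inv_lattice tau s (m, n)). set (B := inv_lattice tau 0 (m, n)).
    assert (E : A - B + s * B ^ 2 = s * s * (A * B) * B).
    { unfold A, B, inv_lattice. cbn [fst snd]. assert (N1 := off_lattice_sub tau s m n Ho).
      assert (N2 := lattice_neq_0 tau m n Ht Hp). set (w := IZR m + IZR n * tau) in *. clearbody w.
      field; auto. }
    rewrite E, !Cmod_mult. assert (PA := Cmod_ge_0 A). assert (PB := Cmod_ge_0 B). assert (Ps := Cmod_ge_0 s).
    simpl. rewrite Rmult_1_r, !Rmult_assoc.
    apply Rmult_le_compat_l; auto. apply Rmult_le_compat_l; auto.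
    apply Rmult_le_compat_l; auto. apply Rmult_le_compat_l; auto. lra. }
  assert (E : wzeta w1 (tau * w1) w1 = / (2 * w1) * (2 + usum g)).
  { unfold wzeta.
    assert (N2 : 2 * w1 <> 0) by (apply Cmult_neq_0; auto; intros E; apply RtoC_inj in E; lra).
    replace (/ (2 * w1) * (2 + usum g)) with (/ w1 + / (2 * w1) * usum g) by (field; auto).
    f_equal. apply usum_unique. eapply is_usum_ext; [|apply is_usum_scal, (asum_usum _ Ag)].
    intros [m n]. cbv beta. rewrite nonzero_part_restrict. unfold g.
    destruct (classic (nonzero_pair (m, n))) as [Hp|Hp]; [|rewrite !restrict_false by exact Hp; ring].
    rewrite !restrict_true by exact Hp. cbv zeta. rewrite lattice_pt_tau. unfold inv_lattice. cbn [fst snd].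
    assert (N1 := off_lattice_sub tau s m n Ho). assert (N3 := lattice_neq_0 tau m n Ht Hp).
    set (w := IZR m + IZR n * tau) in *. clearbody w.
    replace (w1 - 2 * w1 * w) with (2 * w1 * (s - w)) by (unfold s; field).
    unfold s in *. set (y := 1 / 2 - w) in *. clearbody y. field. repeat split; auto. }
  rewrite E. clear E.
  assert (Eg : is_usum (fun p : Z * Z => g (- fst p, - snd p)%Z) (usum g)).
  { apply (is_usum_reindex g (fun p : Z * Z => (- fst p, - snd p)%Z)); [| |apply asum_usum, Ag].
    - intros [a b] [c d] X. injection X. simpl. intros. f_equal; lia.
    - intros [a b] X. exfalso. apply (X (- a, - b)%Z). simpl. f_equal; lia. }
  (* Since [g] has the same sum along [w] and [-w], the sum of [h] is twice that of [g]. *)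
  set (h := fun p : Z * Z => g p + g (- fst p, - snd p)%Z).
  assert (Ah : asum h).
  { apply asum_plus; [exact Ag|]. apply (asum_comp g (fun p : Z * Z => (- fst p, - snd p)%Z)); [|exact Ag].
    intros [a b] [c d] X. injection X. simpl. intros. f_equal; lia. }
  assert (Eh : usum h = 2 * usum g).
  { apply usum_unique. replace (2 * usum g) with (usum g + usum g) by ring.
    apply is_usum_plus; [apply asum_usum, Ag|exact Eg]. }
  (* The [-4] belongs to row zero, where the origin is omitted: its telescoping term at [m = 0] is
     [/ (1/2) + / (1/2) = 4], and the full row sums to zero. *)
  assert (Rows := is_usum_rows h (fun n => restrict (fun n => n = 0%Z) (fun _ => -4) n + eis_row tau n) Ah).
  assert (Hh : forall m n, h (m, n) = restrict nonzero_pair (fun p => / (- (IZR n * tau) - s - IZR (m - 1)) - / (- (IZR n * tau) - s - IZR m)) (m, n)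
     + restrict nonzero_pair (fun p => inv_lattice tau 0 p ^ 2) (m, n)).
  { intros m n. unfold h. cbn [fst snd]. unfold g. destruct (classic (nonzero_pair (m, n))) as [Hp|Hp].
    - assert (Hp' : nonzero_pair (- m, - n)%Z).
      { intros X. apply Hp. injection X. intros. f_equal; lia. }
      rewrite !restrict_true by assumption. unfold inv_lattice. cbn [fst snd].
      rewrite !opp_IZR, !RtoC_opp.
      assert (N1 := off_lattice_sub tau s m n Ho). assert (N2 := off_lattice_sub tau s (- m) (- n) Ho).
      rewrite !opp_IZR, !RtoC_opp in N2. assert (N3 := lattice_neq_0 tau m n Ht Hp).
      rewrite minus_IZR, RtoC_minus.
      replace (s - (- IZR m + - IZR n * tau)) with (s + (IZR m + IZR n * tau)) in * by ring.
      replace (- (IZR n * tau) - s - (IZR m - 1)) with (s - (IZR m + IZR n * tau)) by (unfold s; field).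
      replace (- (IZR n * tau) - s - IZR m) with (- (s + (IZR m + IZR n * tau))) by ring.
      replace (0 - (- IZR m + - IZR n * tau)) with (IZR m + IZR n * tau) by ring.
      set (w := IZR m + IZR n * tau) in *. clearbody w. 
      set (A := s - w) in *. set (A' := s + w) in *. clearbody A A'. unfold s. field. auto.
    - assert (Hp' : ~ nonzero_pair (- m, - n)%Z).
      { intros X. apply Hp. intros Y. apply X. injection Y. intros. f_equal; lia. }
      rewrite !restrict_false by assumption. ring. }
  assert (Tel : forall n, is_usum (fun m => / (- (IZR n * tau) - s - IZR (m - 1)) - / (- (IZR n * tau) - s - IZR m)) 0).
  { intros n. replace (RtoC 0) with (- RtoC 0) by ring.
    eapply is_usum_ext; [|apply is_usum_opp, (is_usum_row_telescope (- (IZR n * tau) - s))].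
    - intros m. cbv beta. ring.
    - intros m X. apply (Ho (- m)%Z (- n)%Z). rewrite !opp_IZR, !RtoC_opp, <- X. ring. }
  assert (Hrow : forall n, is_usum (fun m => h (m, n)) (restrict (fun n => n = 0%Z) (fun _ => -4) n + eis_row tau n)).
  { intros n. eapply is_usum_ext; [intros m; symmetry; apply Hh|].
    apply is_usum_plus; [|apply is_usum_eis_row, Ht].
    destruct (Z.eq_dec n 0) as [->|Hn].
    - rewrite restrict_true by reflexivity.
      assert (T := Tel 0%Z). assert (T1 := is_usum_single (fun m => / (- (0 * tau) - s - IZR (m - 1)) - / (- (0 * tau) - s - IZR m)) 0%Z).
      cbv beta in T1.
      replace (RtoC (-4)) with (0 - (/ (- (0 * tau) - s - IZR (0 - 1)) - / (- (0 * tau) - s - 0))).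
      + eapply is_usum_ext; [|apply (is_usum_minus _ _ _ _ T T1)]. intros m. cbv beta.
        unfold restrict, nonzero_pair. destruct (excluded_middle_informative (m = 0%Z)) as [X|X],
          (excluded_middle_informative ((m, 0%Z) <> (0%Z, 0%Z))) as [Y|Y]; try ring.
        * exfalso. apply Y. congruence.
        * exfalso. apply Y. congruence.
      + simpl (0 - 1)%Z. unfold s. 
        replace (- (0 * tau) - 1 / 2 - -1) with (1 / 2) by field.
        replace (- (0 * tau) - 1 / 2 - 0) with (- (1 / 2)) by field. field.
    - rewrite restrict_false by exact Hn. eapply is_usum_ext; [|apply (Tel n)].
      intros m. cbv beta. rewrite restrict_true; [reflexivity|unfold nonzero_pair; congruence]. }
  specialize (Rows Hrow).
  assert (F := is_usum_plus _ _ _ _ (is_usum_single (fun _ => RtoC (-4)) 0%Z) (is_usum_eis_rows tau Ht)).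
  assert (Ev := is_usum_unique _ _ _ Rows F). rewrite Eh in Ev.
  replace (usum g) with (/ 2 * (2 * usum g)) by field. rewrite Ev.
  replace ((2 * PI * Ci) ^ 2) with (4 * RtoC PI ^ 2 * (Ci * Ci)) by ring. rewrite Ci_sq. field. exact Hw.
Qed.

(** * Continuously differentiable functions of a complex variable *)

Lemma ccont_const (a x : C) : ccont (fun _ => a) x.
Proof.
  intros eps Heps. exists 1%R. split; [lra|]. intros y _. replace (a - a) with (RtoC 0) by ring. rewrite Cmod_0; auto.
Qed.

Lemma ccont_id (x : C) : ccont (fun z => z) x.
Proof. intros eps Heps. exists eps. auto. Qed.

Lemma ccont_plus (f g : C -> C) (x : C) : ccont f x -> ccont g x -> ccont (fun z => f z + g z) x.
Proof.
  intros Hf Hg eps Heps. destruct (Hf (eps / 2)%R) as [d1 [Hd1 H1]]; [lra|].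
  destruct (Hg (eps / 2)%R) as [d2 [Hd2 H2]]; [lra|].
  exists (Rmin d1 d2). split; [apply Rmin_pos; auto|]. intros y Hy.
  specialize (H1 y (Rlt_le_trans _ _ _ Hy (Rmin_l _ _))). specialize (H2 y (Rlt_le_trans _ _ _ Hy (Rmin_r _ _))).
  replace (f y + g y - (f x + g x)) with ((f y - f x) + (g y - g x)) by ring.
  eapply Rle_lt_trans; [apply Cmod_triangle|]. lra.
Qed.

Lemma ccont_mult (f g : C -> C) (x : C) : ccont f x -> ccont g x -> ccont (fun z => f z * g z) x.
Proof.
  intros Hf Hg eps Heps. assert (Pf := Cmod_ge_0 (f x)). assert (Pg := Cmod_ge_0 (g x)).
  set (M := (1 + Cmod (f x) + Cmod (g x))%R). assert (HM : (1 <= M)%R) by (unfold M; lra).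
  set (e := Rmin 1 (eps / (2 * M))).
  assert (He : (0 < e)%R) by (apply Rmin_pos; [lra|apply Rdiv_lt_0_compat; lra]).
  destruct (Hf e He) as [d1 [Hd1 H1]]. destruct (Hg e He) as [d2 [Hd2 H2]].
  exists (Rmin d1 d2). split; [apply Rmin_pos; auto|]. intros y Hy.
  specialize (H1 y (Rlt_le_trans _ _ _ Hy (Rmin_l _ _))). specialize (H2 y (Rlt_le_trans _ _ _ Hy (Rmin_r _ _))).
  assert (E1 : (e <= 1)%R) by apply Rmin_l. assert (E2 : (e <= eps / (2 * M))%R) by apply Rmin_r.
  assert (E3 : (e * M <= eps / 2)%R).
  { apply Rmult_le_compat_r with (r := M) in E2; [|lra]. replace (eps / (2 * M) * M)%R with (eps / 2)%R in E2 by (field; lra). auto. }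
  replace (f y * g y - f x * g x) with ((f y - f x) * (g y - g x) + ((f y - f x) * g x + f x * (g y - g x))) by ring.
  eapply Rle_lt_trans; [apply Cmod_triangle|].
  assert (T := Cmod_triangle ((f y - f x) * g x) (f x * (g y - g x))). rewrite !Cmod_mult in *.
  set (a := Cmod (f y - f x)) in *. set (b := Cmod (g y - g x)) in *.
  assert (Pa : (0 <= a)%R) by apply Cmod_ge_0. assert (Pb : (0 <= b)%R) by apply Cmod_ge_0.
  assert (A1 : (a * b <= e * 1)%R) by (apply Rmult_le_compat; lra).
  assert (A2 : (a * Cmod (g x) <= e * Cmod (g x))%R) by (apply Rmult_le_compat_r; lra).
  assert (A3 : (Cmod (f x) * b <= Cmod (f x) * e)%R) by (apply Rmult_le_compat_l; lra).
  unfold M in E3. lra.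
Qed.

Lemma ccont_comp (f g : C -> C) (x : C) : ccont f (g x) -> ccont g x -> ccont (fun z => f (g z)) x.
Proof.
  intros Hf Hg eps Heps. destruct (Hf eps Heps) as [d1 [Hd1 H1]]. destruct (Hg d1 Hd1) as [d2 [Hd2 H2]].
  exists d2. split; auto.
Qed.

Lemma ccont_ext_near (f g : C -> C) (x : C) (d : R) : (0 < d)%R ->
  (forall y, (Cmod (y - x) < d)%R -> f y = g y) -> ccont f x -> ccont g x.
Proof.
  intros Hd E H eps Heps. destruct (H eps Heps) as [e [He HH]].
  exists (Rmin d e). split; [apply Rmin_pos; auto|]. intros y Hy.
  rewrite <- (E y (Rlt_le_trans _ _ _ Hy (Rmin_l _ _))), <- (E x).
  - apply HH. apply (Rlt_le_trans _ _ _ Hy (Rmin_r _ _)).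
  - replace (x - x) with (RtoC 0) by ring. rewrite Cmod_0; auto.
Qed.

Lemma ccont_inv (f : C -> C) (x : C) : f x <> 0 -> ccont f x -> ccont (fun z => / f z) x.
Proof.
  intros N Hf eps Heps. assert (P : (0 < Cmod (f x))%R) by (apply Cmod_gt_0; auto).
  set (m := Cmod (f x)) in *.
  set (e := Rmin (m / 2) (eps * (m * m / 2))%R).
  assert (Pmm : (0 < m * m)%R) by (apply Rmult_lt_0_compat; auto).
  assert (He : (0 < e)%R) by (apply Rmin_pos; [lra|apply Rmult_lt_0_compat; lra]).
  destruct (Hf e He) as [d [Hd H]]. exists d. split; auto. intros y Hy. specialize (H y Hy).
  assert (E1 : (e <= m / 2)%R) by apply Rmin_l. assert (E2 : (e <= eps * (m * m / 2))%R) by apply Rmin_r.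
  assert (L : (m / 2 < Cmod (f y))%R).
  { assert (T : (m <= Cmod (f y) + Cmod (f y - f x))%R); [|lra].
    unfold m. replace (f x) with (f y + - (f y - f x)) at 1 by ring. rewrite <- (Cmod_opp (f y - f x)). apply Cmod_triangle. }
  assert (Ny : f y <> 0) by (apply Cmod_gt_0; lra).
  replace (/ f y - / f x) with (- (f y - f x) * (/ f y * / f x)) by (field; auto).
  rewrite !Cmod_mult, Cmod_opp, !Cmod_inv by auto. fold m.
  apply Rlt_le_trans with ((eps * (m * m / 2)) * (/ Cmod (f y) * / m))%R.
  - apply Rmult_lt_compat_r; [|lra]. apply Rmult_lt_0_compat; apply Rinv_0_lt_compat; lra.
  - apply Rle_trans with ((eps * (m * m / 2)) * (/ (m / 2) * / m))%R.
    + apply Rmult_le_compat_l; [apply Rlt_le, Rmult_lt_0_compat; lra|].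
      apply Rmult_le_compat_r; [apply Rlt_le, Rinv_0_lt_compat; lra|]. apply Rinv_le_contravar; lra.
    + right. field. lra.
Qed.

(** Differentiability as a continuous slope function, which turns the product and chain rules into
    algebra. *)
Lemma cderiv_caratheodory (f : C -> C) (x l : C) :
  cderiv f x l <-> exists phi, ccont phi x /\ phi x = l /\ forall y, f y - f x = (y - x) * phi y.
Proof.
  split.
  - intros H. exists (fun y => if eqdec y x then l else (f y - f x) / (y - x)). split; [|split].
    + intros eps Heps. destruct (H (eps / 2)%R) as [d [Hd HH]]; [lra|]. exists d. split; auto. intros y Hy.
      destruct (eqdec x x) as [_|X]; [|tauto]. destruct (eqdec y x) as [E|E].
      * replace (l - l) with (RtoC 0) by ring. rewrite Cmod_0; auto.
      * assert (N : y - x <> 0).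
        { intros Z. apply E. replace y with (y - x + x) by ring. rewrite Z. ring. }
        replace ((f y - f x) / (y - x) - l) with ((f y - f x - (y - x) * l) * / (y - x)) by (field; auto).
        rewrite Cmod_mult, Cmod_inv by auto. specialize (HH y Hy).
        assert (P : (0 < Cmod (y - x))%R) by (apply Cmod_gt_0; auto).
        apply Rle_lt_trans with (eps / 2 * Cmod (y - x) * / Cmod (y - x))%R.
        -- apply Rmult_le_compat_r; auto. apply Rlt_le, Rinv_0_lt_compat; auto.
        -- rewrite Rmult_assoc, Rinv_r by lra. lra.
    + destruct (eqdec x x); tauto.
    + intros y. destruct (eqdec y x) as [->|E]; [ring|]. field.
      intros Z. apply E. replace y with (y - x + x) by ring. rewrite Z. ring.
  - intros [phi [Hc [<- E]]] eps Heps. destruct (Hc eps Heps) as [d [Hd HH]]. exists d. split; auto.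
    intros y Hy. rewrite E. replace ((y - x) * phi y - (y - x) * phi x) with ((phi y - phi x) * (y - x)) by ring.
    rewrite Cmod_mult. apply Rmult_le_compat_r; [apply Cmod_ge_0|]. apply Rlt_le, HH, Hy.
Qed.

Lemma cderiv_mult (f g : C -> C) (x a b : C) : cderiv f x a -> cderiv g x b ->
  cderiv (fun z => f z * g z) x (a * g x + f x * b).
Proof.
  intros Hf Hg. assert (Cg := cderiv_ccont _ _ _ Hg). apply cderiv_caratheodory in Hf. apply cderiv_caratheodory in Hg.
  destruct Hf as [p [Cp [<- Ep]]]. destruct Hg as [q [Cq [<- Eq]]].
  apply cderiv_caratheodory. exists (fun y => p y * g y + f x * q y). split; [|split; auto].
  - apply ccont_plus; apply ccont_mult; auto using ccont_const.
  - intros y. replace (f y * g y - f x * g x) with ((f y - f x) * g y + f x * (g y - g x)) by ring.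
    rewrite Ep, Eq. ring.
Qed.

Lemma cderiv_plus (f g : C -> C) (x a b : C) : cderiv f x a -> cderiv g x b ->
  cderiv (fun z => f z + g z) x (a + b).
Proof.
  intros Hf Hg. apply cderiv_caratheodory in Hf. apply cderiv_caratheodory in Hg.
  destruct Hf as [p [Cp [<- Ep]]]. destruct Hg as [q [Cq [<- Eq]]].
  apply cderiv_caratheodory. exists (fun y => p y + q y). split; [|split; auto].
  - apply ccont_plus; auto.
  - intros y. replace (f y + g y - (f x + g x)) with ((f y - f x) + (g y - g x)) by ring.
    rewrite Ep, Eq. ring.
Qed.

Lemma cderiv_comp (f g : C -> C) (x a b : C) : cderiv f (g x) a -> cderiv g x b ->
  cderiv (fun z => f (g z)) x (a * b).
Proof.
  intros Hf Hg. assert (Cg := cderiv_ccont _ _ _ Hg). apply cderiv_caratheodory in Hf. apply cderiv_caratheodory in Hg.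
  destruct Hf as [p [Cp [<- Ep]]]. destruct Hg as [q [Cq [<- Eq]]].
  apply cderiv_caratheodory. exists (fun y => p (g y) * q y). split; [|split; auto].
  - apply ccont_mult; auto. apply ccont_comp; auto.
  - intros y. rewrite Ep, Eq. ring.
Qed.

Lemma cderiv_inv_id (x : C) : x <> 0 -> cderiv (fun z => / z) x (- / x ^ 2).
Proof.
  intros N. assert (P : (0 < Cmod x)%R) by (apply Cmod_gt_0; auto).
  apply cderiv_ext_near with (f := fun z => / z) (d := Cmod x); auto.
  intros eps Heps.
  destruct (ccont_inv (fun z => z) x N (ccont_id x) (eps * Cmod x)%R) as [d [Hd H]]; [apply Rmult_lt_0_compat; auto|].
  exists (Rmin d (Cmod x)). split; [apply Rmin_pos; auto|]. intros y Hy.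
  specialize (H y (Rlt_le_trans _ _ _ Hy (Rmin_l _ _))). cbv beta in H.
  assert (Hy2 := Rlt_le_trans _ _ _ Hy (Rmin_r _ _)).
  assert (Ny : y <> 0).
  { intros ->. replace (0 - x) with (- x) in Hy2 by ring. rewrite Cmod_opp in Hy2. lra. }
  replace (/ y - / x - (y - x) * - / x ^ 2) with ((/ y - / x) * - / x * (y - x)) by (field; auto).
  rewrite !Cmod_mult, Cmod_opp, Cmod_inv by auto.
  apply Rmult_le_compat_r; [apply Cmod_ge_0|].
  apply Rmult_le_reg_r with (Cmod x); auto. rewrite Rmult_assoc, Rinv_l, Rmult_1_r by lra. lra.
Qed.

(** Continuity of the derivative is what differentiation under the circle integral requires;
    carrying it along avoids deriving it from holomorphy. *)
Definition C1 (f : C -> C) (x : C) : Prop :=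
  exists (f' : C -> C) (d : R), (0 < d)%R /\
    (forall y, (Cmod (y - x) < d)%R -> cderiv f y (f' y)) /\ ccont f' x.

Lemma C1_cderiv (f : C -> C) (x : C) : C1 f x -> exists l, cderiv f x l.
Proof.
  intros [f' [d [Hd [H _]]]]. exists (f' x). apply H.
  replace (x - x) with (RtoC 0) by ring. rewrite Cmod_0; auto.
Qed.

Lemma C1_ccont (f : C -> C) (x : C) : C1 f x -> ccont f x.
Proof. intros H. destruct (C1_cderiv f x H) as [l Hl]. exact (cderiv_ccont _ _ _ Hl). Qed.

Lemma C1_const (a x : C) : C1 (fun _ => a) x.
Proof.
  exists (fun _ => 0), 1%R. split; [lra|]. split; [|apply ccont_const].
  intros y _. apply cderiv_caratheodory. exists (fun _ => 0). split; [apply ccont_const|]. split; auto. intros; ring.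
Qed.

Lemma C1_id (x : C) : C1 (fun z => z) x.
Proof.
  exists (fun _ => 1), 1%R. split; [lra|]. split; [|apply ccont_const].
  intros y _. apply cderiv_caratheodory. exists (fun _ => 1). split; [apply ccont_const|]. split; auto. intros; ring.
Qed.

Lemma C1_plus (f g : C -> C) (x : C) : C1 f x -> C1 g x -> C1 (fun z => f z + g z) x.
Proof.
  intros [f' [d1 [Hd1 [H1 C1]]]] [g' [d2 [Hd2 [H2 C2]]]].
  exists (fun y => f' y + g' y), (Rmin d1 d2). split; [apply Rmin_pos; auto|]. split.
  - intros y Hy. apply cderiv_plus; [apply H1|apply H2]; eapply Rlt_le_trans; try exact Hy; [apply Rmin_l|apply Rmin_r].
  - apply ccont_plus; auto.
Qed.

Lemma C1_mult (f g : C -> C) (x : C) : C1 f x -> C1 g x -> C1 (fun z => f z * g z) x.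
Proof.
  intros Hf Hg. assert (Cf := C1_ccont f x Hf). assert (Cg := C1_ccont g x Hg).
  destruct Hf as [f' [d1 [Hd1 [H1 C1]]]]. destruct Hg as [g' [d2 [Hd2 [H2 C2]]]].
  exists (fun y => f' y * g y + f y * g' y), (Rmin d1 d2). split; [apply Rmin_pos; auto|]. split.
  - intros y Hy. apply cderiv_mult; [apply H1|apply H2]; eapply Rlt_le_trans; try exact Hy; [apply Rmin_l|apply Rmin_r].
  - apply ccont_plus; apply ccont_mult; auto.
Qed.

Lemma C1_comp (f g : C -> C) (x : C) : C1 f (g x) -> C1 g x -> C1 (fun z => f (g z)) x.
Proof.
  intros Hf Hg. assert (Cg := C1_ccont g x Hg).
  destruct Hf as [f' [d1 [Hd1 [H1 C1]]]]. destruct Hg as [g' [d2 [Hd2 [H2 C2]]]].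
  destruct (Cg d1 Hd1) as [d3 [Hd3 H3]].
  exists (fun y => f' (g y) * g' y), (Rmin d2 d3). split; [apply Rmin_pos; auto|]. split.
  - intros y Hy. apply cderiv_comp.
    + apply H1, H3. eapply Rlt_le_trans; [exact Hy|apply Rmin_r].
    + apply H2. eapply Rlt_le_trans; [exact Hy|apply Rmin_l].
  - apply ccont_mult; auto. apply ccont_comp; auto.
Qed.

Lemma C1_inv_id (x : C) : x <> 0 -> C1 (fun z => / z) x.
Proof.
  intros N. exists (fun z => - (1) * (/ z * / z)), (Cmod x). split; [apply Cmod_gt_0; auto|]. split.
  - intros y Hy. assert (Ny : y <> 0).
    { intros ->. replace (0 - x) with (- x) in Hy by ring. rewrite Cmod_opp in Hy. lra. }
    replace (- (1) * (/ y * / y)) with (- / y ^ 2) by (field; auto). apply cderiv_inv_id, Ny.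
  - apply ccont_mult; [apply ccont_const|]. apply ccont_mult; apply ccont_inv; auto using ccont_id.
Qed.

Lemma C1_inv (f : C -> C) (x : C) : f x <> 0 -> C1 f x -> C1 (fun z => / f z) x.
Proof. intros N H. apply (C1_comp (fun z => / z) f); auto. apply C1_inv_id, N. Qed.

Lemma C1_ext_near (f g : C -> C) (x : C) (d : R) : (0 < d)%R ->
  (forall y, (Cmod (y - x) < d)%R -> f y = g y) -> C1 f x -> C1 g x.
Proof.
  intros Hd E [f' [e [He [H Hc]]]]. exists f', (Rmin (d / 2) e).
  split; [apply Rmin_pos; lra|]. split; auto. intros y Hy.
  apply cderiv_ext_near with (f := f) (d := (d / 2)%R); [lra| |].
  - intros z Hz. apply E. replace (z - x) with ((z - y) + (y - x)) by ring.
    eapply Rle_lt_trans; [apply Cmod_triangle|]. assert (X := Rlt_le_trans _ _ _ Hy (Rmin_l _ _)). lra.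
  - apply H. eapply Rlt_le_trans; [exact Hy|apply Rmin_r].
Qed.

Lemma exp_series_C1 {T : Type} (c mu : T -> C) z : exp_summable c mu z -> C1 (exp_series c mu) z.
Proof.
  intros H. destruct (exp_summable_near c mu z H) as [d [Hd Hn]].
  exists (exp_series (fun t => c t * mu t) mu), d. split; auto. split.
  - intros y Hy. apply exp_series_cderiv, Hn, Hy.
  - apply (cderiv_ccont _ _ _ (exp_series_cderiv _ _ _ (exp_summable_deriv _ _ _ H))).
Qed.

Lemma cderiv_Cexp (z : C) : cderiv Cexp z (Cexp z).
Proof.
  apply (cderiv_quadratic _ _ _ (Cmod (Cexp z) * (8 * exp 1)) 1 Rlt_0_1). intros y Hy.
    replace (Cexp y - Cexp z - (y - z) * Cexp z) with (Cexp z * (Cexp (y - z) - 1 - (y - z))).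
    - rewrite Cmod_mult, Rmult_assoc. apply Rmult_le_compat_l; [apply Cmod_ge_0|].
      eapply Rle_trans; [apply Cexp_Taylor2|].
      replace (8 * exp 1 * Cmod (y - z) ^ 2)%R with (8 * Cmod (y - z) ^ 2 * exp 1)%R by ring.
      apply Rmult_le_compat_l; [|apply exp_le; lra]. apply Rmult_le_pos; [lra|apply pow2_ge_0].
    - replace (Cexp y) with (Cexp z * Cexp (y - z)) by (rewrite <- Cexp_add; f_equal; ring). ring.
Qed.

Lemma C1_Cexp (z : C) : C1 Cexp z.
Proof.
  exists Cexp, 1%R. split; [lra|]. split; [intros; apply cderiv_Cexp|]. apply (cderiv_ccont _ _ _ (cderiv_Cexp z)).
Qed.

Lemma C1_csc2 (s : C) : nonint s -> C1 csc2 s.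
Proof.
  intros Hs. assert (N := qnome_neq_1 s Hs).
  assert (Q : C1 qnome s).
  { unfold qnome. apply (C1_comp Cexp (fun z => 2 * PI * Ci * z)); [apply C1_Cexp|].
    apply C1_mult; [apply C1_const|apply C1_id]. }
  unfold csc2, Cdiv. apply C1_mult; [apply C1_const|]. apply C1_mult; auto.
  apply (C1_inv (fun z => (1 - qnome z) ^ 2)).
  - apply Cpow_nz, N.
  - assert (D : C1 (fun z => 1 - qnome z) s).
    { apply C1_ext_near with (f := fun z => 1 + -1 * qnome z) (d := 1%R); [lra| |].
      - intros y _. ring.
      - apply C1_plus; [apply C1_const|]. apply C1_mult; [apply C1_const|auto]. }
    apply C1_ext_near with (f := fun z => (1 - qnome z) * (1 - qnome z)) (d := 1%R); [lra| |].
    + intros y _. ring.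
    + apply C1_mult; auto.
Qed.

Lemma off_lattice_near (tau s : C) : (0 < Im tau)%R -> off_lattice tau s ->
  exists d, (0 < d)%R /\ forall y, (Cmod (y - s) < d)%R -> off_lattice tau y.
Proof.
  intros Ht Hs. destruct (lattice_lower tau s Ht) as [c [Hc H]]. exists c. split; auto.
  intros y Hy m n E. specialize (H m n (Hs m n)). rewrite <- E in H.
  replace (s - y) with (- (y - s)) in H by ring. rewrite Cmod_opp in H.
  assert (A := Rabs_pos (IZR m)). assert (B := Rabs_pos (IZR n)). nra.
Qed.

Lemma floor_strip (y h : R) : (0 < h)%R -> exists j : Z, (0 <= y - IZR j * h < h)%R.
Proof.
  intros Hh. exists (up (y / h) - 1)%Z. destruct (archimed (y / h)) as [H1 H2]. rewrite minus_IZR.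
  assert (E : (y / h * h = y)%R) by (field; lra).
  apply Rmult_lt_compat_r with (r := h) in H1; auto. apply Rmult_le_compat_r with (r := h) in H2; [|lra].
  rewrite E in H1. replace ((IZR (up (y / h)) - y / h) * h)%R with (IZR (up (y / h)) * h - y / h * h)%R in H2 by ring.
  rewrite E in H2. lra.
Qed.

Lemma C1_wp (w1 tau z : C) : w1 <> 0 -> (0 < Im tau)%R -> off_lattice tau (z / (2 * w1)) -> C1 (wp w1 (tau * w1)) z.
Proof.
  intros Hw Ht Hs.
  assert (N2 : 2 * w1 <> 0) by (apply Cmult_neq_0; auto; intros E; apply RtoC_inj in E; lra).
  destruct (off_lattice_near tau _ Ht Hs) as [d [Hd Hn]].
  (* This puts the reduced point in [0 <= Im < Im tau], so that a whole neighbourhood of it stays in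
     the range [Rabs (Im sigma) < Im tau] of [wp_expansion]. *)
  destruct (floor_strip (Im (z / (2 * w1))) (Im tau) Ht) as [j Hj].
  set (sg := fun y => y / (2 * w1) - IZR j * tau).
  assert (Hsg : Im (sg z) = (Im (z / (2 * w1)) - IZR j * Im tau)%R).
  { unfold sg. replace (z / (2 * w1) - IZR j * tau) with (z / (2 * w1) + RtoC (- IZR j)%R * tau) by (rewrite RtoC_opp; ring).
    rewrite Im_shift. ring. }
  assert (Nsg : forall y, off_lattice tau (y / (2 * w1)) -> nonint (sg y)).
  { intros y Hy m E. apply (Hy m j). rewrite <- E. unfold sg. ring. }
  assert (Csg : forall y, C1 sg y).
  { intros y. unfold sg. apply C1_ext_near with (f := fun y => / (2 * w1) * y + - (IZR j * tau)) (d := 1%R); [lra| |].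
    - intros u _. unfold Cdiv. ring.
    - apply C1_plus; [apply C1_mult; [apply C1_const|apply C1_id]|apply C1_const]. }
  set (e := Rmin d (Im tau - Im (sg z))).
  assert (He : (0 < e)%R) by (apply Rmin_pos; auto; rewrite Hsg; lra).
  assert (P2 : (0 < Cmod (2 * w1))%R) by (apply Cmod_gt_0; auto).
  apply C1_ext_near with (f := fun y => / (2 * w1) ^ 2 * (csc2 (sg y) + (2 * PI * Ci) ^ 2 *
      (E2 tau / 12 + (lambert_exp_series tau (sg y) + lambert_exp_series tau (- sg y))))) (d := (e * Cmod (2 * w1))%R).
  - apply Rmult_lt_0_compat; auto.
  - intros y Hy.
    assert (Hy2 : (Cmod (y / (2 * w1) - z / (2 * w1)) < e)%R).
    { replace (y / (2 * w1) - z / (2 * w1)) with ((y - z) * / (2 * w1)) by (field; auto).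
      rewrite Cmod_mult, Cmod_inv by auto. apply Rmult_lt_reg_r with (Cmod (2 * w1)); auto.
      rewrite Rmult_assoc, Rinv_l, Rmult_1_r by lra. auto. }
    assert (Hoff : off_lattice tau (y / (2 * w1))) by (apply Hn; eapply Rlt_le_trans; [exact Hy2|apply Rmin_l]).
    assert (Him : (Rabs (Im (sg y)) < Im tau)%R).
    { assert (T : (Rabs (Im (sg y) - Im (sg z)) < e)%R).
      { eapply Rle_lt_trans; [|exact Hy2]. replace (y / (2 * w1) - z / (2 * w1)) with (sg y - sg z) by (unfold sg; ring).
        eapply Rle_trans; [|apply im_le_Cmod]. right. f_equal. }
      assert (X := Rmin_r d (Im tau - Im (sg z))). fold e in X. rewrite Hsg in *. apply Rabs_def2 in T.
      apply Rabs_def1; lra. }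
    rewrite <- (wp_expansion w1 tau (sg y) j Hw Ht Him (Nsg y Hoff)).
    replace (2 * w1 * (sg y + IZR j * tau)) with y by (unfold sg; field; auto). field. auto.
  - assert (Q1 : C1 (fun y => lambert_exp_series tau (sg y)) z).
    { apply (C1_comp (lambert_exp_series tau) sg); auto. apply exp_series_C1, lambert_exp_summable; auto. rewrite Hsg. lra. }
    assert (Q2 : C1 (fun y => lambert_exp_series tau (- sg y)) z).
    { apply (C1_comp (lambert_exp_series tau) (fun y => - sg y)).
      - apply exp_series_C1, lambert_exp_summable; auto. rewrite im_opp, Hsg. lra.
      - apply C1_ext_near with (f := fun y => -1 * sg y) (d := 1%R); [lra| |].
        + intros u _. ring.
        + apply C1_mult; [apply C1_const|apply Csg]. }
    assert (Q0 : C1 (fun y => csc2 (sg y)) z) by (apply (C1_comp csc2 sg); auto; apply C1_csc2, Nsg, Hs).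
    apply C1_mult; [apply C1_const|]. apply C1_plus; auto.
    apply C1_mult; [apply C1_const|]. apply C1_plus; [apply C1_const|]. apply C1_plus; auto.
Qed.

(** * Residues *)

Lemma cderiv_Re (F : C -> C) (t : R) (l : C) :
  cderiv F (RtoC t) l -> is_derive (K := R_AbsRing) (V := R_NormedModule) (fun u : R => Re (F (RtoC u))) t (Re l).
Proof.
  intros H. split; [apply is_linear_scal_l|].
  intros x' Hx' eps.
  apply (is_filter_lim_locally_unique (K := R_AbsRing) (V := AbsRing_NormedModule R_AbsRing)) in Hx'. subst x'.
  destruct (H eps (cond_pos eps)) as [del [Hd HH]].
  exists (mkposreal del Hd). intros y Hy.
  assert (Hy' : (Cmod (RtoC y - RtoC t) < del)%R).
  { rewrite <- RtoC_minus, Cmod_R. exact Hy. }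
  specialize (HH (RtoC y) Hy'). rewrite <- RtoC_minus, Cmod_R in HH.
  change (Rabs (Re (F y) - Re (F t) - (y - t) * Re l) <= eps * Rabs (y - t))%R.
  eapply Rle_trans; [|exact HH].
  replace (Re (F y) - Re (F t) - (y - t) * Re l)%R with (Re (F y - F t - RtoC (y - t) * l)).
  - apply re_le_Cmod.
  - unfold Re, Cminus, Cplus, Copp, Cmult, RtoC; simpl. ring.
Qed.

Lemma C1_C_derive (f : C -> C) (x : C) : C1 f x -> cderiv f x (C_derive f x) /\ ccont (C_derive f) x.
Proof.
  intros [f' [d [Hd [H Hc]]]].
  assert (E : forall y, (Cmod (y - x) < d)%R -> f' y = C_derive f y).
  { intros y Hy. symmetry. apply cderiv_C_derive, H, Hy. }
  assert (Hx : (Cmod (x - x) < d)%R) by (replace (x - x) with (RtoC 0) by ring; rewrite Cmod_0; auto).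
  split.
  - rewrite <- (E x Hx). apply H, Hx.
  - apply (ccont_ext_near f' _ x d Hd E Hc).
Qed.

Lemma cis_lipschitz (v y : R) : (Cmod (Cexp (Ci * RtoC v) - Cexp (Ci * RtoC y)) <= 2 * Rabs (v - y))%R.
Proof.
  assert (E : forall u : R, Cexp (Ci * RtoC u) = (cos u, sin u)).
  { intros u. unfold Cexp. replace (Re (Ci * RtoC u)) with 0%R by (unfold Re, Ci, Cmult, RtoC; simpl; ring).
    replace (Im (Ci * RtoC u)) with u by (unfold Im, Ci, Cmult, RtoC; simpl; ring).
    rewrite exp_0. f_equal; ring. }
  rewrite !E. replace ((cos v, sin v) - (cos y, sin y)) with ((cos v - cos y)%R, (sin v - sin y)%R) by reflexivity.
  eapply Rle_trans; [apply Cmod_le_abs|].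
  destruct (MVT_abs cos (fun x => - sin x)%R y v) as [c [Hc _]].
  { intros c _. apply derivable_pt_lim_cos. }
  destruct (MVT_abs sin cos y v) as [d [Hd _]].
  { intros d _. apply derivable_pt_lim_sin. }
  rewrite Hc, Hd.
  assert (A : (Rabs (- sin c) <= 1)%R) by (rewrite Rabs_Ropp; apply Rabs_le; assert (S := SIN_bound c); lra).
  assert (B : (Rabs (cos d) <= 1)%R) by (apply Rabs_le; assert (S := COS_bound d); lra).
  assert (P := Rabs_pos (v - y)). nra.
Qed.

Lemma Cmod_cis (t : R) : Cmod (Cexp (Ci * RtoC t)) = 1%R.
Proof.
  rewrite Cmod_Cexp. replace (Re (Ci * RtoC t)) with 0%R by (unfold Re, Ci, Cmult, RtoC; simpl; ring). apply exp_0.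
Qed.

(** * Means over small circles *)

Section circle.

Variables (G : C -> C) (r0 : R) (v : C).
Hypothesis HG : forall z, (0 < Cmod z < r0)%R -> C1 G z.
Hypothesis Hv : forall eps : R, (0 < eps)%R -> exists del : R, (0 < del)%R /\
  forall z, (0 < Cmod z < del)%R -> (Cmod (G z - v) < eps)%R.

Let f (u t : R) : R := Re (G (RtoC u * Cexp (Ci * RtoC t))).
Let D (u t : R) : R := Re (C_derive G (RtoC u * Cexp (Ci * RtoC t)) * Cexp (Ci * RtoC t)).

Lemma circle_pt (u t : R) : (0 < u)%R -> Cmod (RtoC u * Cexp (Ci * RtoC t)) = u.
Proof using Type. intros Hu. rewrite Cmod_mult, Cmod_cis, Cmod_RtoC_nonneg by lra. ring. Qed.

Lemma circle_derive_radial (u t : R) : (0 < u < r0)%R -> is_derive (fun u => f u t) u (D u t).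
Proof using HG.
  intros Hu. unfold f, D.
  apply (cderiv_Re (fun z => G (z * Cexp (Ci * RtoC t)))).
  destruct (C1_C_derive G (RtoC u * Cexp (Ci * RtoC t))) as [H _].
  { apply HG. rewrite circle_pt; lra. }
  apply (cderiv_comp G (fun z => z * Cexp (Ci * RtoC t))); auto.
  apply cderiv_caratheodory. exists (fun _ => Cexp (Ci * RtoC t)). split; [apply ccont_const|]. split; auto. intros; ring.
Qed.

Lemma circle_derive_angular (a : C) (u t : R) : (0 < u < r0)%R ->
  is_derive (fun t => Re (a * G (RtoC u * Cexp (Ci * RtoC t)))) t
    (Re (a * (C_derive G (RtoC u * Cexp (Ci * RtoC t)) * (RtoC u * (Cexp (Ci * RtoC t) * Ci))))).
Proof using HG.
  intros Hu.
  apply (cderiv_Re (fun z => a * G (RtoC u * Cexp (Ci * z)))).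
  destruct (C1_C_derive G (RtoC u * Cexp (Ci * RtoC t))) as [H _].
  { apply HG. rewrite circle_pt; lra. }
  apply cderiv_ext_near with (f := fun z => 0 + a * G (RtoC u * Cexp (Ci * z))) (d := 1%R); [lra|intros; ring|].
  apply (cderiv_affine (fun z => G (RtoC u * Cexp (Ci * z)))).
  apply (cderiv_comp G (fun z => RtoC u * Cexp (Ci * z))); auto.
  apply cderiv_ext_near with (f := fun z => 0 + RtoC u * Cexp (Ci * z)) (d := 1%R); [lra|intros; ring|].
  apply (cderiv_affine (fun z => Cexp (Ci * z))).
  apply (cderiv_comp Cexp (fun z => Ci * z)); [apply cderiv_Cexp|].
  apply cderiv_caratheodory. exists (fun _ => Ci). split; [apply ccont_const|]. split; auto. intros; ring.
Qed.

Lemma circle_D_continuous (u t : R) : (0 < u < r0)%R -> continuity_2d_pt D u t.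
Proof using HG.
  intros Hu eps.
  set (z0 := RtoC u * Cexp (Ci * RtoC t)).
  destruct (C1_C_derive G z0) as [_ Hc].
  { apply HG. unfold z0. rewrite circle_pt; lra. }
  destruct (Hc (eps / 2)%R) as [d [Hd H]]; [destruct eps; simpl; lra|].
  set (M := (1 + u + Cmod (C_derive G z0))%R).
  assert (PM : (1 <= M)%R) by (unfold M; assert (X := Cmod_ge_0 (C_derive G z0)); lra).
  assert (He : (0 < eps)%R) by apply cond_pos.
  set (e := Rmin (d / (4 * M)) (eps / (4 * M))).
  assert (Pe : (0 < e)%R) by (apply Rmin_pos; apply Rdiv_lt_0_compat; lra).
  assert (E1 : (4 * e * M <= d)%R).
  { assert (X := Rmin_l (d / (4 * M)) (eps / (4 * M))). fold e in X.
    apply Rmult_le_compat_r with (r := (4 * M)%R) in X; [|lra].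
    replace (d / (4 * M) * (4 * M))%R with d in X by (field; lra). lra. }
  assert (E2 : (4 * e * M <= eps)%R).
  { assert (X := Rmin_r (d / (4 * M)) (eps / (4 * M))). fold e in X.
    apply Rmult_le_compat_r with (r := (4 * M)%R) in X; [|lra].
    replace (eps / (4 * M) * (4 * M))%R with (pos eps) in X by (field; lra). lra. }
  exists (mkposreal e Pe). simpl. intros u' t' Hu' Ht'.
  unfold D. fold z0. set (z := RtoC u' * Cexp (Ci * RtoC t')).
  set (c := Cexp (Ci * RtoC t)) in *. set (c' := Cexp (Ci * RtoC t')) in *.
  assert (L : (Cmod (c' - c) <= 2 * Rabs (t' - t))%R) by apply cis_lipschitz.
  assert (Nc' : Cmod c' = 1%R) by apply Cmod_cis.
  assert (Hz : (Cmod (z - z0) < d)%R).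
  { unfold z, z0. fold c c'. replace (RtoC u' * c' - RtoC u * c) with (RtoC (u' - u) * c' + RtoC u * (c' - c)) by (rewrite RtoC_minus; ring).
    eapply Rle_lt_trans; [apply Cmod_triangle|]. rewrite !Cmod_mult, Nc', Cmod_R, (Cmod_RtoC_nonneg u) by lra.
    assert (X : (u * Cmod (c' - c) <= u * (2 * e))%R) by (apply Rmult_le_compat_l; lra).
    assert (Y : (e * 1 <= e * M)%R) by (apply Rmult_le_compat_l; lra).
    assert (Y2 : (e * u <= e * M)%R) by (apply Rmult_le_compat_l; unfold M; assert (Q := Cmod_ge_0 (C_derive G z0)); lra).
    lra. }
  specialize (H z Hz).
  replace (Re (C_derive G z * c') - Re (C_derive G z0 * c))%R with
    (Re ((C_derive G z - C_derive G z0) * c' + C_derive G z0 * (c' - c))).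
  - eapply Rle_lt_trans; [apply re_le_Cmod|]. eapply Rle_lt_trans; [apply Cmod_triangle|].
    rewrite !Cmod_mult, Nc'. assert (Q := Cmod_ge_0 (C_derive G z0)).
    assert (X : (Cmod (C_derive G z0) * Cmod (c' - c) <= M * (2 * e))%R).
    { apply Rmult_le_compat; auto using Cmod_ge_0; [unfold M; lra|lra]. }
    lra.
  - replace ((C_derive G z - C_derive G z0) * c' + C_derive G z0 * (c' - c)) with (C_derive G z * c' - C_derive G z0 * c) by ring.
    reflexivity.
Qed.

Lemma circle_ex_RInt (u : R) : (0 < u < r0)%R -> ex_RInt (f u) 0 (2 * PI).
Proof using HG.
  intros Hu. apply (ex_RInt_continuous (V := R_CompleteNormedModule)). intros t _.
  apply (ex_derive_continuous (K := R_AbsRing) (V := R_NormedModule)).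
  eexists. eapply is_derive_ext; [|apply (circle_derive_angular 1 u t Hu)].
  intros s. unfold f. rewrite Cmult_1_l. reflexivity.
Qed.

(** By the chain rule the radial derivative of [G] is its angular derivative divided by [i u], so it
    has a periodic primitive in the angle. *)
Lemma circle_D_RInt (u : R) : (0 < u < r0)%R -> is_RInt (D u) 0 (2 * PI) 0%R.
Proof using HG.
  intros Hu.
  set (P := fun t => Re (/ (RtoC u * Ci) * G (RtoC u * Cexp (Ci * RtoC t)))).
  assert (Nu : RtoC u <> 0) by (intros E; apply RtoC_inj in E; lra).
  assert (E : 0%R = minus (P (2 * PI)%R) (P 0%R)).
  { unfold P. replace (Cexp (Ci * RtoC (2 * PI))) with (Cexp (Ci * RtoC 0)).
    - rewrite minus_eq_zero. reflexivity.
    - rewrite Cmult_0_r, Cexp_0, <- (Cexp_PiCi_even 1). f_equal. rewrite RtoC_mult. ring. }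
  assert (HI : is_RInt (D u) 0 (2 * PI) (minus (P (2 * PI)%R) (P 0%R))); [|rewrite <- E in HI; exact HI].
  apply (is_RInt_derive (V := R_CompleteNormedModule)).
  - intros t _. unfold D.
    replace (C_derive G (RtoC u * Cexp (Ci * RtoC t)) * Cexp (Ci * RtoC t)) with
      (/ (RtoC u * Ci) * (C_derive G (RtoC u * Cexp (Ci * RtoC t)) * (RtoC u * (Cexp (Ci * RtoC t) * Ci)))).
    + apply circle_derive_angular, Hu.
    + field. split; [apply Ci_neq_0|auto].
  - intros t _. apply (filterlim_locally (F := locally t)). intros eps.
    destruct (circle_D_continuous u t Hu eps) as [d Hd].
    exists d. intros s Hs. apply (Hd u s); [|exact Hs].
    rewrite Rminus_diag, Rabs_R0. apply cond_pos.
Qed.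

(** The integral does not depend on the radius, since its derivative is the integral of [D];
    shrinking the circle then evaluates it from the limit [v] of [G] at the puncture. The imaginary
    part is obtained later by applying this to [Ci] times the function. *)
Lemma circle_mean (r : R) : (0 < r < r0)%R -> is_RInt (f r) 0 (2 * PI) (2 * PI * Re v)%R.
Proof using HG Hv.
  intros Hr. assert (PP := PI_RGT_0).
  assert (DJ : forall u, (0 < u < r0)%R -> is_derive (fun u => RInt (f u) 0 (2 * PI)) u 0%R).
  { intros u Hu.
    assert (Near : locally (T := R_UniformSpace) u (fun y => (0 < y < r0)%R)).
    { assert (Pe : (0 < Rmin u (r0 - u))%R) by (apply Rmin_pos; lra).
      exists (mkposreal _ Pe). intros y Hy. change (Rabs (y - u) < Rmin u (r0 - u))%R in Hy.
      assert (X1 := Rmin_l u (r0 - u)). assert (X2 := Rmin_r u (r0 - u)). apply Rabs_def2 in Hy. lra. }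
    assert (H := is_derive_RInt_param f 0 (2 * PI) u).
    assert (E : RInt (fun t => Derive (fun u => f u t) u) 0 (2 * PI) = 0%R).
    { apply is_RInt_unique. eapply is_RInt_ext; [|apply (circle_D_RInt u Hu)].
      intros t _. symmetry. apply is_derive_unique, circle_derive_radial, Hu. }
    rewrite E in H. apply H; clear H E.
    - destruct Near as [d Hd]. exists d. intros y Hy t _. eexists. apply circle_derive_radial, Hd, Hy.
    - intros t _. apply continuity_2d_pt_ext_loc with (f := D); [|apply circle_D_continuous, Hu].
      destruct Near as [d Hd]. exists d. intros y s Hy _. symmetry. apply is_derive_unique, circle_derive_radial.
      apply Hd, Hy.
    - destruct Near as [d Hd]. exists d. intros y Hy. apply circle_ex_RInt, Hd, Hy. }
  assert (E : RInt (f r) 0 (2 * PI) = (2 * PI * Re v)%R).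
  { apply Rminus_diag_uniq. apply Rabs_eq_0. apply Rle_antisym; [|apply Rabs_pos].
    apply le_epsilon. intros eps Heps.
    destruct (Hv (eps / (2 * PI))%R) as [d [Hd H]]; [apply Rdiv_lt_0_compat; lra|].
    set (r1 := (Rmin d r / 2)%R).
    assert (Pr : (0 < Rmin d r)%R) by (apply Rmin_pos; lra).
    assert (X1 := Rmin_l d r). assert (X2 := Rmin_r d r).
    assert (Hr1 : (0 < r1 < r0)%R) by (unfold r1; lra).
    assert (EJ : RInt (f r1) 0 (2 * PI) = RInt (f r) 0 (2 * PI)).
    { apply (eq_is_derive (fun u => RInt (f u) 0 (2 * PI))); [|unfold r1; lra].
      intros t Ht. apply DJ. unfold r1 in *. lra. }
    rewrite <- EJ. rewrite Rplus_0_l.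
    assert (I1 := RInt_correct _ _ _ (circle_ex_RInt r1 Hr1)).
    assert (I2 := is_RInt_minus _ _ _ _ _ _ I1 (is_RInt_const 0 (2 * PI) (Re v))).
    set (J := RInt (f r1) 0 (2 * PI)) in *.
    replace (J - 2 * PI * Re v)%R with (minus J (scal (2 * PI - 0)%R (Re v)))
      by (unfold minus, plus, opp, scal; simpl; unfold mult; simpl; ring).
    change (Rabs ?x) with (norm (V := R_NormedModule) x).
    eapply Rle_trans; [eapply (norm_RInt_le_const (V := R_NormedModule) _ 0 (2 * PI) _ (eps / (2 * PI))); [lra| |exact I2]|].
    - intros t _. apply Rlt_le. eapply Rle_lt_trans; [|apply (H (RtoC r1 * Cexp (Ci * RtoC t)))].
      + unfold f. change (Rabs (Re (G (RtoC r1 * Cexp (Ci * RtoC t)) - v)) <= Cmod (G (RtoC r1 * Cexp (Ci * RtoC t)) - v))%R.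
        apply re_le_Cmod.
      + rewrite circle_pt by lra. unfold r1. lra.
    - right. field. lra. }
  rewrite <- E. apply (RInt_correct (V := R_CompleteNormedModule)), circle_ex_RInt, Hr.
Qed.

End circle.

(** Parametrizing the circle multiplies [F] by [i z], so the real and imaginary parts of the
    integral are means of the real parts of [Ci * (z * F z)] and [z * F z]. *)
Lemma residue_simple_pole (F : C -> C) (r0 : posreal) (v : C) :
  (forall z, (0 < Cmod z < r0)%R -> C1 F z) ->
  (forall eps : R, (0 < eps)%R -> exists del : R, (0 < del)%R /\
    forall z, (0 < Cmod z < del)%R -> (Cmod (z * F z - v) < eps)%R) ->
  is_residue F 0 v.
Proof.
  intros HF Hv. exists r0. split.
  - intros z Hz. replace (z - 0) with z in Hz by ring.
    destruct (C1_cderiv F z (HF z Hz)) as [l Hl]. exists l. apply cderiv_is_derive, Hl.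
  - intros r Hr.
    assert (HG : forall z, (0 < Cmod z < r0)%R -> C1 (fun z => z * F z) z).
    { intros z Hz. apply C1_mult; [apply C1_id|apply HF, Hz]. }
    assert (HG' : forall z, (0 < Cmod z < r0)%R -> C1 (fun z => Ci * (z * F z)) z).
    { intros z Hz. apply C1_mult; [apply C1_const|apply HG, Hz]. }
    assert (Hv' : forall eps : R, (0 < eps)%R -> exists del : R, (0 < del)%R /\
      forall z, (0 < Cmod z < del)%R -> (Cmod (Ci * (z * F z) - Ci * v) < eps)%R).
    { intros eps Heps. destruct (Hv eps Heps) as [d [Hd H]]. exists d. split; auto. intros z Hz.
      replace (Ci * (z * F z) - Ci * v) with (Ci * (z * F z - v)) by ring.
      rewrite Cmod_mult, Cmod_Ci, Rmult_1_l. apply H, Hz. }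
    assert (I1 := circle_mean _ r0 v HG Hv r Hr). assert (I2 := circle_mean _ r0 (Ci * v) HG' Hv' r Hr).
    replace (2 * PI * Ci * v) with ((2 * PI * Re (Ci * v))%R, (2 * PI * Re v)%R).
    + apply (is_RInt_fct_extend_pair (U := R_NormedModule) (V := R_NormedModule)).
      * eapply is_RInt_ext; [|exact I2]. intros t _. cbv beta.
        rewrite Cplus_0_l. set (z := RtoC r * Cexp (Ci * RtoC t)).
        replace (F z * (Ci * RtoC r * Cexp (Ci * RtoC t))) with (Ci * (z * F z)) by (unfold z; ring).
        reflexivity.
      * eapply is_RInt_ext; [|exact I1]. intros t _. cbv beta.
        rewrite Cplus_0_l. set (z := RtoC r * Cexp (Ci * RtoC t)).
        replace (F z * (Ci * RtoC r * Cexp (Ci * RtoC t))) with (Ci * (z * F z)) by (unfold z; ring).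
        unfold Re, Ci, Cmult; simpl. ring.
    + unfold Re, Ci, Cmult, RtoC; simpl. f_equal; ring.
Qed.

Lemma is_residue_unique (f : C -> C) (z0 v v' : C) : is_residue f z0 v -> is_residue f z0 v' -> v = v'.
Proof.
  intros [r1 [_ H1]] [r2 [_ H2]].
  assert (P1 := cond_pos r1). assert (P2 := cond_pos r2).
  assert (X1 := Rmin_l r1 r2). assert (X2 := Rmin_r r1 r2).
  assert (X0 : (0 < Rmin r1 r2)%R) by (apply Rmin_pos; auto).
  specialize (H1 (Rmin r1 r2 / 2)%R ltac:(lra)). specialize (H2 (Rmin r1 r2 / 2)%R ltac:(lra)).
  assert (E := is_RInt_unique (V := C_R_CompleteNormedModule) _ _ _ _ H1).
  rewrite (is_RInt_unique (V := C_R_CompleteNormedModule) _ _ _ _ H2) in E.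
  assert (N := two_PiCi_neq_0).
  replace v with (/ (2 * PI * Ci) * (2 * PI * Ci * v)) by (rewrite Cmult_assoc, Cinv_l by exact N; ring).
  rewrite <- E, Cmult_assoc, Cinv_l by exact N. ring.
Qed.

Lemma residue_unique (f : C -> C) (z0 v : C) : is_residue f z0 v -> residue f z0 = v.
Proof.
  intros H. unfold residue. apply (iota_unique (V := C_R_CompleteNormedModule)); [|exact H].
  intros y Hy. exact (is_residue_unique f z0 y v Hy H).
Qed.

Lemma locally'_Cmod (P : C -> Prop) :
  locally' (T := C_UniformSpace) (RtoC 0) P -> exists d, (0 < d)%R /\ forall z, (0 < Cmod z < d)%R -> P z.
Proof.
  intros [d Hd].
  exists d. split; [apply cond_pos|]. intros z Hz. apply Hd.
  - apply (norm_compat1 (K := C_AbsRing) (V := C_NormedModule)).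
    change (Cmod (z - 0) < d)%R. replace (z - 0) with z by ring. apply Hz.
  - intros E. rewrite E, Cmod_0 in Hz. lra.
Qed.

(** Only the square of [zinf] is known, so its smoothness comes from
    [h(y) - h(x) = (h(y)^2 - h(x)^2) / (h(y) + h(x))] with [h = z / zinf] close to [1]. *)
Lemma residue_zinf (lam zinf phi : C -> C) (r0 : R) : (0 < r0)%R ->
  is_zinf lam zinf -> (forall z, (0 < Cmod z < r0)%R -> C1 lam z) ->
  (forall z, (Cmod z < r0)%R -> C1 phi z) ->
  is_residue (fun z => / zinf z * phi z) 0 (phi 0).
Proof.
  intros Hr0 [Hz1 Hz2] Hlam Hphi.
  apply locally'_Cmod in Hz1. destruct Hz1 as [d1 [Hd1 H1]].
  assert (Hlim : forall eps : R, (0 < eps)%R -> exists d, (0 < d)%R /\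
    forall z, (0 < Cmod z < d)%R -> (Cmod (zinf z / z - 1) < eps)%R).
  { intros eps Heps. 
    assert (X := proj1 (filterlim_locally_ball_norm (K := C_AbsRing) (U := C_NormedModule)
       (F := locally' (T := C_UniformSpace) (RtoC 0)) (fun z => zinf z / z) (RtoC 1)) Hz2 (mkposreal eps Heps)).
    apply locally'_Cmod in X. exact X. }
  set (h := fun z => z * / zinf z).
  assert (Hh : forall eps : R, (0 < eps)%R -> exists d, (0 < d)%R /\
    forall z, (0 < Cmod z < d)%R -> zinf z <> 0 /\ (Cmod (h z - 1) < eps)%R).
  { intros eps Heps. destruct (Hlim (Rmin (1 / 2) (eps / 2))) as [d [Hd H]]; [apply Rmin_pos; lra|].
    exists d. split; auto. intros z Hz. specialize (H z Hz).
    assert (X1 := Rmin_l (1 / 2) (eps / 2)). assert (X2 := Rmin_r (1 / 2) (eps / 2)).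
    assert (Nz : z <> 0) by (apply Cmod_gt_0; lra).
    set (w := zinf z / z) in *.
    assert (Lw : (1 / 2 < Cmod w)%R).
    { assert (T := Cmod_triangle w (- (w - 1))). replace (w + - (w - 1)) with (RtoC 1) in T by ring.
      rewrite Cmod_1, Cmod_opp in T. lra. }
    assert (Nw : w <> 0) by (apply Cmod_gt_0; lra).
    assert (Nf : zinf z <> 0).
    { intros E. apply Nw. unfold w. rewrite E. field. auto. }
    split; auto. replace (h z - 1) with (- (w - 1) * / w).
    - rewrite Cmod_mult, Cmod_opp, Cmod_inv by auto.
      apply Rmult_lt_reg_r with (Cmod w); [lra|]. rewrite Rmult_assoc, Rinv_l, Rmult_1_r by lra.
      nra.
    - unfold h, w. field. auto. }
  destruct (Hh (1 / 2)%R) as [d2 [Hd2 H2]]; [lra|].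
  set (r := Rmin r0 (Rmin d1 d2)).
  assert (Pr : (0 < r)%R) by (apply Rmin_pos; auto; apply Rmin_pos; auto).
  assert (R0 : (r <= r0)%R) by apply Rmin_l.
  assert (R1 : (r <= d1)%R) by (eapply Rle_trans; [apply Rmin_r|apply Rmin_l]).
  assert (R2 : (r <= d2)%R) by (eapply Rle_trans; [apply Rmin_r|apply Rmin_r]).
  set (g := fun z => z * z * lam z).
  assert (Hsq : forall z, (0 < Cmod z < r)%R -> h z * h z = g z).
  { intros z Hz. destruct (H2 z ltac:(lra)) as [Nf _]. specialize (H1 z ltac:(lra)).
    (* A zero of [lam] is excluded through the convention [/ 0 = 0], which would make [zinf z]
       vanish. *)
    assert (Nl : lam z <> 0).
    { intros E. apply (Cpow_nz (zinf z) 2 Nf). rewrite H1, E.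
      unfold Cinv, RtoC; simpl. unfold Rdiv. f_equal; ring. }
    unfold h, g. replace (z * / zinf z * (z * / zinf z)) with (z * z * / (zinf z ^ 2)) by (field; auto).
    rewrite H1. field. auto. }
  (* Both values are within [1/2] of [1], hence on the same branch of the square root; a jump of
     sign would make the sum small. *)
  assert (Hsum : forall y z, (0 < Cmod y < r)%R -> (0 < Cmod z < r)%R -> (1 <= Cmod (h y + h z))%R).
  { intros y z Hy Hz. destruct (H2 y ltac:(lra)) as [_ A]. destruct (H2 z ltac:(lra)) as [_ B].
    assert (T := Cmod_triangle (h y + h z) (- (h y - 1) + - (h z - 1))).
    assert (T2 := Cmod_triangle (- (h y - 1)) (- (h z - 1))). rewrite !Cmod_opp in T2.
    replace (h y + h z + (- (h y - 1) + - (h z - 1))) with (RtoC 2) in T by ring.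
    rewrite (Cmod_RtoC_nonneg 2) in T by lra. lra. }
  assert (Hg : forall z, (0 < Cmod z < r)%R -> C1 g z).
  { intros z Hz. unfold g. apply C1_mult; [apply C1_mult; apply C1_id|apply Hlam; lra]. }
  assert (Hne : forall z, (0 < Cmod z < r)%R -> h z + h z <> 0).
  { intros z Hz. apply Cmod_gt_0. specialize (Hsum z z Hz Hz). lra. }
  assert (Near : forall z, (0 < Cmod z < r)%R -> forall y, (Cmod (y - z) < Rmin (Cmod z) (r - Cmod z))%R -> (0 < Cmod y < r)%R).
  { intros z Hz y Hy. assert (X1 := Rmin_l (Cmod z) (r - Cmod z)). assert (X2 := Rmin_r (Cmod z) (r - Cmod z)).
    assert (T := Cmod_triangle z (y - z)). replace (z + (y - z)) with y in T by ring.
    assert (T2 := Cmod_triangle y (- (y - z))). replace (y + - (y - z)) with z in T2 by ring. rewrite Cmod_opp in T2. lra. }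
  assert (Ch : forall z, (0 < Cmod z < r)%R -> ccont h z).
  { intros z Hz eps Heps. destruct (C1_ccont g z (Hg z Hz) eps Heps) as [d [Hd H]].
    exists (Rmin d (Rmin (Cmod z) (r - Cmod z))). split; [apply Rmin_pos; auto; apply Rmin_pos; lra|]. intros y Hy.
    assert (Hy1 := Rlt_le_trans _ _ _ Hy (Rmin_l _ _)). assert (Hy2 := Rlt_le_trans _ _ _ Hy (Rmin_r _ _)).
    specialize (H y Hy1). assert (Hyr := Near z Hz y Hy2). specialize (Hsum y z Hyr Hz).
    rewrite <- (Hsq y Hyr), <- (Hsq z Hz) in H.
    replace (h y * h y - h z * h z) with ((h y - h z) * (h y + h z)) in H by ring. rewrite Cmod_mult in H.
    assert (P := Cmod_ge_0 (h y - h z)). nra. }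
  assert (Dh : forall z l, (0 < Cmod z < r)%R -> cderiv g z l -> cderiv h z (l * / (h z + h z))).
  { intros z l Hz Hl. apply cderiv_caratheodory in Hl. destruct Hl as [p [Cp [<- Ep]]].
    apply cderiv_ext_near with (f := fun y => h z + (y - z) * (p y * / (h y + h z))) (d := Rmin (Cmod z) (r - Cmod z)).
    - apply Rmin_pos; lra.
    - intros y Hy. assert (Hyr := Near z Hz y Hy).
      assert (N : h y + h z <> 0) by (apply Cmod_gt_0; specialize (Hsum y z Hyr Hz); lra).
      rewrite Cmult_assoc, <- Ep, <- (Hsq y Hyr), <- (Hsq z Hz).
      replace (h y * h y - h z * h z) with ((h y - h z) * (h y + h z)) by ring. field. auto.
    - apply cderiv_caratheodory. exists (fun y => p y * / (h y + h z)). split; [|split; auto].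
      + apply ccont_mult; auto. apply ccont_inv; [apply Hne, Hz|]. apply ccont_plus; [apply Ch, Hz|apply ccont_const].
      + intros y. ring. }
  assert (C1h : forall z, (0 < Cmod z < r)%R -> C1 h z).
  { intros z Hz. destruct (Hg z Hz) as [g' [d [Hd [Hgd Hgc]]]].
    exists (fun y => g' y * / (h y + h y)), (Rmin d (Rmin (Cmod z) (r - Cmod z))).
    split; [apply Rmin_pos; auto; apply Rmin_pos; lra|]. split.
    - intros y Hy. apply Dh.
      + apply (Near z Hz). apply (Rlt_le_trans _ _ _ Hy (Rmin_r _ _)).
      + apply Hgd. apply (Rlt_le_trans _ _ _ Hy (Rmin_l _ _)).
    - apply ccont_mult; auto. apply ccont_inv; [apply Hne, Hz|]. apply ccont_plus; apply Ch, Hz. }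
  apply (residue_simple_pole _ (mkposreal r Pr)).
  - simpl. intros z Hz. assert (Nz : z <> 0) by (apply Cmod_gt_0; lra).
    apply C1_mult; [|apply Hphi; lra].
    apply C1_ext_near with (f := fun y => h y * / y) (d := Cmod z); [lra| |].
    + intros y Hy. unfold h. destruct (eqdec y 0) as [->|Ny].
      * exfalso. replace (0 - z) with (- z) in Hy by ring. rewrite Cmod_opp in Hy. lra.
      * rewrite (Cmult_comm y), <- Cmult_assoc, Cinv_r by auto. ring.
    + apply C1_mult; [apply C1h, Hz|apply C1_inv_id, Nz].
  - intros eps Heps.
    assert (Cphi : ccont phi 0) by (apply C1_ccont, Hphi; rewrite Cmod_0; auto).
    assert (M0 := Cmod_ge_0 (phi 0)). set (M := (2 + Cmod (phi 0))%R).
    assert (PM : (2 <= M)%R) by (unfold M; lra).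
    set (e := Rmin 1 (eps / (2 * M))).
    assert (Pe : (0 < e)%R) by (apply Rmin_pos; [lra|apply Rdiv_lt_0_compat; lra]).
    assert (E1 : (e <= 1)%R) by apply Rmin_l.
    assert (E2 : (e * (2 * M) <= eps)%R).
    { assert (X := Rmin_r 1 (eps / (2 * M))). fold e in X. apply Rmult_le_compat_r with (r := (2 * M)%R) in X; [|lra].
      replace (eps / (2 * M) * (2 * M))%R with eps in X by (field; lra). auto. }
    destruct (Hh e Pe) as [d3 [Hd3 H3]]. destruct (Cphi e Pe) as [d4 [Hd4 H4]].
    exists (Rmin d3 d4). split; [apply Rmin_pos; auto|]. intros z Hz.
    assert (Y1 := Rmin_l d3 d4). assert (Y2 := Rmin_r d3 d4).
    destruct (H3 z ltac:(lra)) as [_ A]. specialize (H4 z). replace (z - 0) with z in H4 by ring. specialize (H4 ltac:(lra)).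
    replace (z * (/ zinf z * phi z) - phi 0) with ((h z - 1) * (phi z - phi 0) + ((h z - 1) * phi 0 + (phi z - phi 0))) by (unfold h; ring).
    eapply Rle_lt_trans; [apply Cmod_triangle|]. eapply Rle_lt_trans; [apply Rplus_le_compat_l, Cmod_triangle|].
    rewrite !Cmod_mult. assert (Q1 := Cmod_ge_0 (h z - 1)). assert (Q2 := Cmod_ge_0 (phi z - phi 0)).
    set (a := Cmod (h z - 1)) in *. set (b := Cmod (phi z - phi 0)) in *.
    assert (T1 : (a * b <= e * 1)%R) by (apply Rmult_le_compat; lra).
    assert (T2 : (a * Cmod (phi 0) <= e * Cmod (phi 0))%R) by (apply Rmult_le_compat_r; lra).
    unfold M in E2. nra.
Qed.

(** * Integrals over the cycles *)

Lemma ccont_continuous_Re (f : C -> C) (t : R) : ccont f (RtoC t) ->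
  continuous (T := R_UniformSpace) (U := R_UniformSpace) (fun u => Re (f (RtoC u))) t.
Proof.
  intros H. apply (filterlim_locally (F := locally t)). intros eps.
  destruct (H eps (cond_pos eps)) as [d [Hd HH]].
  exists (mkposreal d Hd). intros s Hs. change (Rabs (Re (f (RtoC s)) - Re (f (RtoC t))) < eps)%R.
  change (Re (f (RtoC s)) - Re (f (RtoC t)))%R with (Re (f (RtoC s) - f (RtoC t))).
  eapply Rle_lt_trans; [apply re_le_Cmod|]. apply HH. rewrite <- RtoC_minus, Cmod_R. exact Hs.
Qed.

Lemma Im_Re (z : C) : Im z = Re (- Ci * z).
Proof. unfold Im, Re, Ci, Copp, Cmult; simpl. ring. Qed.

Lemma is_RInt_cderiv (F f : C -> C) (a b : R) :
  (forall t : R, cderiv F (RtoC t) (f (RtoC t))) -> (forall t : R, ccont f (RtoC t)) ->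
  is_RInt (V := C_R_NormedModule) (fun t => f (RtoC t)) a b (F (RtoC b) - F (RtoC a)).
Proof.
  intros HF Hf. rewrite (surjective_pairing (F (RtoC b) - F (RtoC a))).
  apply (is_RInt_fct_extend_pair (U := R_NormedModule) (V := R_NormedModule)).
  - apply (is_RInt_derive (V := R_CompleteNormedModule) (fun t => Re (F (RtoC t))) (fun t => Re (f (RtoC t)))).
    + intros t _. apply cderiv_Re, HF.
    + intros t _. apply ccont_continuous_Re, Hf.
  - assert (H : is_RInt (fun t => Re (- Ci * f (RtoC t))) a b (Re (- Ci * F (RtoC b)) - Re (- Ci * F (RtoC a)))%R).
    { apply (is_RInt_derive (V := R_CompleteNormedModule) (fun t => Re (- Ci * F (RtoC t))) (fun t => Re (- Ci * f (RtoC t)))).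
      + intros t _. apply (cderiv_Re (fun z => - Ci * F z)).
        apply cderiv_ext_near with (f := fun z => 0 + - Ci * F z) (d := 1%R); [lra|intros; ring|].
        apply cderiv_affine, HF.
      + intros t _. apply (ccont_continuous_Re (fun z => - Ci * f z)). apply ccont_mult; [apply ccont_const|apply Hf]. }
    rewrite <- !Im_Re in H. eapply is_RInt_ext; [|exact H].
    intros t _. symmetry. exact (Im_Re (f (RtoC t))).
Qed.

Lemma is_RInt_fourier (n : Z) :
  is_RInt (V := C_R_NormedModule) (fun t => Cexp (freq n * RtoC t)) 0 1 (if Z.eq_dec n 0 then RtoC 1 else RtoC 0).
Proof.
  destruct (Z.eq_dec n 0) as [->|Hn].
  - replace (RtoC 1) with (RtoC 1 - RtoC 0) by ring.
    apply (is_RInt_cderiv (fun z => z) (fun z => Cexp (freq 0 * z))).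
    + intros t. replace (Cexp (freq 0 * RtoC t)) with (RtoC 1).
      * apply cderiv_caratheodory. exists (fun _ => 1). split; [apply ccont_const|]. split; auto. intros; ring.
      * unfold freq. rewrite Cmult_0_r, Cmult_0_l, Cexp_0. reflexivity.
    + intros t. apply C1_ccont, (C1_comp Cexp (fun z => freq 0 * z)); [apply C1_Cexp|].
      apply C1_mult; [apply C1_const|apply C1_id].
  - assert (N : freq n <> 0).
    { unfold freq. apply Cmult_neq_0; [apply two_PiCi_neq_0|]. intros E. apply RtoC_inj, eq_IZR in E. auto. }
    replace (RtoC 0) with ((0 + / freq n * Cexp (freq n * RtoC 1)) - (0 + / freq n * Cexp (freq n * RtoC 0))).
    + apply (is_RInt_cderiv (fun z => 0 + / freq n * Cexp (freq n * z)) (fun z => Cexp (freq n * z))).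
      * intros t. replace (Cexp (freq n * RtoC t)) with (/ freq n * (Cexp (freq n * RtoC t) * freq n)) by (field; auto).
        apply (cderiv_affine (fun z => Cexp (freq n * z))).
        apply (cderiv_comp Cexp (fun z => freq n * z)); [apply cderiv_Cexp|].
        apply cderiv_caratheodory. exists (fun _ => freq n). split; [apply ccont_const|]. split; auto. intros; ring.
      * intros t. apply C1_ccont, (C1_comp Cexp (fun z => freq n * z)); [apply C1_Cexp|].
        apply C1_mult; [apply C1_const|apply C1_id].
    + rewrite Cmult_0_r, Cexp_0, Cmult_1_r. unfold freq at 2. rewrite Cexp_PiCi_even. ring.
Qed.

Lemma is_RInt_Cscal (c : C) (f : R -> C) (a b : R) (l : C) :
  is_RInt (V := C_R_NormedModule) f a b l -> is_RInt (V := C_R_NormedModule) (fun t => c * f t) a b (c * l).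
Proof.
  intros H. 
  assert (H1 := is_RInt_fct_extend_fst (U := R_NormedModule) (V := R_NormedModule) f a b l H).
  assert (H2 := is_RInt_fct_extend_snd (U := R_NormedModule) (V := R_NormedModule) f a b l H).
  rewrite (surjective_pairing (c * l)).
  apply (is_RInt_fct_extend_pair (U := R_NormedModule) (V := R_NormedModule)).
  - apply (is_RInt_minus (V := R_NormedModule) _ _ _ _ _ _ (is_RInt_scal (V := R_NormedModule) _ _ _ (fst c) _ H1)
      (is_RInt_scal (V := R_NormedModule) _ _ _ (snd c) _ H2)).
  - apply (is_RInt_plus (V := R_NormedModule) _ _ _ _ _ _ (is_RInt_scal (V := R_NormedModule) _ _ _ (fst c) _ H2)
      (is_RInt_scal (V := R_NormedModule) _ _ _ (snd c) _ H1)).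
Qed.

(** Weierstrass test along the net of finite sets: the majorant makes the partial sums converge
    uniformly, which allows the exchange with the integral. *)
Lemma is_RInt_usum {T : Type} (f : T -> R -> C) (M : T -> R) (I : T -> C) (a b : R) :
  bsum M -> (forall t x, Cmod (f t x) <= M t)%R ->
  (forall t, is_RInt (V := C_R_NormedModule) (f t) a b (I t)) ->
  exists s, is_usum I s /\ is_RInt (V := C_R_NormedModule) (fun x => usum (fun t => f t x)) a b s.
Proof.
  intros HM Hf HI.
  assert (M0 : forall t, (0 <= M t)%R) by (intros t; eapply Rle_trans; [apply Cmod_ge_0|apply (Hf t 0%R)]).
  destruct (filterlim_RInt (V := C_R_CompleteNormedModule) (fun (F : list T) (x : R) => sum_list (fun t => f t x) F) a b
    finite_subsets finite_subsets_filter (fun x => usum (fun t => f t x)) (fun F => sum_list I F)) as [s [Hs1 Hs2]].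
  - intros F. induction F as [|t F IH].
    + apply (is_RInt_ext (V := C_R_NormedModule) (fun _ => zero)); [reflexivity|].
      replace (sum_list I nil) with (scal (V := C_R_NormedModule) (b - a)%R (zero : C_R_NormedModule)).
      * apply (is_RInt_const (V := C_R_NormedModule)).
      * apply (scal_zero_r (V := C_R_NormedModule)).
    + apply (is_RInt_plus (V := C_R_NormedModule) _ _ _ _ _ _ (HI t) IH).
  - intros P [eps HP].
    destruct (bsum_tail M M0 HM (eps / 2)) as [F0 [N0 H0]]; [destruct eps; simpl; lra|].
    exists F0. intros F N HF. apply HP. intros x.
    apply (norm_compat1 (K := C_AbsRing) (V := C_NormedModule)).
    change (Cmod (sum_list (fun t => f t x) F - usum (fun t => f t x)) < eps)%R.
    assert (A : asum (fun t => f t x)) by (apply asum_le with (2 := HM); intros t; apply Hf).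
    assert (R1 : is_usum (restrict (fun t => In t F) (fun t => f t x)) (sum_list (fun t => f t x) F)).
    { rewrite (sum_list_ext_in _ (restrict (fun t => In t F) (fun t => f t x))).
      - apply is_usum_finite; auto. intros t Ht. apply restrict_false, Ht.
      - intros t Ht. rewrite restrict_true; auto. }
    assert (R2 := is_usum_minus _ _ _ _ R1 (asum_usum _ A)).
    apply Rle_lt_trans with (eps / 2)%R; [|destruct eps; simpl; lra].
    apply is_usum_bound with (1 := R2). intros L NL.
    set (L' := filter (fun t => if in_dec eqdec t F then false else true) L).
    apply Rle_trans with (rsum M L').
    + unfold L'. clear -Hf. induction L as [|t L IH]; simpl; [lra|].
      destruct (in_dec eqdec t F) as [E|E]; simpl.
      * rewrite restrict_true by auto. replace (f t x - f t x) with (RtoC 0) by ring. rewrite Cmod_0. lra.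
      * rewrite restrict_false by auto. replace (0 - f t x) with (- f t x) by ring. rewrite Cmod_opp.
        specialize (Hf t x). lra.
    + apply H0.
      * apply NoDup_filter, NL.
      * intros t Ht Ht0. apply filter_In in Ht. destruct Ht as [_ Ht].
        destruct (in_dec eqdec t F) as [E|E]; [discriminate|]. apply E, HF, Ht0.
  - exists s. split; auto.
Qed.

Lemma asum_mult {T : Type} (f g : T -> C) : asum f -> asum g -> asum (fun t => f t * g t).
Proof.
  intros Hf Hg. apply (asum_comp _ (fun t : T => (t, t)) ltac:(intros; congruence) (asum_prod f g Hf Hg)).
Qed.

Lemma Cmod_Cexp_freq (n : Z) (t : R) : Cmod (Cexp (freq n * RtoC t)) = 1%R.
Proof.
  rewrite Cmod_Cexp, Re_freq. simpl Im. rewrite Rmult_0_r, Rmult_0_r, Ropp_0. apply exp_0.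
Qed.

(** The second factor is taken at [- t], so that orthogonality pairs equal indices and no
    conjugation enters. *)
Lemma Parseval (A B : Z -> C) : asum A -> asum B ->
  is_RInt (V := C_R_NormedModule)
    (fun t => usum (fun n => A n * Cexp (freq n * RtoC t)) * usum (fun n => B n * Cexp (freq n * RtoC (- t))))
    0 1 (usum (fun n => A n * B n)).
Proof.
  intros HA HB.
  assert (HM : bsum (fun p : Z * Z => Cmod (A (fst p)) * Cmod (B (snd p)))%R).
  { apply (bsum_prod (fun n => Cmod (A n)) (fun n => Cmod (B n))); auto; intros; apply Cmod_ge_0. }
  destruct (is_RInt_usum (fun (p : Z * Z) t => (A (fst p) * B (snd p)) * Cexp (freq (fst p - snd p) * RtoC t))
    _ (fun p => (A (fst p) * B (snd p)) * (if Z.eq_dec (fst p - snd p) 0 then RtoC 1 else RtoC 0)) 0 1 HM) as [s [H1 H2]].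
  - intros p t. rewrite !Cmod_mult, Cmod_Cexp_freq. lra.
  - intros p. apply is_RInt_Cscal, is_RInt_fourier.
  - assert (E : usum (fun n => A n * B n) = s).
    { apply usum_unique.
      match type of H1 with is_usum ?F s => assert (R := is_usum_reindex F (fun n : Z => (n, n)) s) end.
      eapply is_usum_ext; [|apply R; [| |exact H1]].
      - intros n. cbn [fst snd]. rewrite Z.sub_diag. destruct (Z.eq_dec 0 0); [|lia]. ring.
      - intros; congruence.
      - intros [m n] Hn. cbn [fst snd]. destruct (Z.eq_dec (m - n) 0) as [E|E]; [|ring].
        exfalso. apply (Hn n). f_equal. lia. }
    rewrite E. eapply is_RInt_ext; [|exact H2]. intros t _. cbv beta.
    assert (Aexp : forall (A : Z -> C) (t : R), asum A -> asum (fun n => A n * Cexp (freq n * RtoC t))).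
    { clear. intros A t HA. apply asum_le with (2 := HA). intros n. rewrite Cmod_mult, Cmod_Cexp_freq. lra. }
    apply usum_unique.
    eapply is_usum_ext; [|apply (is_usum_mult _ _ _ _ (Aexp A t HA) (Aexp B (- t)%R HB) (asum_usum _ (Aexp A t HA)) (asum_usum _ (Aexp B (- t)%R HB)))].
    intros [m n]. cbn [fst snd].
    replace (Cexp (freq (m - n) * RtoC t)) with (Cexp (freq m * RtoC t) * Cexp (freq n * RtoC (- t))); [ring|].
    rewrite <- Cexp_add. f_equal. unfold freq. rewrite minus_IZR, RtoC_minus, RtoC_opp. ring.
Qed.

(** * Quadratic and cubic sums of the Fourier coefficients *)

Lemma wp_coef_opp (tau : C) (n : Z) : (0 < Im tau)%R -> wp_coef tau (- n) = wp_coef tau n * Cexp (freq n * tau).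
Proof.
  intros Ht. destruct (Z.eq_dec n 0) as [->|Hn].
  - change (- 0)%Z with 0%Z. rewrite wp_coef_0. ring.
  - unfold wp_coef. assert (N1 := qnome_neq_1 _ (nonint_mult_tau tau n Ht Hn)).
    replace (Cexp (freq n * tau)) with (qnome (IZR n * tau)) by (unfold qnome, freq; f_equal; ring).
    replace (qnome (IZR (- n) * tau)) with (/ qnome (IZR n * tau)).
    + assert (N2 : qnome (IZR n * tau) <> 0) by apply Cexp_neq_0. set (x := qnome (IZR n * tau)) in *. clearbody x.
      rewrite opp_IZR, RtoC_opp. field. repeat split; auto.
      replace (x - 1) with (- (1 - x)) by ring. intros E. apply N1. replace (1 - x) with (- - (1 - x)) by ring. rewrite E. ring.
    + unfold qnome. rewrite <- Cexp_opp. f_equal. rewrite opp_IZR, RtoC_opp. ring.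
Qed.

Lemma wp_coef_sum2 (tau : C) : (0 < Im tau)%R ->
  is_usum (fun n => wp_coef tau n * wp_coef tau (- n)) (2 * qdouble 2 1 tau).
Proof.
  intros Ht. assert (A := exp_summable_asum _ _ _ (wp_coef_sq_summable tau tau ltac:(lra))).
  replace (2 * qdouble 2 1 tau) with (wp_coef tau 0 * wp_coef tau (- 0) + 2 * qdouble 2 1 tau) by (rewrite wp_coef_0; ring).
  apply (is_usum_Z (fun n => wp_coef tau n * wp_coef tau (- n))).
  - eapply asum_ext; [|exact A]. intros n. cbv beta. rewrite (wp_coef_opp tau n Ht). ring.
  - eapply is_usum_ext; [|apply is_usum_scal, (qdouble_rows 2 1 tau (fun x => x / (1 - x) ^ 2) Ht is_usum_geom1)].
    intros n. cbv beta. rewrite Z.opp_involutive, wp_coef_pos, wp_coef_neg by exact Ht.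
    assert (N := pow_q_ne (qnome tau) (Cmod_qnome_lt_1 tau Ht) n).
    unfold lambert_term. set (x := qnome tau ^ S n) in *. clearbody x. rewrite RtoC_pow. field. auto.
Qed.

(** The factor [e(n tau)] hidden in [a_(-n)] is shared equally between the series of [a_n] and of
    [a_n^2], both taken at [tau / 2], where both converge. *)
Lemma asum_wp_coef3 (tau : C) : (0 < Im tau)%R -> asum (fun n => wp_coef tau (- n) * (wp_coef tau n * wp_coef tau n)).
Proof.
  intros Ht. set (s := RtoC (1 / 2) * tau).
  assert (Is : Im s = (Im tau / 2)%R) by (unfold s; rewrite im_scal_l; field).
  assert (A1 := exp_summable_asum _ _ _ (wp_coef_summable tau s ltac:(lra))).
  assert (A2 := exp_summable_asum _ _ _ (wp_coef_sq_summable tau s ltac:(lra))).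
  eapply asum_ext; [|exact (asum_mult _ _ A1 A2)]. intros n. cbv beta. rewrite (wp_coef_opp tau n Ht).
  replace (freq n * tau) with (freq n * s + freq n * s) by (unfold s; rewrite RtoC_div by lra; field).
  rewrite Cexp_add. ring.
Qed.

(** With [x = q^n], the indices [n] and [- n] contribute [n^3 x / (1 - x)^3] and
    [n^3 x^2 / (1 - x)^3]; together these are the row of [qdouble 3 2]. *)
Lemma wp_coef_sum3 (tau : C) : (0 < Im tau)%R ->
  is_usum (fun n => wp_coef tau (- n) * (wp_coef tau n * wp_coef tau n)) (qdouble 3 2 tau).
Proof.
  intros Ht.
  replace (qdouble 3 2 tau) with (wp_coef tau (- 0) * (wp_coef tau 0 * wp_coef tau 0) + qdouble 3 2 tau) by (rewrite wp_coef_0; ring).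
  apply (is_usum_Z (fun n => wp_coef tau (- n) * (wp_coef tau n * wp_coef tau n)) _ (asum_wp_coef3 tau Ht)).
  eapply is_usum_ext; [|apply (qdouble_rows 3 2 tau (fun x => x * (1 + x) / (1 - x) ^ 3) Ht is_usum_geom2)].
  intros n. cbv beta. rewrite Z.opp_involutive, wp_coef_pos, wp_coef_neg by exact Ht.
  assert (N := pow_q_ne (qnome tau) (Cmod_qnome_lt_1 tau Ht) n).
  unfold lambert_term. set (x := qnome tau ^ S n) in *. clearbody x. rewrite RtoC_pow. field. auto.
Qed.

Lemma wp_coef_sum3' (tau : C) : (0 < Im tau)%R ->
  is_usum (fun n => wp_coef tau (- n) * (wp_coef tau n * wp_coef tau n) * Cexp (freq n * tau)) (qdouble 3 2 tau).
Proof.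
  intros Ht.
  assert (H := proj1 (is_usum_reindex _ Z.opp _ ltac:(intros; lia)
     (fun t Hn => False_ind _ (Hn (- t)%Z (Z.opp_involutive t)))) (wp_coef_sum3 tau Ht)).
  eapply is_usum_ext; [|exact H]. intros n. cbv beta. rewrite Z.opp_involutive, (wp_coef_opp tau n Ht). ring.
Qed.

(** * The differentials and their periods as Fourier series *)

Section periods.

Variables (w1 tau c : C).
Hypothesis Hw : w1 <> 0.
Hypothesis Ht : (0 < Im tau)%R.

Let w2 := tau * w1.
Let kk := (PI * Ci / w1) ^ 2.

Lemma two_w1_neq_0 : 2 * w1 <> 0.
Proof using Hw. apply Cmult_neq_0; auto. intros E. apply RtoC_inj in E. lra. Qed.

(** The constant [c] and the [E2] term sit at index zero only, where [wp_coef] vanishes; every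
    pairing below therefore loses them. *)
Definition lambda_coef (n : Z) : C :=
  kk * wp_coef tau n + restrict (fun n => n = 0%Z) (fun _ => c + kk * (E2 tau / 12)) n.

Lemma wp_strip (sg : C) (j : Z) : (0 < Im sg < Im tau)%R ->
  wp w1 w2 (2 * w1 * (sg + IZR j * tau)) = kk * (E2 tau / 12 + exp_series (wp_coef tau) freq sg).
Proof using Hw Ht.
  intros Hs. assert (H := wp_fourier w1 tau sg j Hw Hs). assert (N := two_w1_neq_0).
  unfold w2. set (X := wp _ _ _) in *.
  replace X with (X * (2 * w1) ^ 2 * / (2 * w1) ^ 2) by (field; auto).
  rewrite H. unfold kk. field. auto.
Qed.

Lemma asum_lambda_coef (sg : C) : (0 < Im sg < Im tau)%R -> asum (fun n => lambda_coef n * Cexp (freq n * sg)).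
Proof using Hw Ht.
  intros Hs. assert (A := exp_summable_asum _ _ _ (wp_coef_summable tau sg Hs)).
  apply asum_ext with (fun n => kk * (wp_coef tau n * Cexp (freq n * sg)) +
    restrict (fun n => n = 0%Z) (fun _ => c + kk * (E2 tau / 12)) n * Cexp (freq n * sg)).
  - intros n. unfold lambda_coef. ring.
  - apply asum_plus; [apply asum_scal, A|].
    assert (D : asum (fun n => (c + kk * (E2 tau / 12)) * RtoC (decay n))).
    { apply asum_scal, asum_le with (2 := bsum_decay). intros n. rewrite Cmod_RtoC_nonneg; [lra|apply Rlt_le, decay_pos]. }
    eapply asum_ext; [|exact (asum_restrict (fun n => n = 0%Z) _ D)]. intros n. cbv beta.
    destruct (Z.eq_dec n 0) as [->|E].
    + rewrite !restrict_true, decay_0 by auto. unfold freq. rewrite Cmult_0_r, Cmult_0_l, Cexp_0. ring.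
    + rewrite !restrict_false by auto. ring.
Qed.

Lemma lambda_fourier (sg : C) (j : Z) (t : R) : (0 < Im sg < Im tau)%R ->
  lambda w1 w2 c (2 * w1 * (sg + IZR j * tau) + t * (2 * w1)) =
  usum (fun n => (lambda_coef n * Cexp (freq n * sg)) * Cexp (freq n * t)).
Proof using Hw Ht.
  intros Hs. unfold lambda.
  replace (2 * w1 * (sg + IZR j * tau) + t * (2 * w1)) with (2 * w1 * ((sg + t) + IZR j * tau)) by ring.
  assert (Hs' : (0 < Im (sg + t) < Im tau)%R) by (rewrite Im_plus; simpl (Im (RtoC t)); lra).
  rewrite wp_strip by exact Hs'. symmetry. apply usum_unique.
  assert (A := asum_usum _ (exp_summable_asum _ _ _ (wp_coef_summable tau (sg + t) Hs'))).
  assert (B := is_usum_single (fun _ : Z => c + kk * (E2 tau / 12)) 0%Z).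
  replace (kk * (E2 tau / 12 + exp_series (wp_coef tau) freq (sg + t)) + c) with
    (kk * exp_series (wp_coef tau) freq (sg + t) + (c + kk * (E2 tau / 12))) by ring.
  eapply is_usum_ext; [|apply (is_usum_plus _ _ _ _ (is_usum_scal _ kk _ A) B)].
  intros n. cbv beta. unfold lambda_coef. rewrite Cmult_plus_distr_l, Cexp_add.
  destruct (Z.eq_dec n 0) as [->|E].
  - rewrite !restrict_true by auto. unfold freq. rewrite !Cmult_0_r, !Cmult_0_l, Cexp_0. ring.
  - rewrite !restrict_false by auto. ring.
Qed.

(** Since [kk = - PI^2 / w1^2], the value of [wzeta] at the half-period cancels the constant term
    [kk * E2 / 12]. *)
Lemma W_strip (zP zQ rho : C) (l : Z) : (0 < Im rho < Im tau)%R ->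
  zP - zQ = 2 * w1 * (rho + IZR l * tau) -> W w1 w2 zP zQ = kk * exp_series (wp_coef tau) freq rho.
Proof using Hw Ht.
  intros Hr E. unfold W. rewrite E, wp_strip by exact Hr. unfold w2.
  rewrite wzeta_half_period by assumption. unfold kk.
  replace ((PI * Ci / w1) ^ 2) with (RtoC PI ^ 2 * (Ci * Ci) / (w1 * w1)) by (field; auto).
  rewrite Ci_sq. field. auto.
Qed.

(** Along the cycle the position of [Q] is [sg + t] and that of [P - Q] is [rho - t], so Parseval
    applies and the exponentials combine at [sg + rho]. *)
Lemma RInt_lambda_W (sg rho x z : C) (j l : Z) : (0 < Im sg < Im tau)%R -> (0 < Im rho < Im tau)%R ->
  x = 2 * w1 * (sg + IZR j * tau) -> z - x = 2 * w1 * (rho + IZR l * tau) ->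
  is_cycle_int (fun zQ => lambda w1 w2 c zQ * W w1 w2 z zQ) x (2 * w1)
    (2 * w1 * kk ^ 2 * exp_series (fun n => wp_coef tau n * wp_coef tau n) freq (sg + rho)).
Proof using Hw Ht.
  intros Hs Hr Ex Ez.
  assert (AB : asum (fun n => 2 * w1 * (kk * (wp_coef tau n * Cexp (freq n * rho))))).
  { apply asum_scal, asum_scal, exp_summable_asum, wp_coef_summable, Hr. }
  assert (P := Parseval _ _ (asum_lambda_coef sg Hs) AB).
  assert (Hsr : (0 < Im (sg + rho) < 2 * Im tau)%R) by (rewrite Im_plus; lra).
  replace (2 * w1 * kk ^ 2 * exp_series (fun n => wp_coef tau n * wp_coef tau n) freq (sg + rho)) with
    (usum (fun n => lambda_coef n * Cexp (freq n * sg) * (2 * w1 * (kk * (wp_coef tau n * Cexp (freq n * rho)))))).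
  - unfold is_cycle_int. eapply is_RInt_ext; [|exact P]. intros t _. cbv beta.
    rewrite Ex, <- (lambda_fourier sg j t Hs).
    match goal with |- _ = ?a * ?b * ?d => transitivity (a * (b * d)); [|apply Cmult_assoc] end; f_equal.
    rewrite (W_strip z _ (rho - t) l).
    + match goal with |- _ = ?a * ?b * ?d => transitivity (d * a * b); [|ring] end. unfold exp_series.
      assert (Hr' : (0 < Im (rho - t) < Im tau)%R).
      { replace (Im (rho - t)) with (Im rho) by (unfold Im, Cminus, Cplus, Copp, RtoC; simpl; ring). exact Hr. }
      rewrite <- usum_scal by apply (exp_summable_asum _ _ _ (wp_coef_summable tau _ Hr')). apply usum_ext. intros n.
      replace (freq n * (rho - t)) with (freq n * rho + freq n * RtoC (- t)) by (rewrite RtoC_opp; ring).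
      rewrite Cexp_add. ring.
    + replace (Im (rho - t)) with (Im rho) by (unfold Im, Cminus, Cplus, Copp, RtoC; simpl; ring). exact Hr.
    + rewrite <- Ex. replace (z - (x + t * (2 * w1))) with (z - x - t * (2 * w1)) by ring. rewrite Ez. ring.
  - unfold exp_series. rewrite <- usum_scal by apply (exp_summable_asum _ _ _ (wp_coef_sq_summable tau _ Hsr)). apply usum_ext.
    intros n. unfold lambda_coef. rewrite Cmult_plus_distr_l, Cexp_add.
    destruct (Z.eq_dec n 0) as [->|E].
    + rewrite wp_coef_0. ring.
    + rewrite restrict_false by auto. ring.
Qed.

Lemma phi3_strip (sg rho x z : C) (j l : Z) : (0 < Im sg < Im tau)%R -> (0 < Im rho < Im tau)%R ->
  x = 2 * w1 * (sg + IZR j * tau) -> z - x = 2 * w1 * (rho + IZR l * tau) ->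
  phi3 w1 w2 c x z = 2 * w1 * kk ^ 2 * exp_series (fun n => wp_coef tau n * wp_coef tau n) freq (sg + rho).
Proof using Hw Ht.
  intros Hs Hr Ex Ez. unfold phi3, cycle_int.
  apply (is_RInt_unique (V := C_R_CompleteNormedModule)). exact (RInt_lambda_W sg rho x z j l Hs Hr Ex Ez).
Qed.

(** If the imaginary part were an exact multiple of [Im tau], a real shift along the cycle would
    reach the lattice point with indices [(0, j)]. *)
Lemma avoids_strip (x : C) : avoids_lattice w1 w2 x ->
  exists (j : Z) (sg : C), x = 2 * w1 * (sg + IZR j * tau) /\ (0 < Im sg < Im tau)%R.
Proof using Hw Ht.
  intros Ha. assert (N := two_w1_neq_0).
  destruct (floor_strip (Im (x / (2 * w1))) (Im tau) Ht) as [j Hj].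
  exists j, (x / (2 * w1) - IZR j * tau). split; [field; auto|].
  assert (E : Im (x / (2 * w1) - IZR j * tau) = (Im (x / (2 * w1)) - IZR j * Im tau)%R).
  { replace (x / (2 * w1) - IZR j * tau) with (x / (2 * w1) + RtoC (- IZR j)%R * tau) by (rewrite RtoC_opp; ring).
    rewrite Im_shift. ring. }
  rewrite E. destruct Hj as [[Hj|Hj] Hj2]; [lra|]. exfalso.
  apply (Ha (- Re (x / (2 * w1) - IZR j * tau))%R (0%Z, j)).
  unfold w2. rewrite lattice_pt_tau. cbn [fst snd].
  set (y := x / (2 * w1) - IZR j * tau) in *.
  assert (Ey : y = RtoC (Re y)).
  { rewrite (surjective_pairing y) at 1. unfold RtoC. f_equal. change (snd y) with (Im y). rewrite E, <- Hj. reflexivity. }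
  replace x with (2 * w1 * (y + IZR j * tau)) by (unfold y; field; auto).
  rewrite RtoC_opp, <- Ey. ring.
Qed.

Lemma strip_off_lattice (sg : C) (j : Z) : (0 < Im sg < Im tau)%R -> off_lattice tau (sg + IZR j * tau).
Proof using Ht.
  intros Hs. apply off_lattice_strip; auto.
  - rewrite Rabs_pos_eq; lra.
  - intros m E. rewrite E in Hs. simpl in Hs. lra.
Qed.

Lemma C1_lambda_punctured : exists r, (0 < r)%R /\ forall z, (0 < Cmod z < r)%R -> C1 (lambda w1 w2 c) z.
Proof using Hw Ht.
  assert (N := two_w1_neq_0). assert (P : (0 < Cmod (2 * w1))%R) by (apply Cmod_gt_0; auto).
  destruct (lattice_lower tau 0 Ht) as [d [Hd H]].
  exists (d * Cmod (2 * w1))%R. split; [apply Rmult_lt_0_compat; auto|]. intros z Hz.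
  unfold lambda. apply C1_plus; [|apply C1_const]. apply C1_wp; auto. intros m n E.
  assert (Nz : z <> 0) by (apply Cmod_gt_0; lra).
  assert (Np : nonzero_pair (m, n)).
  { intros X. injection X. intros -> ->. apply Nz.
    replace z with (2 * w1 * (z / (2 * w1))) by (field; auto). rewrite E. ring. }
  specialize (H m n (fun X => lattice_neq_0 tau m n Ht Np (eq_sym X))).
  rewrite <- E in H. replace (0 - z / (2 * w1)) with (- (z * / (2 * w1))) in H by (field; auto).
  rewrite Cmod_opp, Cmod_mult, Cmod_inv in H by auto.
  assert (A := Rabs_pos (IZR m)). assert (B := Rabs_pos (IZR n)).
  assert (H2 : (d <= Cmod z * / Cmod (2 * w1))%R) by nra.
  apply Rmult_le_compat_r with (r := Cmod (2 * w1)) in H2; [|lra].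
  rewrite Rmult_assoc, Rinv_l, Rmult_1_r in H2 by lra. lra.
Qed.

Lemma phi2_strip (zinf : C -> C) (sg z : C) (j : Z) : is_zinf (lambda w1 w2 c) zinf ->
  (0 < Im sg < Im tau)%R -> z = 2 * w1 * (sg + IZR j * tau) ->
  phi2 w1 w2 zinf z = sqrt 2 * (kk * exp_series (wp_coef tau) freq sg).
Proof using Hw Ht.
  intros Hz Hs Ez. unfold phi2. f_equal. apply residue_unique.
  assert (N := two_w1_neq_0). assert (P : (0 < Cmod (2 * w1))%R) by (apply Cmod_gt_0; auto).
  destruct C1_lambda_punctured as [r1 [Hr1 H1]].
  destruct (off_lattice_near tau _ Ht (strip_off_lattice sg j Hs)) as [d [Hd Hn]].
  rewrite <- (W_strip z 0 sg j Hs) by (rewrite Ez; ring).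
  assert (X0 := Rmin_l r1 (d * Cmod (2 * w1))). assert (X1 := Rmin_r r1 (d * Cmod (2 * w1))).
  apply (residue_zinf (lambda w1 w2 c) zinf (W w1 w2 z) (Rmin r1 (d * Cmod (2 * w1)))); auto.
  - apply Rmin_pos; auto. apply Rmult_lt_0_compat; auto.
  - intros y Hy. apply H1. lra.
  - intros y Hy. unfold W. apply C1_plus; [|apply C1_const].
    apply (C1_comp (wp w1 w2) (fun y => z - y)).
    + apply C1_wp; auto. apply Hn.
      replace ((z - y) / (2 * w1) - (sg + IZR j * tau)) with (- (y * / (2 * w1))) by (rewrite Ez; field; auto).
      rewrite Cmod_opp, Cmod_mult, Cmod_inv by auto.
      apply Rmult_lt_reg_r with (Cmod (2 * w1)); auto. rewrite Rmult_assoc, Rinv_l, Rmult_1_r by lra. lra.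
    + apply C1_ext_near with (f := fun y => z + -1 * y) (d := 1%R); [lra|intros; ring|].
      apply C1_plus; [apply C1_const|apply C1_mult; [apply C1_const|apply C1_id]].
Qed.

Lemma usum_opp_index (f : Z -> C) : asum f -> usum (fun n => f (- n)%Z) = usum f.
Proof using Type.
  intros Hf. apply usum_unique.
  apply (proj1 (is_usum_reindex f Z.opp _ ltac:(intros; lia)
     (fun t Hn => False_ind _ (Hn (- t)%Z (Z.opp_involutive t))))), asum_usum, Hf.
Qed.

Lemma freq_opp (n : Z) : freq (- n) = - freq n.
Proof using Type. unfold freq. rewrite opp_IZR, RtoC_opp. ring. Qed.

Lemma x3_integral (zinf : C -> C) (sg x : C) (j : Z) : is_zinf (lambda w1 w2 c) zinf ->
  (0 < Im sg < Im tau)%R -> x = 2 * w1 * (sg + IZR j * tau) ->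
  is_cycle_int (fun z => lambda w1 w2 c z * phi2 w1 w2 zinf z) x (2 * w1)
    (sqrt 2 * (2 * w1 * kk ^ 2 * (2 * qdouble 2 1 tau))).
Proof using Hw Ht.
  intros Hz Hs Ex.
  assert (A0 := exp_summable_asum _ _ _ (wp_coef_summable tau sg Hs)).
  assert (A1 := asum_comp _ Z.opp ltac:(intros; lia) A0). cbv beta in A1.
  assert (P := Parseval _ _ (asum_lambda_coef sg Hs) (asum_scal _ (sqrt 2 * (2 * w1 * kk)) A1)).
  replace (sqrt 2 * (2 * w1 * kk ^ 2 * (2 * qdouble 2 1 tau))) with
    (usum (fun n => lambda_coef n * Cexp (freq n * sg) * (sqrt 2 * (2 * w1 * kk) * (wp_coef tau (- n) * Cexp (freq (- n) * sg))))).
  - unfold is_cycle_int. eapply is_RInt_ext; [|exact P]. intros t _. cbv beta.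
    rewrite Ex, <- (lambda_fourier sg j t Hs).
    match goal with |- _ = ?a * ?b * ?d => transitivity (a * (b * d)); [|apply Cmult_assoc] end; f_equal.
    assert (Hs' : (0 < Im (sg + t) < Im tau)%R) by (rewrite Im_plus; simpl (Im (RtoC t)); lra).
    rewrite (phi2_strip zinf (sg + t) _ j Hz Hs') by ring.
    assert (A2 := exp_summable_asum _ _ _ (wp_coef_summable tau (sg + t) Hs')).
    replace (sqrt 2 * (kk * exp_series (wp_coef tau) freq (sg + t)) * (2 * w1)) with
      (sqrt 2 * (2 * w1 * kk) * exp_series (wp_coef tau) freq (sg + t)) by ring.
    unfold exp_series. rewrite <- (usum_opp_index _ A2).
    rewrite <- usum_scal by apply (asum_comp _ Z.opp ltac:(intros; lia) A2).
    apply usum_ext. intros n. rewrite Cmult_plus_distr_l, Cexp_add.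
    replace (freq (- n) * t) with (freq n * RtoC (- t)) by (rewrite freq_opp, RtoC_opp; ring). ring.
  - apply usum_unique.
    replace (sqrt 2 * (2 * w1 * kk ^ 2 * (2 * qdouble 2 1 tau))) with
      (sqrt 2 * (2 * w1 * kk ^ 2) * (2 * qdouble 2 1 tau)) by ring.
    eapply is_usum_ext; [|apply is_usum_scal, (wp_coef_sum2 tau Ht)]. intros n. cbv beta.
    replace (lambda_coef n * Cexp (freq n * sg) * (sqrt 2 * (2 * w1 * kk) * (wp_coef tau (- n) * Cexp (freq (- n) * sg)))) with
      (lambda_coef n * (sqrt 2 * (2 * w1 * kk) * wp_coef tau (- n)) * (Cexp (freq n * sg) * Cexp (freq (- n) * sg))) by ring.
    rewrite <- Cexp_add. replace (freq n * sg + freq (- n) * sg) with (RtoC 0) by (rewrite freq_opp; ring).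
    rewrite Cexp_0. unfold lambda_coef. destruct (Z.eq_dec n 0) as [->|E].
    + change (- 0)%Z with 0%Z. rewrite wp_coef_0. ring.
    + rewrite restrict_false by auto. ring.
Qed.

Lemma y2_residue (zinf : C -> C) (sg x : C) (j : Z) : is_zinf (lambda w1 w2 c) zinf ->
  (0 < Im sg < Im tau)%R -> x = 2 * w1 * (sg + IZR j * tau) ->
  is_residue (fun z => / zinf z * phi3 w1 w2 c x z) 0 (2 * w1 * kk ^ 2 * (2 * qdouble 2 1 tau)).
Proof using Hw Ht.
  intros Hz Hs Ex. assert (N := two_w1_neq_0). assert (P : (0 < Cmod (2 * w1))%R) by (apply Cmod_gt_0; auto).
  destruct C1_lambda_punctured as [r1 [Hr1 H1]].
  set (d := Rmin (Im sg) (Im tau - Im sg)).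
  assert (Hd : (0 < d)%R) by (apply Rmin_pos; lra).
  assert (D1 := Rmin_l (Im sg) (Im tau - Im sg)). assert (D2 := Rmin_r (Im sg) (Im tau - Im sg)). fold d in D1, D2.
  set (r := Rmin r1 (d * Cmod (2 * w1))).
  assert (X1 := Rmin_l r1 (d * Cmod (2 * w1))). assert (X2 := Rmin_r r1 (d * Cmod (2 * w1))). fold r in X1, X2.
  assert (Hr : (0 < r)%R) by (apply Rmin_pos; auto; apply Rmult_lt_0_compat; auto).
  assert (Him : forall z, (Cmod z < r)%R -> (- d < Im (z / (2 * w1)) < d)%R).
  { intros z Hzr. apply Rabs_lt_between. eapply Rle_lt_trans; [apply im_le_Cmod|]. unfold Cdiv.
    rewrite Cmod_mult, Cmod_inv by auto.
    apply Rmult_lt_reg_r with (Cmod (2 * w1)); auto. rewrite Rmult_assoc, Rinv_l, Rmult_1_r by lra. lra. }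
  assert (F : forall z, (Cmod z < r)%R -> phi3 w1 w2 c x z =
    2 * w1 * kk ^ 2 * exp_series (fun n => wp_coef tau n * wp_coef tau n) freq (/ (2 * w1) * z + tau)).
  { intros z Hzr. assert (Hi := Him z Hzr).
    (* For [z] near [0] the difference [z - x] lies in the strip opposite to that of [x], hence the
       index [- j - 1] and the added [tau]. The series is then evaluated near [tau], in the interior
       of the doubled strip. *)
    rewrite (phi3_strip sg (z / (2 * w1) - sg + tau) x z j (- j - 1)); auto.
    - do 2 f_equal. field. auto.
    - rewrite Im_plus. replace (Im (z / (2 * w1) - sg)) with (Im (z / (2 * w1)) - Im sg)%R by reflexivity. lra.
    - rewrite Ex, minus_IZR, opp_IZR, RtoC_minus, RtoC_opp. field. auto. }
  assert (Z0 : (Cmod 0 < r)%R) by (rewrite Cmod_0; auto).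
  replace (2 * w1 * kk ^ 2 * (2 * qdouble 2 1 tau)) with (phi3 w1 w2 c x 0).
  - apply (residue_zinf (lambda w1 w2 c) zinf (phi3 w1 w2 c x) r); auto.
    + intros z Hzr. apply H1. lra.
    + intros z Hzr. assert (Hi := Him z Hzr).
      apply C1_ext_near with (f := fun z => 2 * w1 * kk ^ 2 * exp_series (fun n => wp_coef tau n * wp_coef tau n) freq (/ (2 * w1) * z + tau)) (d := (r - Cmod z)%R); [lra| |].
      * intros y Hy. symmetry. apply F. assert (T := Cmod_triangle z (y - z)). replace (z + (y - z)) with y in T by ring. lra.
      * apply C1_mult; [apply C1_const|].
        apply (C1_comp (exp_series (fun n => wp_coef tau n * wp_coef tau n) freq) (fun z => / (2 * w1) * z + tau)).
        -- apply exp_series_C1, wp_coef_sq_summable. rewrite Im_plus. replace (/ (2 * w1) * z) with (z / (2 * w1)) by (unfold Cdiv; ring). lra.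
        -- apply C1_plus; [apply C1_mult; [apply C1_const|apply C1_id]|apply C1_const].
  - rewrite (F 0 Z0). f_equal. rewrite Cmult_0_r, Cplus_0_l. apply usum_unique.
    (* At [tau] the series of [a_n^2] is the sum of [a_n a_(-n)], the same as in [x3_integral]; this
       is the source of [x3 = y2]. *)
    eapply is_usum_ext; [|apply (wp_coef_sum2 tau Ht)]. intros n. cbv beta. rewrite (wp_coef_opp tau n Ht). ring.
Qed.

Lemma y3_integral (sg sg' rho x x' : C) (j j' l : Z) :
  (0 < Im sg < Im tau)%R -> (0 < Im sg' < Im tau)%R -> (0 < Im rho < Im tau)%R ->
  x = 2 * w1 * (sg + IZR j * tau) -> x' = 2 * w1 * (sg' + IZR j' * tau) ->
  x' - x = 2 * w1 * (rho + IZR l * tau) ->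
  is_cycle_int (fun z => lambda w1 w2 c z * phi3 w1 w2 c x z) x' (2 * w1)
    ((2 * w1) ^ 2 * kk ^ 3 * qdouble 3 2 tau).
Proof using Hw Ht.
  intros Hs Hs' Hr Ex Ex' Ez. assert (N := two_w1_neq_0).
  set (dd := (j' - j - l)%Z).
  assert (Ed : sg + rho = sg' + IZR dd * tau).
  { assert (E : 2 * w1 * (rho + IZR l * tau) = 2 * w1 * (sg' + IZR j' * tau) - 2 * w1 * (sg + IZR j * tau)) by (rewrite <- Ez, Ex, Ex'; ring).
    replace rho with (/ (2 * w1) * (2 * w1 * (rho + IZR l * tau)) - IZR l * tau) by (field; auto).
    rewrite E. unfold dd. rewrite !minus_IZR, !RtoC_minus. field. auto. }
  (* The point [sg + rho] lies in the doubled strip and [sg'] in the simple one, so they differ by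
     at most one row. *)
  assert (Hd : dd = 0%Z \/ dd = 1%Z).
  { assert (E := f_equal Im Ed). rewrite Im_shift, Im_plus in E.
    assert (L1 : (-1 < IZR dd)%R) by nra. assert (L2 : (IZR dd < 2)%R) by nra.
    apply lt_IZR in L1. apply lt_IZR in L2. lia. }
  assert (Hsr : (0 < Im (sg + rho) < 2 * Im tau)%R) by (rewrite Im_plus; lra).
  assert (A0 := exp_summable_asum _ _ _ (wp_coef_sq_summable tau (sg + rho) Hsr)).
  assert (A1 := asum_comp _ Z.opp ltac:(intros; lia) A0). cbv beta in A1.
  assert (P := Parseval _ _ (asum_lambda_coef sg' Hs') (asum_scal _ ((2 * w1) ^ 2 * kk ^ 2) A1)).
  replace ((2 * w1) ^ 2 * kk ^ 3 * qdouble 3 2 tau) with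
    (usum (fun n => lambda_coef n * Cexp (freq n * sg') * ((2 * w1) ^ 2 * kk ^ 2 * (wp_coef tau (- n) * wp_coef tau (- n) * Cexp (freq (- n) * (sg + rho)))))).
  - unfold is_cycle_int. eapply is_RInt_ext; [|exact P]. intros t _. cbv beta.
    match goal with |- _ = ?a * ?b * ?d => transitivity (a * (b * d)); [|apply Cmult_assoc] end.
    assert (Hr' : (0 < Im (rho + t) < Im tau)%R) by (rewrite Im_plus; simpl (Im (RtoC t)); lra).
    rewrite (phi3_strip sg (rho + t) x _ j l Hs Hr' Ex).
    + rewrite Ex', <- (lambda_fourier sg' j' t Hs'). f_equal.
      assert (Hsr' : (0 < Im (sg + (rho + t)) < 2 * Im tau)%R) by (rewrite !Im_plus in *; simpl (Im (RtoC t)); lra).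
      assert (A2 := exp_summable_asum _ _ _ (wp_coef_sq_summable tau _ Hsr')).
      replace (2 * w1 * kk ^ 2 * exp_series (fun n => wp_coef tau n * wp_coef tau n) freq (sg + (rho + t)) * (2 * w1)) with
        ((2 * w1) ^ 2 * kk ^ 2 * exp_series (fun n => wp_coef tau n * wp_coef tau n) freq (sg + (rho + t))) by ring.
      unfold exp_series. rewrite <- (usum_opp_index _ A2).
      rewrite <- usum_scal by apply (asum_comp _ Z.opp ltac:(intros; lia) A2).
      apply usum_ext. intros n.
      replace (freq (- n) * (sg + (rho + t))) with (freq (- n) * (sg + rho) + freq n * RtoC (- t)) by (rewrite freq_opp, RtoC_opp; ring).
      rewrite Cexp_add. ring.
    + replace (x' + t * (2 * w1) - x) with (x' - x + t * (2 * w1)) by ring. rewrite Ez. ring.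
  - apply usum_unique.
    (* The two possible relative positions of the strips are exchanged by [n -> -n], because
       [wp_coef (-n) = q^n wp_coef n]. *)
    assert (S3 : is_usum (fun n => wp_coef tau n * (wp_coef tau (- n) * wp_coef tau (- n)) * Cexp (freq (- n) * (IZR dd * tau))) (qdouble 3 2 tau)).
    { assert (R : forall f : Z -> C, is_usum f (qdouble 3 2 tau) -> is_usum (fun n => f (- n)%Z) (qdouble 3 2 tau)).
      { intros f. apply (proj1 (is_usum_reindex f Z.opp _ ltac:(intros; lia)
         (fun t Hn => False_ind _ (Hn (- t)%Z (Z.opp_involutive t))))). }
      destruct Hd as [-> | ->].
      - eapply is_usum_ext; [|apply (R _ (wp_coef_sum3 tau Ht))]. intros n. cbv beta.
        rewrite Z.opp_involutive, Cmult_0_l, Cmult_0_r, Cexp_0. ring.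
      - eapply is_usum_ext; [|apply (R _ (wp_coef_sum3' tau Ht))]. intros n. cbv beta.
        rewrite Z.opp_involutive, Cmult_1_l. ring. }
    eapply is_usum_ext; [|apply is_usum_scal, S3]. intros n. cbv beta. rewrite Ed.
    rewrite (Cmult_plus_distr_l (freq (- n)) sg'), Cexp_add.
    replace (freq (- n) * sg') with (- (freq n * sg')) by (rewrite freq_opp; ring). rewrite Cexp_opp.
    assert (Ne := Cexp_neq_0 (freq n * sg')).
    unfold lambda_coef. destruct (Z.eq_dec n 0) as [->|E].
    + change (- 0)%Z with 0%Z. rewrite wp_coef_0. ring.
    + rewrite restrict_false by auto. field. auto.
Qed.

End periods.

Theorem proposition7p3 :
  forall w1 w2 : C,
    let tau := w2 / w1 in
    let t2 := 1 / (sqrt 2 * w1) in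
    w1 <> 0 ->
    (0 < Im tau)%R ->
    (forall (c : C) (zinf : C -> C) (x x' : C),
       let lam := lambda w1 w2 c in
       is_zinf lam zinf ->
       avoids_lattice w1 w2 x ->
       avoids_lattice w1 w2 x' ->
       avoids_lattice w1 w2 (x' - x) ->
       exists x3 y2 y3 : C,
         is_cycle_int (fun z => lam z * phi2 w1 w2 zinf z) x (2 * w1) x3 /\
         (exists r : C,
            is_residue (fun z => / zinf z * phi3 w1 w2 c x z) 0 r /\ y2 = sqrt 2 * r) /\
         is_cycle_int (fun z => lam z * phi3 w1 w2 c x z) x' (2 * w1) y3 /\
         x3 = y2 /\
         y2 = Ci * PI ^ 3 / 3 * t2 ^ 3 * C_derive E2 tau /\
         y3 = - (PI ^ 4 / 6) * t2 ^ 4 * C_derive (C_derive E2) tau) /\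
    (C_differentiable E2 tau /\ C_differentiable (C_derive E2) tau /\
     C_differentiable E4 tau /\ C_differentiable E6 tau) /\
    1 / (2 * PI * Ci) * C_derive E2 tau = 1 / 12 * (E2 tau ^ 2 - E4 tau) /\
    1 / (2 * PI * Ci) * C_derive E4 tau = 1 / 3 * (E2 tau * E4 tau - E6 tau) /\
    1 / (2 * PI * Ci) * C_derive E6 tau = 1 / 2 * (E2 tau * E6 tau - E4 tau ^ 2).
Proof.
  intros w1 w2 tau t2 Hw Ht. split; [|apply Ramanujan_identities, Ht].
  intros c zinf x x' lam Hz Hx Hx' Hxx. unfold lam in *. clear lam.
  assert (Ew2 : w2 = tau * w1) by (unfold tau; field; auto).
  assert (E1 := cderiv_C_derive _ _ _ (E2_cderiv tau Ht)).
  assert (E2' := cderiv_C_derive _ _ _ (C_derive_E2_cderiv tau Ht)).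
  (* With [tau] made opaque, [w2] can be replaced by [tau * w1], the form in which the lattice
     enters every expansion. *)
  rewrite E1, E2'. clear E1 E2'. clearbody tau. subst w2.
  destruct (avoids_strip w1 tau Hw Ht x Hx) as [j [sg [Ex Hs]]].
  destruct (avoids_strip w1 tau Hw Ht x' Hx') as [j' [sg' [Ex' Hs']]].
  destruct (avoids_strip w1 tau Hw Ht _ Hxx) as [l [rho [Ez Hr]]].
  assert (S2 : RtoC (sqrt 2) * RtoC (sqrt 2) = 2) by (rewrite <- RtoC_mult, sqrt_sqrt by lra; reflexivity).
  assert (NS : RtoC (sqrt 2) <> 0).
  { intros E. rewrite E, Cmult_0_l in S2. apply RtoC_inj in S2. lra. }
  eexists. eexists. eexists. split; [|split; [|split; [|split; [|split]]]].
  - exact (x3_integral w1 tau c Hw Ht zinf sg x j Hz Hs Ex).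
  - eexists. split; [exact (y2_residue w1 tau c Hw Ht zinf sg x j Hz Hs Ex)|reflexivity].
  - exact (y3_integral w1 tau c Hw Ht sg sg' rho x x' j j' l Hs Hs' Hr Ex Ex' Ez).
  - reflexivity.
  - unfold t2. set (s := RtoC (sqrt 2)) in *.
    (* By [s * s = 2] an odd power of [t2] keeps one factor [s], which matches the factor [sqrt 2]
       in the definitions of [phi2] and [y2]; the fourth power, for [y3], keeps none. *)
    replace ((1 / (s * w1)) ^ 3) with (s / (4 * w1 ^ 3)).
    + replace (Ci * RtoC PI ^ 3 / 3 * (s / (4 * w1 ^ 3)) * (-24 * (2 * PI * Ci * qdouble 2 1 tau))) with
       (- (Ci * Ci) * (4 * s * RtoC PI ^ 4 * qdouble 2 1 tau / w1 ^ 3)) by (field; auto).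
      replace ((PI * Ci / w1) ^ 2) with (Ci * Ci * (RtoC PI ^ 2 / w1 ^ 2)) by (field; auto).
      rewrite Ci_sq. field. auto.
    + replace ((1 / (s * w1)) ^ 3) with (s / ((s * s) * (s * s) * w1 ^ 3)) by (field; auto).
      rewrite S2. field. auto.
  - unfold t2. set (s := RtoC (sqrt 2)) in *.
    replace ((1 / (s * w1)) ^ 4) with (1 / (4 * w1 ^ 4)).
    + replace (-24 * (2 * PI * Ci) * (2 * PI * Ci * qdouble 3 2 tau)) with ((Ci * Ci) * (-96 * RtoC PI ^ 2 * qdouble 3 2 tau)) by ring.
      replace ((PI * Ci / w1) ^ 2) with (Ci * Ci * (RtoC PI ^ 2 / w1 ^ 2)) by (field; auto).
      rewrite Ci_sq. field. auto.
    + replace ((1 / (s * w1)) ^ 4) with (1 / ((s * s) * (s * s) * w1 ^ 4)) by (field; auto).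
      rewrite S2. field. auto.
Qed.
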